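(* Fix real numbers $\theta$ and $Y$ with $|\theta|<\pi/2$ and $0<Y<\pi|\cot\theta|$ (if $\theta=0$, only $Y>0$ is required). Then, in the region $$ |\operatorname{Im} y |\leq \pi,\quad \operatorname{Re} y \geq -Y,\quad y\notin\beta\mathbb R_{\leq 0},\quad \arg\beta=\theta, $$ one has the following uniform asymptotic expansion as $\beta\rightarrow 0$: $$ \log(e^{-y};e^{-\beta})_\infty \sim-\frac{\operatorname{Li}_2(e^{-y})}{\beta}+\frac{\log(1-e^{-y})}{2}+\frac{\log 2\pi}{2}-\frac{y}{\beta}+\left(\frac{y}{\beta}-\frac{1}{2}\right)\log\left(\frac{y}{\beta}\right) -\log\Gamma\left(\frac{y}{\beta}\right)-\sum_{k=1}^{\infty}\frac{B_{2k}\beta^{2k-1}}{(2k)!}\left(\operatorname{Li}_{2-2k}(e^{-y})-\frac{(2k-2)!}{y^{2k-1}}\right). $$ That is, for every integer $N\ge 1$ there is a constant $D=D(N,Y,\theta)$, independent of $\beta$ and $y$ subject to $|\operatorname{Im} y |\leq \pi$, $\operatorname{Re} y \geq -Y$, $y\notin\beta\mathbb R_{\leq 0}$ and $\arg\beta=\theta$, such that if the sum on the right-hand side is truncated at $k=N$, then the absolute value of the difference between the two sides is at most $D|\beta|^{2N+1}$. Here $\operatorname{Li}_2(e^{-y})$ and $\log(1-e^{-y})$ denote the branches that are real-valued for $y>0$ and analytic for $y\notin\beta\mathbb R_{\leq 0}$ (in the region considered), whereas $\log(y/\beta)$ and $\log\Gamma(y/\beta)$ denote the branches that are real-valued for $y/\beta>0$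 and analytic for $y\notin\beta\mathbb R_{\leq 0}$.
   Context: For $|q|<1$, $(z;q)_\infty=\prod_{j=0}^\infty(1-zq^j)$. For $\operatorname{Re}\beta>0$, the function $y\mapsto(e^{-y};e^{-\beta})_\infty$ vanishes exactly on $2\pi \mathrm{i}\mathbb Z+\beta\mathbb Z_{\le0}$, and $\log(e^{-y};e^{-\beta})_\infty$ denotes the analytic branch of its logarithm on $\mathbb C\setminus(2\pi \mathrm{i}\mathbb Z+\beta\mathbb R_{\le0})$ that tends to $0$ as $\operatorname{Re}y\to+\infty$; for $\operatorname{Re}y>0$ it equals $\sum_{k=0}^\infty\log(1-e^{-y-\beta k})$ with principal logarithms. The Bernoulli numbers $B_k$ are defined by $\frac{1}{e^x-1}=\sum_{k=0}^\infty \frac{B_kx^{k-1}}{k!}$. The polylogarithms are $\operatorname{Li}_n(x)=\sum_{k=1}^\infty x^k/k^n$ for $|x|<1$, $n\in\mathbb Z$, continued analytically; for $n\le0$ they are rational functions with pole only at $x=1$. *)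

(* Defs.v *)
(* Stdlib reals with Coquelicot's complex numbers. *)
From Stdlib Require Export Reals ZArith.
From Coquelicot Require Export Coquelicot.

Open Scope R_scope.

Definition Cexp (z : C) : C :=
  (exp (Re z) * cos (Im z), exp (Re z) * sin (Im z)).

Definition Clim_seq (u : nat -> C) : C :=
  (real (Lim_seq (fun n => Re (u n))), real (Lim_seq (fun n => Im (u n)))).

Fixpoint Cprod (u : nat -> C) (n : nat) : C :=
  match n with
  | O => RtoC 1
  | S m => Cmult (Cprod u m) (u m)
  end.

(* Analytic in the Weierstrass sense: locally the sum of a convergent power
   series. *)
Definition analytic_at (f : C -> C) (z : C) : Prop :=
  exists (a : nat -> C) (r : R), 0 < r /\
    forall h : C, Cmod h < r ->
      @is_pseries C_AbsRing C_NormedModule a h (f (Cplus z h)).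

Definition analytic_on (U : C -> Prop) (f : C -> C) : Prop :=
  forall z : C, U z -> analytic_at f z.

(* A multivalued function enters through a predicate that determines its branch
   uniquely on the (connected) domain in question; values outside the domain are
   unconstrained. *)

Definition log_branch (U : C -> Prop) (F f : C -> C) : Prop :=
  analytic_on U f /\ forall z : C, U z -> Cexp (f z) = F z.

Definition real_on_positives (f : C -> C) : Prop :=
  forall t : R, 0 < t -> Im (f (RtoC t)) = 0.

Definition slit_plane (w : C) : Prop :=
  ~ exists t : R, t <= 0 /\ w = RtoC t.

Definition on_beta_ray (beta y : C) : Prop :=
  exists t : R, t <= 0 /\ y = Cmult beta (RtoC t).

(* The complement of [2 pi i Z + beta R_{<=0}].  If [beta] has argument [theta],
   [|theta| < pi/2] and [Y |tan theta| < pi], the points of this cut set with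
   [|Im y| <= pi] and [Re y >= -Y] are exactly those of [beta R_{<=0}]. *)
Definition cut_domain (beta y : C) : Prop :=
  ~ exists (m : Z) (t : R), t <= 0 /\
      y = Cplus (Cmult (RtoC (2 * PI * IZR m)) Ci) (Cmult beta (RtoC t)).

Definition qpoch (z q : C) : C :=
  Clim_seq (Cprod (fun j => Cminus (RtoC 1) (Cmult z (Cpow q j)))).

Definition is_log_qpoch (beta : C) (f : C -> C) : Prop :=
  log_branch (cut_domain beta)
    (fun y => qpoch (Cexp (Copp y)) (Cexp (Copp beta))) f /\
  forall eps : R, 0 < eps -> exists M : R, forall y : C,
    cut_domain beta y -> M < Re y -> Cmod (f y) < eps.

Definition is_bernoulli (B : nat -> R) : Prop :=
  exists r : R, 0 < r /\ forall x : R, x <> 0 -> Rabs x < r ->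
    is_series (fun k => B k * powerRZ x (Z.of_nat k - 1) / INR (fact k))
              (/ (exp x - 1)).

(* [l] is the sum of [x^k / k^n] over [k >= 1]; the index is shifted by one. *)
Definition is_polylog_series (n : Z) (x l : C) : Prop :=
  @is_series C_AbsRing C_NormedModule
    (fun k => Cdiv (Cpow x (S k)) (RtoC (powerRZ (INR (S k)) n))) l.

(* For [n <= 0]: the single-valued continuation to [C \ {1}]. *)
Definition is_polylog_nonpos (n : Z) (f : C -> C) : Prop :=
  analytic_on (fun x => x <> RtoC 1) f /\
  forall x : C, Cmod x < 1 -> is_polylog_series n x (f x).

(* [f y] is the continuation of [Li_2 (e^{-y})] from [Re y > 0], where the series
   converges; in particular it is real for [y > 0]. *)
Definition is_Li2_exp_branch (beta : C) (f : C -> C) : Prop :=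
  analytic_on (cut_domain beta) f /\
  forall y : C, 0 < Re y -> is_polylog_series 2 (Cexp (Copp y)) (f y).

Definition is_log_1m_exp_branch (beta : C) (f : C -> C) : Prop :=
  log_branch (cut_domain beta)
    (fun y => Cminus (RtoC 1) (Cexp (Copp y))) f /\
  real_on_positives f.

(* Gauss's formula [lim n! n^z / (z (z+1) ... (z+n))], valid at every [z] that is
   not a nonpositive integer.  The sequence starts at [n = 1]. *)
Definition CGamma (z : C) : C :=
  Clim_seq (fun m => let n := S m in
    Cdiv (Cmult (RtoC (INR (fact n))) (Cexp (Cmult z (RtoC (ln (INR n))))))
         (Cprod (fun k => Cplus z (RtoC (INR k))) (S n))).

Definition is_log_slit (f : C -> C) : Prop :=
  log_branch slit_plane (fun w => w) f /\ real_on_positives f.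

Definition is_log_Gamma_slit (f : C -> C) : Prop :=
  log_branch slit_plane CGamma f /\ real_on_positives f.

Definition has_arg (beta : C) (theta : R) : Prop :=
  exists r : R, 0 < r /\ beta = (r * cos theta, r * sin theta).

(* Main.v *)
Require Import Defs.
From Stdlib Require Import Lra Lia Classical Ranalysis5.

(** The difference [E(y)] between the two sides of the expansion is treated by
    telescoping along [y], [y + beta], [y + 2 beta], ... rather than by summing
    a series of logarithms.

    Three functional equations are used: [LogQ y - LogQ (y + beta)] is
    [log(1 - e^{-y})] ([LogQ_step]); the derivative of [Li_2(e^{-y})] is
    [log(1 - e^{-y})] ([Li2_derive]); and [log Gamma] minus Stirling's main terms
    satisfies the difference equation of [stir_rem_step], with limit [0] at
    infinity ([stir_rem_bound]). Together they show that [E(y) - E(y + beta)] is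
    exactly the error of one step of the Euler-Maclaurin formula for
    [f(s) = log(1 - e^{-(y + s beta)}) - log(y/beta + s)] on [0 <= s <= 1]. The
    logarithmic singularities of the two terms at [y + s beta = 0] cancel: the
    derivatives of [f] are [beta^j] times those of [1/(e^z - 1) - 1/z], which is
    analytic at [0]. That is why the estimate is uniform up to the cut, where
    neither Stirling's formula nor the expansion of the q-product is uniform on
    its own.

    One step of order [2N+2] ([euler_maclaurin_step]) costs at most a constant
    times the integral of [|beta|^(2N+2) |g(y + s beta)|] over [0 <= s <= 1], where
    [g] is the derivative of order [2N+1] of [1/(e^z - 1) - 1/z]. By
    [polefree_bounded_swept], [|g(z)| <= M / (1 + (Re z)^2)] on all rays of direction
    [beta] issued from the region, so the steps add up to a difference of values
    of the arctangent, and one factor [|beta|] is absorbed because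
    [Re beta = |beta| cos theta]. The condition on [Y] enters only here: it keeps
    these rays at a positive distance from the poles [2 pi i m], [m <> 0]
    ([swept_away]). Finally [E(y + n beta)] tends to [0] ([remainder_limit]).

    The remaining work identifies the given branches. Two logarithms of the same
    function differ by a multiple of [2 pi i], which is constant along a path by
    continuity ([stays_inside]) and is determined at one end. Relations between
    functions given only on the half-plane [Re y > 0] or in the unit disc are
    continued along segments by the identity theorem for real-analytic functions
    ([Ranalytic_identity]). *)

(** * The complex exponential *)

Ltac csimp := unfold Cexp, Cminus, Cdiv, Cplus, Copp, Cmult, Cconj, RtoC, Re, Im; simpl.
Ltac csimp_ring := csimp; ring.

Lemma C_eq (a b : C) : Re a = Re b -> Im a = Im b -> a = b.
Proof. destruct a, b; simpl; congruence. Qed.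

Lemma Cexp_plus a b : Cexp (a + b) = (Cexp a * Cexp b)%C.
Proof.
  apply C_eq; csimp; rewrite exp_plus, ?cos_plus, ?sin_plus; ring.
Qed.

Lemma Cexp_0 : Cexp 0 = 1.
Proof. apply C_eq; csimp; rewrite exp_0, ?cos_0, ?sin_0; ring. Qed.

Lemma Cmod_Cexp z : Cmod (Cexp z) = exp (Re z).
Proof.
  unfold Cmod, Cexp; simpl.
  replace (_ + _) with (exp (Re z) ^ 2 * (Rsqr (sin (Im z)) + Rsqr (cos (Im z))))
    by (unfold Rsqr; ring).
  rewrite sin2_cos2, Rmult_1_r. apply sqrt_pow2. left; apply exp_pos.
Qed.

Lemma Cexp_neq_0 z : Cexp z <> 0.
Proof.
  intros H. apply (f_equal Cmod) in H. rewrite Cmod_Cexp, Cmod_0 in H.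
  pose proof (exp_pos (Re z)); lra.
Qed.

Lemma Cexp_opp z : Cexp (- z) = (/ Cexp z)%C.
Proof.
  assert (H : (Cexp z * Cexp (- z) = 1)%C).
  { rewrite <- Cexp_plus, <- Cexp_0. f_equal. ring. }
  pose proof (Cexp_neq_0 z).
  replace (Cexp (- z)) with ((Cexp z * Cexp (-z)) / Cexp z)%C by (field; auto).
  rewrite H. field; auto.
Qed.

Lemma Cexp_minus a b : Cexp (a - b) = (Cexp a / Cexp b)%C.
Proof. unfold Cminus, Cdiv. now rewrite Cexp_plus, Cexp_opp. Qed.

Lemma Cexp_RtoC t : Cexp (RtoC t) = RtoC (exp t).
Proof. apply C_eq; csimp; rewrite ?cos_0, ?sin_0; ring. Qed.

Lemma Cexp_eq_1 z : Cexp z = 1 -> Re z = 0 /\ exists k : Z, Im z = 2 * PI * IZR k.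
Proof.
  intros H.
  assert (R0 : Re z = 0).
  { apply (f_equal Cmod) in H. rewrite Cmod_Cexp, Cmod_1 in H.
    apply exp_inv. now rewrite exp_0. }
  split; auto.
  pose proof (f_equal Re H) as Hc. pose proof (f_equal Im H) as Hs.
  simpl in Hc, Hs. rewrite R0, exp_0 in Hc, Hs. rewrite Rmult_1_l in Hc, Hs.
  destruct (sin_eq_0_0 (Im z / 2)) as [k Hk].
  - assert (E : cos (2 * (Im z / 2)) = 1) by (rewrite <- Hc; f_equal; field).
    rewrite cos_2a_sin in E. nra.
  - exists k. lra.
Qed.

Lemma Cmod_le_ReIm z : Cmod z <= Rabs (Re z) + Rabs (Im z).
Proof.
  replace z with (RtoC (Re z) + RtoC (Im z) * Ci)%C at 1
    by (apply C_eq; csimp; ring).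
  eapply Rle_trans; [apply Cmod_triangle|].
  rewrite Cmod_mult, !Cmod_R, Cmod_Ci. lra.
Qed.

Lemma im_le_Cmod z : Rabs (Im z) <= Cmod z.
Proof. eapply Rle_trans; [|apply Rmax_Cmod]. apply Rmax_r. Qed.

Lemma Re_le_Cmod z : Re z <= Cmod z.
Proof. pose proof (re_le_Cmod z). pose proof (Rle_abs (Re z)). lra. Qed.

Lemma Cmod_minus_sym a b : Cmod (a - b) = Cmod (b - a).
Proof. rewrite <- Cmod_opp. f_equal. ring. Qed.

Lemma Cmod_ge_minus a b : Cmod a - Cmod b <= Cmod (a + b).
Proof.
  pose proof (Cmod_triangle (a + b) (- b)) as H. rewrite Cmod_opp in H.
  replace (a + b + - b)%C with a in H by ring. lra.
Qed.

(** * Complex-valued functions of a real variable *)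

(** Componentwise, so that the real theory of derivatives applies directly. *)
Definition Cderive (phi : R -> C) (s : R) (l : C) : Prop :=
  is_derive (fun t => Re (phi t)) s (Re l) /\
  is_derive (fun t => Im (phi t)) s (Im l).

Definition Ccont (phi : R -> C) (s : R) : Prop :=
  continuity_pt (fun t => Re (phi t)) s /\ continuity_pt (fun t => Im (phi t)) s.

Lemma Cderive_eq phi s l l' : Cderive phi s l -> l = l' -> Cderive phi s l'.
Proof. intros H E; now rewrite <- E. Qed.

Lemma Cderive_ext phi psi s l : (forall t, phi t = psi t) -> Cderive phi s l -> Cderive psi s l.
Proof.
  intros E [H1 H2]; split; eapply is_derive_ext; try eassumption;
  intros t; simpl; now rewrite E.
Qed.

Lemma Cderive_ext_loc phi psi s l : locally s (fun t => phi t = psi t) ->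
  Cderive phi s l -> Cderive psi s l.
Proof.
  intros E [H1 H2]; split; eapply is_derive_ext_loc; try eassumption;
  (eapply filter_imp; [|exact E]); intros t Ht; simpl; now rewrite Ht.
Qed.

Lemma Cderive_unique phi s l l' : Cderive phi s l -> Cderive phi s l' -> l = l'.
Proof.
  intros [A B] [A' B']. apply is_derive_unique in A, B, A', B'.
  apply C_eq; congruence.
Qed.

Lemma Cderive_const c s : Cderive (fun _ => c) s 0.
Proof. split; apply @is_derive_const. Qed.

Lemma Cderive_plus f g s a b : Cderive f s a -> Cderive g s b -> Cderive (fun t => f t + g t)%C s (a + b)%C.
Proof. intros [] []; split; apply @is_derive_plus; auto. Qed.

Lemma Cderive_opp f s a : Cderive f s a -> Cderive (fun t => - f t)%C s (- a)%C.
Proof. intros []; split; apply @is_derive_opp; auto. Qed.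

Lemma Cderive_minus f g s a b : Cderive f s a -> Cderive g s b -> Cderive (fun t => f t - g t)%C s (a - b)%C.
Proof. intros. apply Cderive_plus; auto. now apply Cderive_opp. Qed.

Lemma Cderive_mult f g s a b : Cderive f s a -> Cderive g s b ->
  Cderive (fun t => f t * g t)%C s (a * g s + f s * b)%C.
Proof.
  intros [H1 H2] [H3 H4]; split.
  - apply (is_derive_ext (fun t => Re (f t) * Re (g t) - Im (f t) * Im (g t)));
      [reflexivity|].
    replace (Re _) with (minus (Re a * Re (g s) + Re (f s) * Re b)
      (Im a * Im (g s) + Im (f s) * Im b)) by (unfold minus, plus, opp; csimp_ring).
    apply @is_derive_minus; apply Derive.is_derive_mult; auto.
  - apply (is_derive_ext (fun t => Re (f t) * Im (g t) + Im (f t) * Re (g t)));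
      [reflexivity|].
    replace (Im _) with (plus (Re a * Im (g s) + Re (f s) * Im b)
      (Im a * Re (g s) + Im (f s) * Re b)) by (unfold plus; csimp_ring).
    apply @is_derive_plus; apply Derive.is_derive_mult; auto.
Qed.

Lemma Cderive_scal c f s a : Cderive f s a -> Cderive (fun t => c * f t)%C s (c * a)%C.
Proof.
  intros H. eapply Cderive_eq; [apply Cderive_mult; [apply Cderive_const|exact H]|]. apply C_eq; csimp_ring.
Qed.

Lemma Cderive_inv f s a : Cderive f s a -> f s <> 0 ->
  Cderive (fun t => / f t)%C s (- a / (f s * f s))%C.
Proof.
  intros [H1 H2] Hn.
  assert (N : Re (f s) * Re (f s) + Im (f s) * Im (f s) <> 0).
  { intros E. apply Hn. apply C_eq; simpl; nra. }
  assert (HN : is_derive (fun t => Re (f t) * Re (f t) + Im (f t) * Im (f t)) s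
    ((Re a * Re (f s) + Re (f s) * Re a) + (Im a * Im (f s) + Im (f s) * Im a))).
  { apply @is_derive_plus; apply Derive.is_derive_mult; auto. }
  split.
  - apply (is_derive_ext (fun t => Re (f t) / (Re (f t) * Re (f t) + Im (f t) * Im (f t)))).
    { intros t. csimp. unfold Rdiv. f_equal. f_equal. ring. }
    evar_last; [apply Derive.is_derive_div; [exact H1|exact HN|exact N]|].
    csimp. unfold Re, Im in N. field. split; [|exact N]. simpl.
    intros E. apply N. nra.
  - apply (is_derive_ext (fun t => - Im (f t) / (Re (f t) * Re (f t) + Im (f t) * Im (f t)))).
    { intros t. csimp. unfold Rdiv. f_equal. f_equal. ring. }
    evar_last; [apply Derive.is_derive_div; [apply @is_derive_opp; exact H2|exact HN|exact N]|].
    unfold opp; csimp. unfold Re, Im in N. field. split; [|exact N]. simpl.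
    intros E. apply N. nra.
Qed.

Lemma Cderive_exp f s a : Cderive f s a -> Cderive (fun t => Cexp (f t)) s (a * Cexp (f s))%C.
Proof.
  intros [H1 H2].
  assert (E := is_derive_comp exp (fun t => Re (f t)) s _ _ (is_derive_exp _) H1).
  assert (Co := is_derive_comp cos (fun t => Im (f t)) s _ _ (is_derive_cos _) H2).
  assert (Si := is_derive_comp sin (fun t => Im (f t)) s _ _ (is_derive_sin _) H2).
  split; (evar_last; [eapply Derive.is_derive_mult; [exact E|eassumption]|]);
    unfold scal; simpl; unfold mult; simpl; csimp_ring.
Qed.

Lemma Cderive_real g s l : is_derive g s l -> Cderive (fun t => RtoC (g t)) s (RtoC l).
Proof. intros; split; simpl; auto. apply @is_derive_const. Qed.

Lemma Cderive_line z d s : Cderive (fun t => z + RtoC t * d)%C s d.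
Proof. split; csimp; auto_derive; auto; ring. Qed.

Lemma Ccont_of_Cderive f s l : Cderive f s l -> Ccont f s.
Proof.
  intros [H1 H2]; split; apply derivable_continuous_pt.
  - exists (Re l). now apply is_derive_Reals.
  - exists (Im l). now apply is_derive_Reals.
Qed.

Lemma Ccont_const c s : Ccont (fun _ => c) s.
Proof. eapply Ccont_of_Cderive, Cderive_const. Qed.

Lemma Ccont_plus f g s : Ccont f s -> Ccont g s -> Ccont (fun t => f t + g t)%C s.
Proof.
  intros [A B] [A' B']; split.
  - exact (continuity_pt_plus _ _ _ A A').
  - exact (continuity_pt_plus _ _ _ B B').
Qed.

Lemma Ccont_opp f s : Ccont f s -> Ccont (fun t => - f t)%C s.
Proof.
  intros [A B]; split; [exact (continuity_pt_opp _ _ A)|exact (continuity_pt_opp _ _ B)].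
Qed.

Lemma Ccont_minus f g s : Ccont f s -> Ccont g s -> Ccont (fun t => f t - g t)%C s.
Proof. intros. apply Ccont_plus; auto. now apply Ccont_opp. Qed.

Lemma Ccont_mult f g s : Ccont f s -> Ccont g s -> Ccont (fun t => f t * g t)%C s.
Proof.
  intros [A B] [A' B']; split.
  - exact (continuity_pt_minus _ _ _ (continuity_pt_mult _ _ _ A A')
      (continuity_pt_mult _ _ _ B B')).
  - exact (continuity_pt_plus _ _ _ (continuity_pt_mult _ _ _ A B')
      (continuity_pt_mult _ _ _ B A')).
Qed.

Lemma Ccont_ext f g s : (forall t, f t = g t) -> Ccont f s -> Ccont g s.
Proof.
  intros E [A B]; split.
  - apply (continuity_pt_ext (fun t => Re (f t))); auto. intros t; now rewrite E.
  - apply (continuity_pt_ext (fun t => Im (f t))); auto. intros t; now rewrite E.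
Qed.

Lemma monotone_of_derive (g g' : R -> R) a b : a <= b ->
  (forall s, a <= s <= b -> continuity_pt g s) ->
  (forall s, a < s < b -> is_derive g s (g' s)) ->
  (forall s, a < s < b -> 0 <= g' s) -> g a <= g b.
Proof.
  intros Hab Hc Hd Hp. destruct (Rle_lt_or_eq_dec a b Hab) as [Lt|Eq]; [|subst; lra].
  assert (pr1 : forall c, a < c < b -> derivable_pt g c).
  { intros c Hc'. exists (g' c). apply is_derive_Reals; auto. }
  assert (pr2 : forall c, a < c < b -> derivable_pt id c) by (intros ? _; apply derivable_pt_id).
  destruct (MVT g id a b pr1 pr2 Lt Hc) as (c & P & E).
  { intros ? _; apply derivable_continuous_pt, derivable_pt_id. }
  rewrite (derive_pt_eq_0 _ _ _ (pr1 c P) (proj1 (is_derive_Reals _ _ _) (Hd c P))) in E.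
  rewrite (derive_pt_eq_0 _ _ _ (pr2 c P) (derivable_pt_lim_id c)) in E.
  unfold id in E. pose proof (Hp c P). nra.
Qed.

(** Projecting on the direction of the increment reduces the complex mean value
    inequality to the monotonicity of a real function. *)
Lemma mean_value_ineq (phi phi' : R -> C) (A A' : R -> R) a b : a <= b ->
  (forall s, a <= s <= b -> Ccont phi s) -> (forall s, a <= s <= b -> continuity_pt A s) ->
  (forall s, a < s < b -> Cderive phi s (phi' s)) ->
  (forall s, a < s < b -> is_derive A s (A' s)) ->
  (forall s, a < s < b -> Cmod (phi' s) <= A' s) ->
  Cmod (phi b - phi a) <= A b - A a.
Proof.
  intros Hab Hc HcA Hd HdA Hb.
  assert (M : A a <= A b).
  { apply (monotone_of_derive A A'); auto.
    intros s Hs. eapply Rle_trans; [apply Cmod_ge_0|]; auto. }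
  set (c := (phi b - phi a)%C). set (m := Cmod c).
  destruct (Req_dec m 0) as [E|NE]; [lra|].
  assert (P : 0 < m) by (pose proof (Cmod_ge_0 c); fold m in H; lra).
  assert (Hm : m ^ 2 = Re c ^ 2 + Im c ^ 2) by apply Cmod2_alt.
  assert (G : m * A a - (Re c * Re (phi a) + Im c * Im (phi a)) <=
              m * A b - (Re c * Re (phi b) + Im c * Im (phi b))).
  { apply (monotone_of_derive
      (fun s => m * A s - (Re c * Re (phi s) + Im c * Im (phi s)))
      (fun s => m * A' s - (Re c * Re (phi' s) + Im c * Im (phi' s)))); auto.
    - intros s Hs. destruct (Hc s Hs).
      apply continuity_pt_minus; [|apply continuity_pt_plus];
        apply continuity_pt_scal; auto.
    - intros s Hs. destruct (Hd s Hs).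
      apply @is_derive_minus; [|apply @is_derive_plus];
        apply is_derive_scal; auto.
    - intros s Hs. pose proof (Hb s Hs).
      pose proof (Re_le_Cmod (Cconj c * phi' s)) as Q.
      rewrite Cmod_mult, Cmod_conj in Q. fold m in Q.
      replace (Re (Cconj c * phi' s)) with (Re c * Re (phi' s) + Im c * Im (phi' s)) in Q
        by csimp_ring.
      nra. }
  assert (E : Re c * (Re (phi b) - Re (phi a)) + Im c * (Im (phi b) - Im (phi a)) = m ^ 2).
  { rewrite Hm. unfold c. csimp_ring. }
  nra.
Qed.

(** How a branch is pinned down: a logarithm of [1] has its imaginary part in
    [2 pi Z], hence away from [pi] and [-pi], so along a path it is [0] everywhere
    as soon as it is small once. *)
Lemma stays_inside (v : R -> R) a b c :
  (forall s, Rmin a b <= s <= Rmax a b -> continuity_pt v s) ->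
  (forall s, Rmin a b <= s <= Rmax a b -> Rabs (v s) <> c) ->
  Rabs (v a) < c -> Rabs (v b) < c.
Proof.
  intros Hc Hn Ha.
  destruct (Rlt_le_dec (Rabs (v b)) c) as [|Hb]; auto. exfalso.
  assert (Hb' : c < Rabs (v b)).
  { destruct Hb as [|E]; auto. symmetry in E. exfalso. revert E. apply Hn.
    split; [apply Rmin_r|apply Rmax_r]. }
  assert (Cg : forall s, Rmin a b <= s <= Rmax a b ->
    continuity_pt (fun s => Rabs (v s) - c) s).
  { intros s Hs. apply continuity_pt_minus; [|apply continuity_pt_const; easy].
    apply (continuity_pt_comp v Rabs); auto. apply Rcontinuity_abs. }
  destruct (Rtotal_order a b) as [L|[E|L]].
  - rewrite Rmin_left, Rmax_right in * by lra.
    destruct (IVT_interv (fun s => Rabs (v s) - c) a b Cg L) as (z & Hz & Ez); try lra.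
    apply (Hn z Hz); lra.
  - subst; lra.
  - rewrite Rmin_right, Rmax_left in * by lra.
    destruct (IVT_interv (fun s => - (Rabs (v s) - c)) b a) as (z & Hz & Ez); try lra.
    + intros; apply (continuity_pt_opp (fun s => Rabs (v s) - c)); auto.
    + apply (Hn z Hz); lra.
Qed.

Lemma two_pi_Z_small (x : R) (k : Z) : x = 2 * PI * IZR k -> Rabs x < PI -> x = 0.
Proof.
  intros E H. pose proof PI_RGT_0.
  destruct (Z.eq_dec k 0) as [->|N]; [rewrite E; ring|].
  exfalso. assert (1 <= Rabs (IZR k)).
  { rewrite <- abs_IZR. apply IZR_le. lia. }
  rewrite E, !Rabs_mult, (Rabs_right 2), (Rabs_right PI) in H by lra. nra.
Qed.

Lemma two_pi_Z_neq_pi (x : R) (k : Z) : x = 2 * PI * IZR k -> Rabs x <> PI.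
Proof.
  intros E H. pose proof PI_RGT_0.
  rewrite E, !Rabs_mult, (Rabs_right 2), (Rabs_right PI), <- abs_IZR in H by lra.
  assert (2 * IZR (Z.abs k) = 1) by nra.
  rewrite <- mult_IZR in H1. apply eq_IZR in H1. lia.
Qed.

(** * Analytic functions restricted to lines *)

Lemma is_series_Re (u : nat -> C) l :
  @is_series C_AbsRing C_NormedModule u l -> is_series (fun n => Re (u n)) (Re l).
Proof.
  intros H. eapply filterlim_ext; [|eapply filterlim_comp; [exact H|]].
  2: { destruct l. apply (@continuous_fst R_UniformSpace R_UniformSpace). }
  intros n. induction n as [|n IH]; [now rewrite !sum_O|].
  rewrite !sum_Sn, <- IH. reflexivity.
Qed.

Lemma is_series_Im (u : nat -> C) l :
  @is_series C_AbsRing C_NormedModule u l -> is_series (fun n => Im (u n)) (Im l).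
Proof.
  intros H. eapply filterlim_ext; [|eapply filterlim_comp; [exact H|]].
  2: { destruct l. apply (@continuous_snd R_UniformSpace R_UniformSpace). }
  intros n. induction n as [|n IH]; [now rewrite !sum_O|].
  rewrite !sum_Sn, <- IH. reflexivity.
Qed.

Definition Ranalytic (g : R -> R) (s0 : R) : Prop :=
  exists (a : nat -> R) (r : R), 0 < r /\
    forall h, Rabs h < r -> is_pseries a h (g (s0 + h)).

Lemma CV_radius_ge (a : nat -> R) (r : R) (g : R -> R) :
  (forall h, Rabs h < r -> is_pseries a h (g h)) -> Rbar_le r (CV_radius a).
Proof.
  intros H. apply Rbar_not_lt_le. intros L.
  assert (P := CV_radius_ge_0 a).
  destruct (CV_radius a) as [c| |] eqn:E; simpl in *; try easy.
  assert (A : Rabs ((c + r) / 2) = (c + r) / 2) by (apply Rabs_right; lra).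
  apply (CV_disk_outside a ((c + r) / 2)).
  - rewrite E; simpl. rewrite A. lra.
  - apply ex_series_lim_0. exists (g ((c + r) / 2)).
    apply is_pseries_R, H. rewrite A; lra.
Qed.

Lemma Ranalytic_PSeries g s0 : Ranalytic g s0 -> exists a (r : posreal), Rbar_le r (CV_radius a) /\
  forall h, Rabs h < r -> g (s0 + h) = PSeries a h.
Proof.
  intros (a & r & Hr & H). exists a, (mkposreal r Hr). split; simpl.
  - now apply (CV_radius_ge a r (fun h => g (s0 + h))).
  - intros h Hh. symmetry. now apply is_pseries_unique, H.
Qed.

(** Dividing by [h] and letting [h] tend to [0+] strips the coefficients one at a
    time, so one-sided vanishing suffices. *)
Lemma PSeries_zero_right (a : nat -> R) (d : R) : 0 < d -> Rbar_lt 0 (CV_radius a) ->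
  (forall h, 0 < h < d -> PSeries a h = 0) -> forall n, a n = 0.
Proof.
  intros Hd Hr Hz n. revert a Hr Hz.
  assert (Z : forall a, Rbar_lt 0 (CV_radius a) ->
    (forall h, 0 < h < d -> PSeries a h = 0) -> a 0%nat = 0).
  { intros a Hr Hz.
    assert (Hc : continuity_pt (PSeries a) 0).
    { apply PSeries_continuity. now rewrite Rabs_R0. }
    destruct (Req_dec (a 0%nat) 0) as [|N]; auto. exfalso.
    destruct (Hc (Rabs (a 0%nat))) as (al & Hal & H); [now apply Rabs_pos_lt|].
    pose proof (Rmin_l al d). pose proof (Rmin_r al d).
    assert (0 < Rmin al d) by (apply Rmin_pos; lra).
    specialize (H (Rmin al d / 2)). simpl in H.
    rewrite PSeries_0, Hz in H by lra. unfold Rdist in H.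
    rewrite Rminus_0_l, Rabs_Ropp in H.
    apply (Rlt_irrefl (Rabs (a 0%nat))), H. split.
    - split; [exact I|]. lra.
    - rewrite Rminus_0_r, Rabs_right; lra. }
  induction n as [|n IH]; intros a Hr Hz; [auto|].
  change (a (S n)) with (PS_decr_1 a n).
  apply IH; [now rewrite CV_radius_decr_1|].
  intros h Hh.
  destruct (Rbar_lt_le_dec h (CV_radius a)) as [L|L].
  - pose proof (PSeries_decr_1 a h) as E. rewrite Z, Hz in E by auto.
    assert (0 = 0 + h * PSeries (PS_decr_1 a) h) as E'.
    { apply E. apply CV_radius_inside. rewrite Rabs_right by lra. auto. }
    assert (h * PSeries (PS_decr_1 a) h = 0) as E2 by lra.
    apply Rmult_integral in E2. destruct E2; [lra|auto].
  - rewrite <- (Rmult_1_l (PSeries _ _)), <- (Rinv_l h) by lra.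
    rewrite Rmult_assoc, <- PSeries_decr_1_aux, Hz by auto. ring.
Qed.

(** The infimum of the points beyond which a real-analytic function vanishes
    can only be the left end: at that infimum the Taylor coefficients are
    forced to be zero by the values on the right. *)
Lemma Ranalytic_identity (g : R -> R) a b e : a < b -> 0 < e ->
  (forall s, a <= s <= b -> Ranalytic g s) ->
  (forall s, b - e < s < b -> g s = 0) -> forall s, a <= s < b -> g s = 0.
Proof.
  intros Hab He HA Hz.
  set (E := fun t => 0 <= t <= b - a /\ forall s, b - t < s < b -> g s = 0).
  assert (E0 : E (Rmin e (b - a))).
  { split; [split; [apply Rmin_glb; lra|apply Rmin_r]|].
    intros s Hs. pose proof (Rmin_l e (b - a)). apply Hz. lra. }
  destruct (completeness E) as (T & HT1 & HT2).
  - exists (b - a). intros t [Ht _]. lra.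
  - eexists; exact E0.
  - assert (T1 : T <= b - a) by (apply HT2; intros t [Ht _]; lra).
    assert (T0 : 0 < T).
    { apply Rlt_le_trans with (Rmin e (b - a)); [apply Rmin_pos; lra|now apply HT1]. }
    assert (ZT : forall s, b - T < s < b -> g s = 0).
    { intros s Hs. destruct (classic (exists t, E t /\ b - s < t)) as [(t & [_ Ht] & L)|N].
      - apply Ht. lra.
      - exfalso. assert (T <= b - s); [|lra]. apply HT2. intros t Ht.
        apply Rnot_lt_le. intros L. apply N. now exists t. }
    destruct (Ranalytic_PSeries g (b - T)) as (c & r & Hr & Hc); [apply HA; lra|].
    pose proof (cond_pos r).
    assert (Cz : forall n, c n = 0).
    { apply (PSeries_zero_right c (Rmin r T)).
      - apply Rmin_pos; lra.
      - eapply Rbar_lt_le_trans; [|exact Hr]. simpl; lra.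
      - intros h Hh. pose proof (Rmin_l r T). pose proof (Rmin_r r T).
        rewrite <- Hc by (rewrite Rabs_right; lra). apply ZT. lra. }
    assert (Zr : forall h, Rabs h < r -> g (b - T + h) = 0).
    { intros h Hh. rewrite Hc by auto.
      rewrite (PSeries_ext _ (fun _ => 0)) by auto. apply PSeries_const_0. }
    assert (TE : T = b - a).
    { destruct (Rle_lt_or_eq_dec _ _ T1) as [L|]; auto. exfalso.
      pose proof (Rmin_l (r / 2) (b - a - T)). pose proof (Rmin_r (r / 2) (b - a - T)).
      set (m := Rmin (r / 2) (b - a - T)) in *.
      assert (0 < m) by (apply Rmin_pos; lra).
      assert (T + m <= T); [|lra].
      apply HT1. split; [lra|]. intros s Hs.
      destruct (Rlt_le_dec (b - T) s); [apply ZT; lra|].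
      replace s with (b - T + (s - (b - T))) by ring.
      apply Zr. rewrite Rabs_left1; lra. }
    intros s Hs. destruct (Req_dec s a) as [->|].
    + replace a with (b - T + 0) by lra. apply Zr. rewrite Rabs_R0; lra.
    + apply ZT. lra.
Qed.

Lemma Ranalytic_derive g s0 : Ranalytic g s0 -> Ranalytic (Derive g) s0.
Proof.
  intros H. destruct (Ranalytic_PSeries g s0 H) as (a & r & Hr & E).
  exists (PS_derive a), r. split; [apply cond_pos|]. intros h Hh.
  assert (L : Rbar_lt (Rabs h) (CV_radius a)) by (eapply Rbar_lt_le_trans; [|exact Hr]; auto).
  replace (Derive g (s0 + h)) with (Derive (PSeries a) h); [now apply is_pseries_derive|].
  rewrite <- (Derive_ext_loc (fun t => g (s0 + t))).
  - unfold Derive. apply f_equal, Lim_ext. intros t. do 3 f_equal. ring.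
  - assert (P : 0 < r - Rabs h) by lra. exists (mkposreal _ P). intros t Ht.
    apply E. change (Rabs (t - h) < r - Rabs h) in Ht.
    pose proof (Rabs_triang_inv t h). lra.
Qed.

Lemma Ranalytic_ex_derive g s0 : Ranalytic g s0 -> ex_derive g s0.
Proof.
  intros H. destruct (Ranalytic_PSeries g s0 H) as (a & r & Hr & E).
  apply (ex_derive_ext_loc (fun s => PSeries a (s - s0))).
  - exists r. intros t Ht. change (Rabs (t - s0) < r) in Ht.
    rewrite <- E by auto. f_equal. ring.
  - apply (ex_derive_comp (V := R_NormedModule) (PSeries a) (fun s => s - s0)).
    + apply ex_derive_PSeries. rewrite Rminus_diag, Rabs_R0.
      eapply Rbar_lt_le_trans; [|exact Hr]. apply cond_pos.
    + auto_derive; auto.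
Qed.

Lemma Ranalytic_minus f g s0 : Ranalytic f s0 -> Ranalytic g s0 -> Ranalytic (fun s => f s - g s) s0.
Proof.
  intros (a & r & Hr & Ha) (b & r' & Hr' & Hb).
  exists (PS_minus a b), (Rmin r r'). split; [now apply Rmin_pos|].
  intros h Hh. pose proof (Rmin_l r r'). pose proof (Rmin_r r r').
  apply @is_pseries_minus; [apply Ha|apply Hb]; lra.
Qed.

Lemma Ranalytic_plus f g s0 : Ranalytic f s0 -> Ranalytic g s0 -> Ranalytic (fun s => f s + g s) s0.
Proof.
  intros (a & r & Hr & Ha) (b & r' & Hr' & Hb).
  exists (PS_plus a b), (Rmin r r'). split; [now apply Rmin_pos|].
  intros h Hh. pose proof (Rmin_l r r'). pose proof (Rmin_r r r').
  apply @is_pseries_plus; [apply Ha|apply Hb]; lra.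
Qed.

Lemma Ranalytic_scal c f s0 : Ranalytic f s0 -> Ranalytic (fun s => c * f s) s0.
Proof.
  intros (a & r & Hr & Ha). exists (PS_scal c a), r. split; auto.
  intros h Hh. apply @is_pseries_scal; [apply Rmult_comm|auto].
Qed.

(** A differential relation between real-analytic functions continues to the
    left: the difference of its two sides is real-analytic. *)
Lemma Ranalytic_derive_continuation (u v : R -> R) a b e s : 0 < e -> a <= s < b ->
  (forall t, a <= t <= b -> Ranalytic u t) -> (forall t, a <= t <= b -> Ranalytic v t) ->
  (forall t, b - e < t < b -> is_derive u t (v t)) -> is_derive u s (v s).
Proof.
  intros He Hs Hu Hv HD.
  assert (Z : Derive u s - v s = 0).
  { apply (Ranalytic_identity (fun s => Derive u s - v s) a b e); auto; try lra.
    - intros t Ht. apply Ranalytic_minus; auto. apply Ranalytic_derive; auto.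
    - intros t Ht. apply Rminus_diag_eq, is_derive_unique; auto. }
  replace (v s) with (Derive u s) by lra.
  apply Derive_correct, Ranalytic_ex_derive, Hu. lra.
Qed.

Lemma pow_n_C (z : C) n : @pow_n C_Ring z n = (z ^ n)%C.
Proof. induction n; simpl; [reflexivity|]. now rewrite IHn. Qed.

Lemma Cpow_real_mult (h : R) (d : C) n : ((RtoC h * d) ^ n)%C = (RtoC (h ^ n) * d ^ n)%C.
Proof. rewrite Cpow_mult_l. now rewrite RtoC_pow. Qed.

(** The only source of derivatives for a function known to be analytic: on every
    line through [z] the power series becomes a pair of real power series, with
    the same complex number [l] as first coefficient. *)
Lemma analytic_coef f z : analytic_at f z -> exists l, forall z0 d s0,
  z = (z0 + RtoC s0 * d)%C ->
  Ranalytic (fun s => Re (f (z0 + RtoC s * d)%C)) s0 /\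
  Ranalytic (fun s => Im (f (z0 + RtoC s * d)%C)) s0 /\
  Cderive (fun s => f (z0 + RtoC s * d)%C) s0 (d * l)%C.
Proof.
  intros (a & r & Hr & H). exists (a 1%nat). intros z0 d s0 Ez.
  pose proof (Cmod_ge_0 d) as Hd.
  assert (Hr' : 0 < r / (Cmod d + 1)) by (apply Rdiv_lt_0_compat; lra).
  assert (S : forall h, Rabs h < r / (Cmod d + 1) ->
    @is_series C_AbsRing C_NormedModule
      (fun n => RtoC (h ^ n) * (d ^ n * a n))%C (f (z0 + RtoC (s0 + h) * d)%C)).
  { intros h Hh. replace (z0 + RtoC (s0 + h) * d)%C with (z + RtoC h * d)%C
      by (rewrite Ez, RtoC_plus; ring).
    eapply is_series_ext; [|apply (H (RtoC h * d)%C)].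
    - intros n. simpl. rewrite pow_n_C, Cpow_real_mult.
      unfold scal; simpl; unfold mult; simpl. ring.
    - rewrite Cmod_mult, Cmod_R.
      apply (Rmult_lt_compat_r (Cmod d + 1)) in Hh; [|lra].
      unfold Rdiv in Hh. rewrite Rmult_assoc, Rinv_l in Hh by lra.
      pose proof (Rabs_pos h). nra. }
  assert (SR : forall h, Rabs h < r / (Cmod d + 1) ->
    is_pseries (fun n => Re (d ^ n * a n)%C) h (Re (f (z0 + RtoC (s0 + h) * d)%C))).
  { intros h Hh. apply is_pseries_R. eapply is_series_ext; [|apply is_series_Re, S, Hh].
    intros n. csimp_ring. }
  assert (SI : forall h, Rabs h < r / (Cmod d + 1) ->
    is_pseries (fun n => Im (d ^ n * a n)%C) h (Im (f (z0 + RtoC (s0 + h) * d)%C))).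
  { intros h Hh. apply is_pseries_R. eapply is_series_ext; [|apply is_series_Im, S, Hh].
    intros n. csimp_ring. }
  assert (D : forall (g : R -> R) c, (forall h, Rabs h < r / (Cmod d + 1) ->
    is_pseries c h (g (s0 + h))) -> is_derive g s0 (c 1%nat)).
  { intros g c Hg.
    assert (HR := CV_radius_ge c _ _ Hg).
    apply (is_derive_ext_loc (fun s => PSeries c (s - s0))).
    - exists (mkposreal _ Hr'). intros t Ht. change (Rabs (t - s0) < r / (Cmod d + 1)) in Ht.
      rewrite (is_pseries_unique _ _ _ (Hg _ Ht)). f_equal. ring.
    - evar_last.
      + apply (is_derive_comp (V := R_NormedModule) (PSeries c) (fun s => s - s0)).
        * apply is_derive_PSeries. rewrite Rminus_diag, Rabs_R0.
          eapply Rbar_lt_le_trans; [|exact HR]. simpl; auto.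
        * auto_derive; auto.
      + rewrite Rminus_diag, PSeries_0. unfold PS_derive, scal; simpl; unfold mult; simpl. ring. }
  split; [|split; [|split]].
  - exists (fun n => Re (d ^ n * a n)%C), (r / (Cmod d + 1)); auto.
  - exists (fun n => Im (d ^ n * a n)%C), (r / (Cmod d + 1)); auto.
  - evar_last; [apply (D (fun s => Re (f (z0 + RtoC s * d)%C)) _ SR)|]. csimp_ring.
  - evar_last; [apply (D (fun s => Im (f (z0 + RtoC s * d)%C)) _ SI)|]. csimp_ring.
Qed.

Lemma analytic_line_Ccont f z0 d s0 : analytic_at f (z0 + RtoC s0 * d)%C ->
  Ccont (fun s => f (z0 + RtoC s * d)%C) s0.
Proof.
  intros H. destruct (analytic_coef _ _ H) as (l & Hl).
  eapply Ccont_of_Cderive. now apply Hl.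
Qed.

(** Restricted to a segment, the real and imaginary parts are real-analytic. *)
Lemma analytic_segment_zero (f : C -> C) (z0 d : C) a b e : a < b -> 0 < e ->
  (forall s, a <= s <= b -> analytic_at f (z0 + RtoC s * d)%C) ->
  (forall s, b - e < s < b -> f (z0 + RtoC s * d)%C = 0) ->
  forall s, a <= s < b -> f (z0 + RtoC s * d)%C = 0.
Proof.
  intros Hab He HA Hz s Hs. apply C_eq.
  - apply (Ranalytic_identity (fun s => Re (f (z0 + RtoC s * d)%C)) a b e); auto.
    + intros t Ht. destruct (analytic_coef _ _ (HA t Ht)) as (l & Hl). now apply Hl.
    + intros t Ht. now rewrite Hz.
  - apply (Ranalytic_identity (fun s => Im (f (z0 + RtoC s * d)%C)) a b e); auto.
    + intros t Ht. destruct (analytic_coef _ _ (HA t Ht)) as (l & Hl). now apply Hl.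
    + intros t Ht. now rewrite Hz.
Qed.

(** * Complex derivatives *)

(** A complex derivative, encoded as a common derivative along all real lines:
    restricting a function to a ray then needs no chain rule. *)
Definition holo (f : C -> C) (z l : C) : Prop :=
  forall z0 d s0, z = (z0 + RtoC s0 * d)%C ->
  Cderive (fun s => f (z0 + RtoC s * d)%C) s0 (d * l)%C.

Lemma analytic_holo f z : analytic_at f z -> exists l, holo f z l.
Proof.
  intros H. destruct (analytic_coef f z H) as (l & Hl).
  exists l. intros z0 d s0 E. now apply (Hl z0 d s0).
Qed.

Lemma holo_eq f z l l' : holo f z l -> l = l' -> holo f z l'.
Proof. intros H E; now rewrite <- E. Qed.

Lemma holo_ext f g z l : (forall x, f x = g x) -> holo f z l -> holo g z l.
Proof. intros E H z0 d s0 Ez. eapply Cderive_ext; [|apply (H _ _ _ Ez)]. simpl; auto. Qed.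

Lemma holo_line f z0 d s0 l : holo f (z0 + RtoC s0 * d)%C l ->
  Cderive (fun s => f (z0 + RtoC s * d)%C) s0 (d * l)%C.
Proof. intros H. now apply H. Qed.

Lemma holo_const c z : holo (fun _ => c) z 0.
Proof. intros z0 d s0 E. eapply Cderive_eq; [apply Cderive_const|ring]. Qed.

Lemma holo_id z : holo (fun x => x) z 1.
Proof. intros z0 d s0 E. eapply Cderive_eq; [apply Cderive_line|ring]. Qed.

Lemma holo_plus f g z a b : holo f z a -> holo g z b -> holo (fun x => f x + g x)%C z (a + b)%C.
Proof.
  intros Hf Hg z0 d s0 E. eapply Cderive_eq; [apply (Cderive_plus (fun s => f _) (fun s => g _))|].
  - now apply Hf.
  - now apply Hg.
  - ring.
Qed.

Lemma holo_opp f z a : holo f z a -> holo (fun x => - f x)%C z (- a)%C.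
Proof.
  intros Hf z0 d s0 E. eapply Cderive_eq; [apply (Cderive_opp (fun s => f _))|].
  - now apply Hf.
  - ring.
Qed.

Lemma holo_minus f g z a b : holo f z a -> holo g z b -> holo (fun x => f x - g x)%C z (a - b)%C.
Proof. intros Hf Hg. apply (holo_plus f (fun x => - g x)%C); auto. now apply holo_opp. Qed.

Lemma holo_mult f g z a b : holo f z a -> holo g z b ->
  holo (fun x => f x * g x)%C z (a * g z + f z * b)%C.
Proof.
  intros Hf Hg z0 d s0 E. eapply Cderive_eq; [apply (Cderive_mult (fun s => f _) (fun s => g _))|].
  - now apply Hf.
  - now apply Hg.
  - simpl. rewrite <- E. ring.
Qed.

Lemma holo_scal c f z a : holo f z a -> holo (fun x => c * f x)%C z (c * a)%C.
Proof.
  intros H. eapply holo_eq; [apply (holo_mult (fun _ => c) f); [apply holo_const|exact H]|].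
  ring.
Qed.

Lemma holo_inv f z a : holo f z a -> f z <> 0 -> holo (fun x => / f x)%C z (- a / (f z * f z))%C.
Proof.
  intros Hf Hn z0 d s0 E. eapply Cderive_eq; [apply (Cderive_inv (fun s => f _))|].
  - now apply Hf.
  - simpl. now rewrite <- E.
  - simpl. rewrite <- E. field. auto.
Qed.

Lemma holo_exp f z a : holo f z a -> holo (fun x => Cexp (f x)) z (a * Cexp (f z))%C.
Proof.
  intros Hf z0 d s0 E. eapply Cderive_eq; [apply (Cderive_exp (fun s => f _))|].
  - now apply Hf.
  - simpl. rewrite <- E. ring.
Qed.

Lemma holo_pow f z a n : holo f z a ->
  holo (fun x => f x ^ S n)%C z (RtoC (INR (S n)) * f z ^ n * a)%C.
Proof.
  intros H. induction n as [|n IH].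
  - apply (holo_ext f); [intros; simpl; ring|]. eapply holo_eq; [exact H|]. simpl. ring.
  - eapply holo_eq; [apply (holo_mult f (fun x => f x ^ S n)%C); [exact H|exact IH]|].
    rewrite (S_INR (S n)), RtoC_plus. simpl Cpow. ring.
Qed.

Lemma holo_sum (f : nat -> C -> C) z (a : nat -> C) n :
  (forall k, (k <= n)%nat -> holo (f k) z (a k)) ->
  holo (fun x => sum_n (fun k => f k x) n) z (sum_n a n).
Proof.
  intros H. induction n as [|n IH].
  - rewrite sum_O. eapply holo_ext; [|apply (H 0%nat); lia]. intros x; now rewrite sum_O.
  - rewrite sum_Sn. apply (holo_ext (fun x => sum_n (fun k => f k x) n + f (S n) x)%C).
    + intros x; now rewrite sum_Sn.
    + apply holo_plus; auto.
Qed.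

Lemma holo_unique f z a b : holo f z a -> holo f z b -> a = b.
Proof.
  intros Ha Hb.
  assert (E : z = (z + RtoC 0 * 1)%C) by ring.
  pose proof (Cderive_unique _ _ _ _ (Ha _ _ _ E) (Hb _ _ _ E)) as Q.
  rewrite !Cmult_1_l in Q. exact Q.
Qed.

(** * The derivatives of [1/(e^z - 1) - 1/z] *)

(** The singularity of [1/(e^z - 1) - 1/z] at [0] is removable but is excluded
    here, since the formula is meaningless there. *)
Definition regular (z : C) : Prop := z <> 0 /\ Cexp z <> 1.

Lemma Cderive_locally_neq phi s l c : Cderive phi s l -> phi s <> c -> locally s (fun t => phi t <> c).
Proof.
  intros H N. destruct (Ccont_of_Cderive _ _ _ H) as [HR HI].
  apply continuity_pt_filterlim in HR, HI.
  destruct (Req_dec (Re (phi s)) (Re c)) as [E|NE].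
  - assert (NI : Im (phi s) <> Im c) by (intros E'; apply N, C_eq; auto).
    apply (filter_imp (fun t => Im (phi t) <> Im c)); [intros t Ht E'; apply Ht; now rewrite E'|].
    apply (HI (fun x => x <> Im c)). now apply open_neq.
  - apply (filter_imp (fun t => Re (phi t) <> Re c)); [intros t Ht E'; apply Ht; now rewrite E'|].
    apply (HR (fun x => x <> Re c)). now apply open_neq.
Qed.

Lemma regular_locally z z0 d s0 : regular z -> z = (z0 + RtoC s0 * d)%C ->
  locally s0 (fun s => regular (z0 + RtoC s * d)%C).
Proof.
  intros [H1 H2] ->. apply filter_and.
  - eapply Cderive_locally_neq; [apply Cderive_line|auto].
  - apply (Cderive_locally_neq (fun s => Cexp (z0 + RtoC s * d)%C) s0 (d * Cexp (z0 + RtoC s0 * d))%C); auto.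
    apply (Cderive_exp (fun s => (z0 + RtoC s * d)%C)), Cderive_line.
Qed.

Lemma holo_ext_regular f g z l : (forall x, regular x -> f x = g x) -> regular z ->
  holo f z l -> holo g z l.
Proof.
  intros E Hz H z0 d s0 Ez. eapply Cderive_ext_loc; [|apply (H _ _ _ Ez)].
  eapply filter_imp; [|apply (regular_locally z z0 d s0 Hz Ez)]. simpl; auto.
Qed.

(** The coefficients of [Li_{-m}(e^{-z})] as a polynomial in [u = 1/(e^z - 1)],
    read off from [u' = -(u + u^2)]; they are [(j-1)!] times the Stirling numbers
    of the second kind [S(m+1,j)]. *)
Fixpoint Li_neg_coef (m j : nat) : R :=
  match m with
  | O => if Nat.eqb j 1 then 1 else 0
  | S m' => INR j * Li_neg_coef m' j + INR (pred j) * Li_neg_coef m' (pred j)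
  end.

Definition bose (z : C) : C := (/ (Cexp z - 1))%C.

(** [Li_{-m}(e^{-z})] on the whole domain, as a rational function of [e^z]. *)
Definition Li_neg (m : nat) (z : C) : C :=
  sum_n (fun j => RtoC (Li_neg_coef m j) * bose z ^ j)%C (S m).

Lemma Li_neg_coef_big m j : (m + 1 < j)%nat -> Li_neg_coef m j = 0.
Proof.
  revert j. induction m as [|m IH]; intros j Hj; simpl.
  - destruct (Nat.eqb_spec j 1); auto; lia.
  - rewrite !IH by lia. ring.
Qed.

Lemma Li_neg_coef_0 m : Li_neg_coef m 0 = 0.
Proof. induction m as [|m IH]; simpl; auto. rewrite IH. ring. Qed.

Lemma regular_minus z : regular z -> (Cexp z - 1 <> 0)%C.
Proof.
  intros [_ H] E. apply H. replace (Cexp z) with (Cexp z - 1 + 1)%C by ring. rewrite E; ring.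
Qed.

Lemma holo_bose z : Cexp z <> 1 -> holo bose z (- (bose z + bose z ^ 2))%C.
Proof.
  intros Hz. assert (N : (Cexp z - 1 <> 0)%C).
  { intros E. apply Hz. replace (Cexp z) with (Cexp z - 1 + 1)%C by ring. rewrite E; ring. }
  eapply holo_eq; [apply (holo_inv (fun x => Cexp x - 1)%C)|]; auto.
  - apply holo_minus; [apply (holo_exp (fun x => x)), holo_id|apply holo_const].
  - unfold bose. simpl. field. auto.
Qed.

Lemma holo_Li_neg m z : Cexp z <> 1 -> holo (Li_neg m) z (- Li_neg (S m) z)%C.
Proof.
  intros Hz. unfold Li_neg.
  eapply holo_eq.
  - apply (holo_sum (fun j x => RtoC (Li_neg_coef m j) * bose x ^ j)%C z
      (fun j => - (RtoC (INR j * Li_neg_coef m j) * bose z ^ j +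
                   RtoC (INR j * Li_neg_coef m j) * bose z ^ S j))%C).
    intros k _. destruct k as [|k].
    + apply (holo_eq _ _ 0).
      * apply (holo_ext (fun _ => RtoC (Li_neg_coef m 0))); [intros; simpl; ring|apply holo_const].
      * simpl INR. rewrite Rmult_0_l. ring.
    + eapply holo_eq; [apply holo_scal, holo_pow, holo_bose, Hz|].
      rewrite RtoC_mult. simpl Cpow. ring.
  - assert (E : forall n, sum_n (fun j => - (RtoC (INR j * Li_neg_coef m j) * bose z ^ j +
                   RtoC (INR j * Li_neg_coef m j) * bose z ^ S j))%C n =
      (- (sum_n (fun j => RtoC (Li_neg_coef (S m) j) * bose z ^ j)%C (S n)
         - RtoC (INR (S n) * Li_neg_coef m (S n)) * bose z ^ S n))%C).
    { induction n as [|n IH].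
      - rewrite sum_Sn, !sum_O. simpl. rewrite Li_neg_coef_0. apply C_eq; csimp_ring.
      - rewrite sum_Sn, IH, (sum_Sn _ (S n)). unfold plus; simpl plus.
        change (Li_neg_coef (S m) (S (S n))) with
          (INR (S (S n)) * Li_neg_coef m (S (S n)) + INR (S n) * Li_neg_coef m (S n)).
        rewrite (RtoC_plus (_ * _)). simpl Cpow. unfold plus; simpl. ring. }
    rewrite E. rewrite (Li_neg_coef_big m (S (S m))) by lia. rewrite Rmult_0_r. ring.
Qed.

(** The [m]-th derivative of [1/(e^z - 1) - 1/z], in the form in which it enters
    the expansion. *)
Definition polefree (m : nat) (z : C) : C :=
  ((-1) ^ m * (Li_neg m z - RtoC (INR (fact m)) * / z ^ S m))%C.

Lemma holo_polefree m z : regular z -> holo (polefree m) z (polefree (S m) z).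
Proof.
  intros [Hz He]. unfold polefree.
  eapply holo_eq.
  - apply (holo_scal ((-1) ^ m)%C), holo_minus; [apply holo_Li_neg, He|].
    apply holo_scal. apply (holo_inv (fun x => x ^ S m)%C).
    + apply (holo_pow (fun x => x)), holo_id.
    + now apply Cpow_nz.
  - rewrite fact_simpl, mult_INR, RtoC_mult. simpl Cpow.
    field. split; auto. now apply Cpow_nz.
Qed.

Lemma exp_mono x y : x <= y -> exp x <= exp y.
Proof. intros [H| ->]; [left; now apply exp_increasing|lra]. Qed.

Lemma RtoC_neq x : x <> 0 -> RtoC x <> 0.
Proof. intros H E. apply H. now apply RtoC_inj. Qed.

(** The Taylor remainder [e^z - sum_{k<n} z^k/k!]. *)
Fixpoint exp_tail (n : nat) (z : C) : C :=
  match n with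
  | O => Cexp z
  | S m => (exp_tail m z - RtoC (/ INR (fact m)) * z ^ m)%C
  end.

Lemma holo_exp_tail n z : holo (exp_tail n) z (exp_tail (pred n) z).
Proof.
  induction n as [|n IH]; simpl exp_tail.
  - eapply holo_eq; [apply (holo_exp (fun x => x)), holo_id|ring].
  - simpl pred. destruct n as [|n].
    + eapply holo_eq; [apply (holo_minus Cexp); [exact IH|]|].
      * apply (holo_ext (fun _ => RtoC (/ INR (fact 0)))); [intros; simpl; ring|apply holo_const].
      * simpl; ring.
    + eapply holo_eq; [apply (holo_minus (exp_tail (S n))); [exact IH|]|].
      * apply holo_scal, (holo_pow (fun x => x)), holo_id.
      * simpl pred. simpl exp_tail. rewrite fact_simpl, mult_INR, Rinv_mult, RtoC_mult, RtoC_inv.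
        2: first [apply INR_fact_neq_0|apply not_0_INR; lia].
        field; repeat split; apply RtoC_neq;
          first [apply INR_fact_neq_0|apply not_0_INR; lia].
 Qed.

Lemma exp_tail_0 n : exp_tail (S n) 0 = 0.
Proof.
  induction n as [|n IH].
  - simpl. rewrite Cexp_0, Rinv_1. ring.
  - change (exp_tail (S (S n)) 0) with
      (exp_tail (S n) 0 - RtoC (/ INR (fact (S n))) * 0 ^ S n)%C.
    rewrite IH. simpl Cpow. ring.
Qed.

(** Each remainder is the derivative of the next, which gains a factor [|z|] on the
    segment from [0] to [z]. *)
Lemma exp_tail_bound n z : Cmod (exp_tail n z) <= exp (Cmod z) * Cmod z ^ n.
Proof.
  revert z. induction n as [|n IH]; intros z.
  - simpl. rewrite Cmod_Cexp, Rmult_1_r. apply exp_mono. apply Re_le_Cmod.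
  - set (M := exp (Cmod z) * Cmod z ^ S n).
    pose proof (Cmod_ge_0 z).
    assert (D : forall t, Cderive (fun t => exp_tail (S n) (0 + RtoC t * z)%C) t
       (z * exp_tail n (0 + RtoC t * z))%C).
    { intros t. apply holo_line. apply (holo_exp_tail (S n)). }
    pose proof (mean_value_ineq (fun t => exp_tail (S n) (0 + RtoC t * z)%C)
      (fun t => z * exp_tail n (0 + RtoC t * z))%C (fun t => M * t) (fun _ => M) 0 1) as Q.
    cbv beta in Q.
    replace (0 + RtoC 1 * z)%C with z in Q by ring.
    replace (0 + RtoC 0 * z)%C with (RtoC 0) in Q by ring.
    rewrite exp_tail_0 in Q.
    replace (exp_tail (S n) z - 0)%C with (exp_tail (S n) z) in Q by ring.
    replace (M * 1 - M * 0) with M in Q by ring. apply Q; [lra|..].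
    + intros t _. eapply Ccont_of_Cderive, D.
    + intros t _. apply derivable_continuous_pt. reg.
    + auto.
    + intros. auto_derive; auto; ring.
    + intros t Ht. rewrite Cmod_mult. unfold M. simpl pow.
      replace (0 + t * z)%C with (t * z)%C by ring.
      eapply Rle_trans; [apply Rmult_le_compat_l, IH; lra|].
      rewrite Cmod_mult, Cmod_R, Rabs_right by lra.
      assert (E : t * Cmod z <= Cmod z) by nra.
      assert (0 <= t * Cmod z) by nra.
      assert (exp (t * Cmod z) <= exp (Cmod z)) by now apply exp_mono.
      assert ((t * Cmod z) ^ n <= Cmod z ^ n) by (apply pow_incr; lra).
      pose proof (exp_pos (t * Cmod z)).
      assert (0 <= (t * Cmod z) ^ n) by now apply pow_le.
      assert (exp (t * Cmod z) * (t * Cmod z) ^ n <= exp (Cmod z) * Cmod z ^ n)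
        by (apply Rmult_le_compat; lra).
      nra.
Qed.

(** Entire functions up to a removable singularity. They form a family closed
    under differentiation, in which [1/(e^z-1) - 1/z] can be written without any
    pole at [0]. *)
Definition exp_quotient (n : nat) (z : C) : C := (exp_tail n z * / z ^ n)%C.

Lemma holo_exp_quotient n (z : C) : z <> 0 -> holo (exp_quotient n) z (exp_quotient n z - RtoC (INR n) * exp_quotient (S n) z)%C.
Proof.
  intros Hz. unfold exp_quotient. destruct n as [|n].
  - apply (holo_ext Cexp); [intros; simpl; field; apply RtoC_neq; lra|].
    eapply holo_eq; [apply (holo_exp (fun x => x)), holo_id|].
    simpl. rewrite Rinv_1. field; auto.
  - eapply holo_eq.
    + apply (holo_mult (exp_tail (S n))); [apply holo_exp_tail|].
      apply (holo_inv (fun x => x ^ S n)%C); [apply (holo_pow (fun x => x)), holo_id|].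
      now apply Cpow_nz.
    + simpl pred.
      change (exp_tail (S (S n)) z) with
        (exp_tail (S n) z - RtoC (/ INR (fact (S n))) * z ^ S n)%C.
      change (exp_tail (S n) z) with (exp_tail n z - RtoC (/ INR (fact n)) * z ^ n)%C.
      rewrite fact_simpl, mult_INR, Rinv_mult, RtoC_mult, !RtoC_inv. simpl Cpow.
      field; repeat split; auto; try now apply Cpow_nz.
      all: try apply RtoC_neq; first [apply INR_fact_neq_0|apply not_0_INR; lia].
Qed.

(** Derivatives are asked for at all regular points, where they are unique, but
    bounds only on [K]. *)
Fixpoint bounded_derivs (K : C -> Prop) (n : nat) (f : C -> C) : Prop :=
  (exists c, forall z, K z -> Cmod (f z) <= c) /\
  match n with
  | O => True
  | S m => exists f', (forall z, regular z -> holo f z (f' z)) /\ bounded_derivs K m f'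
  end.

Lemma bounded_derivs_S K n f : bounded_derivs K (S n) f -> bounded_derivs K n f.
Proof.
  revert f. induction n as [|n IH]; intros f [H1 (f' & H2 & H3)]; split; auto.
  exists f'. auto.
Qed.

Lemma bounded_derivs_const K n c : bounded_derivs K n (fun _ => c).
Proof.
  revert c. induction n as [|n IH]; intros c; split; auto;
    try (exists (Cmod c); intros; lra).
  exists (fun _ => RtoC 0). split; auto. intros; apply holo_const.
Qed.

Lemma bounded_derivs_minus K n f g : bounded_derivs K n f -> bounded_derivs K n g -> bounded_derivs K n (fun z => f z - g z)%C.
Proof.
  revert f g. induction n as [|n IH]; intros f g [[a Ha] Hf] [[b Hb] Hg]; split; auto.
  1, 2: exists (a + b); intros z Hz; specialize (Ha z Hz); specialize (Hb z Hz);
    unfold Cminus; pose proof (Cmod_triangle (f z) (- g z)) as Q; rewrite Cmod_opp in Q; lra.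
  destruct Hf as (f' & Df & Hf), Hg as (g' & Dg & Hg).
  exists (fun z => f' z - g' z)%C. split; auto. intros z Hz. apply holo_minus; auto.
Qed.

Lemma bounded_derivs_plus K n f g : bounded_derivs K n f -> bounded_derivs K n g -> bounded_derivs K n (fun z => f z + g z)%C.
Proof.
  revert f g. induction n as [|n IH]; intros f g [[a Ha] Hf] [[b Hb] Hg]; split; auto.
  1, 2: exists (a + b); intros z Hz; specialize (Ha z Hz); specialize (Hb z Hz);
    pose proof (Cmod_triangle (f z) (g z)) as Q; lra.
  destruct Hf as (f' & Df & Hf), Hg as (g' & Dg & Hg).
  exists (fun z => f' z + g' z)%C. split; auto. intros z Hz. apply holo_plus; auto.
Qed.

Lemma bounded_derivs_mult K n f g : bounded_derivs K n f -> bounded_derivs K n g -> bounded_derivs K n (fun z => f z * g z)%C.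
Proof.
  assert (B : forall (f g : C -> C) a b, (forall z, K z -> Cmod (f z) <= a) ->
    (forall z, K z -> Cmod (g z) <= b) -> forall z, K z -> Cmod (f z * g z) <= a * b).
  { intros h k a b Ha Hb z Hz. specialize (Ha z Hz). specialize (Hb z Hz).
    rewrite Cmod_mult. pose proof (Cmod_ge_0 (h z)). pose proof (Cmod_ge_0 (k z)).
    apply Rmult_le_compat; auto. }
  revert f g. induction n as [|n IH]; intros f g Hf Hg.
  - destruct Hf as [[a Ha] _], Hg as [[b Hb] _]. split; auto. exists (a * b); auto.
  - pose proof (bounded_derivs_S _ _ _ Hf) as Hf0. pose proof (bounded_derivs_S _ _ _ Hg) as Hg0.
    destruct Hf as [[a Ha] (f' & Df & Hf)], Hg as [[b Hb] (g' & Dg & Hg)].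
    split; [exists (a * b); auto|].
    exists (fun z => f' z * g z + f z * g' z)%C. split.
    + intros z Hz. apply holo_mult; auto.
    + apply bounded_derivs_plus; apply IH; auto.
Qed.

Lemma bounded_derivs_inv K n (f : C -> C) c : 0 < c -> (forall z, regular z -> f z <> 0) ->
  (forall z, K z -> c <= Cmod (f z)) -> (forall z, K z -> regular z) ->
  bounded_derivs K n f -> bounded_derivs K n (fun z => / f z)%C.
Proof.
  intros Hc Hr HK KR. induction n as [|n IH]; intros Hf.
  - split; auto. exists (/ c). intros z Hz. rewrite Cmod_inv by exact (Hr z (KR z Hz)).
    apply Rinv_le_contravar; auto.
  - pose proof (bounded_derivs_S _ _ _ Hf) as Hf0. split.
    + exists (/ c). intros z Hz. rewrite Cmod_inv by exact (Hr z (KR z Hz)). apply Rinv_le_contravar; auto.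
    + destruct Hf as [_ (f' & D & Hf)].
      exists (fun z => (0 - f' z) * (/ f z * / f z))%C. split.
      * intros z Hz. eapply holo_eq; [apply holo_inv; [apply D; auto|exact (Hr z Hz)]|]. field. exact (Hr z Hz).
      * apply bounded_derivs_mult; [apply bounded_derivs_minus; auto; apply bounded_derivs_const|].
        apply bounded_derivs_mult; auto.
Qed.

Lemma bounded_derivs_exp_quotient K R0 n k : (forall z, K z -> Cmod z <= R0) -> (forall z, K z -> regular z) ->
  bounded_derivs K n (exp_quotient k).
Proof.
  intros HR KR. revert k.
  assert (B : forall k, exists c, forall z, K z -> Cmod (exp_quotient k z) <= c).
  { intros k. exists (exp R0). intros z Hz.
    assert (P : 0 < Cmod z ^ k) by (apply pow_lt, Cmod_gt_0, KR, Hz).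
    unfold exp_quotient. rewrite Cmod_mult, Cmod_inv, Cmod_pow by now apply Cpow_nz, KR.
    apply (Rmult_le_reg_r (Cmod z ^ k)); auto.
    rewrite Rmult_assoc, Rinv_l, Rmult_1_r by lra.
    eapply Rle_trans; [apply exp_tail_bound|]. apply Rmult_le_compat_r; [lra|].
    apply exp_mono. auto. }
  induction n as [|n IH]; intros k; split; auto.
  exists (fun z => exp_quotient k z - RtoC (INR k) * exp_quotient (S k) z)%C. split.
  - intros z [Hz _]. now apply holo_exp_quotient.
  - apply bounded_derivs_minus; auto. apply (bounded_derivs_mult K n (fun _ => RtoC (INR k))); auto.
    apply bounded_derivs_const.
Qed.

Lemma exp_quotient_1_eq z : regular z -> (exp_quotient 1 z = (Cexp z - 1) / z)%C.
Proof.
  intros [H _]. unfold exp_quotient. simpl. rewrite Rinv_1. field; auto.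
Qed.

(** Near the removable singularity [0] the function [1/(e^z-1) - 1/z] is
    [-e_2/e_1] with [e_1(z) = (e^z-1)/z] and [e_2(z) = (e^z-1-z)/z^2], which stays
    bounded with all its derivatives where [e_1] is bounded below. *)
Lemma polefree_bounded_compact (R0 c : R) (m : nat) : 0 < c -> exists M, forall z, regular z ->
  Cmod z <= R0 -> c * Cmod z <= Cmod (Cexp z - 1) -> Cmod (polefree m z) <= M.
Proof.
  intros Hc.
  set (K := fun z => regular z /\ Cmod z <= R0 /\ c * Cmod z <= Cmod (Cexp z - 1)).
  assert (E1 : forall z, regular z -> exp_quotient 1 z <> 0).
  { intros z Hz. rewrite exp_quotient_1_eq by auto. intros E.
    apply (regular_minus z Hz). destruct Hz.
    replace (Cexp z - 1)%C with ((Cexp z - 1) / z * z)%C by (field; auto). rewrite E. ring. }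
  assert (N0 : bounded_derivs K m (fun z => (0 - exp_quotient 2 z) * / exp_quotient 1 z)%C).
  { apply bounded_derivs_mult; [apply bounded_derivs_minus; [apply bounded_derivs_const|]|].
    - apply (bounded_derivs_exp_quotient K R0); intros z (? & ? & ?); auto.
    - apply (bounded_derivs_inv K m (exp_quotient 1) c); auto; [|now intros z [? _]|apply (bounded_derivs_exp_quotient K R0); intros z (? & ? & ?); auto].
      intros z (Hr & _ & H). rewrite exp_quotient_1_eq by auto. destruct Hr as [Hz _].
      rewrite Cmod_div by auto. apply Cmod_gt_0 in Hz.
      apply (Rmult_le_reg_r (Cmod z)); auto. unfold Rdiv. rewrite Rmult_assoc, Rinv_l; lra. }
  assert (G : forall m k f, bounded_derivs K m f -> (forall z, regular z -> f z = polefree k z) ->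
    bounded_derivs K 0 (polefree (m + k))).
  { clear m N0. induction m as [|m IH]; intros k f Hn Hf.
    - destruct Hn as [[M HM] _]. split; auto. exists M. intros z Hz.
      simpl. destruct Hz as (Hz & Hz'). rewrite <- Hf by exact Hz. apply HM. now split.
    - destruct Hn as [_ (f' & D & Hn)].
      replace (S m + k)%nat with (m + S k)%nat by lia. apply (IH (S k) f'); auto.
      intros z Hz. apply (holo_unique f z); auto.
      apply (holo_ext_regular (polefree k)); auto; [intros; symmetry; auto|]. now apply holo_polefree. }
  destruct (G m 0%nat _ N0) as [[M HM] _].
  - intros z Hz. pose proof (regular_minus z Hz). destruct Hz as [Hz _].
    unfold exp_quotient, polefree, Li_neg. rewrite sum_Sn, sum_O. simpl. unfold plus; simpl. unfold bose.
    rewrite Rinv_1.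
    field. repeat split; auto.
  - exists M. intros z H1 H2 H3. rewrite <- (Nat.add_0_r m). apply HM. unfold K. auto.
Qed.

Lemma Cmod_sum_n (u : nat -> C) n : Cmod (sum_n u n) <= sum_n (fun k => Cmod (u k)) n.
Proof.
  induction n as [|n IH]; [rewrite !sum_O; lra|]. rewrite !sum_Sn.
  eapply Rle_trans; [apply Cmod_triangle|]. unfold plus; simpl. lra.
Qed.

Lemma sum_n_Rle (a b : nat -> R) n : (forall k, (k <= n)%nat -> a k <= b k) ->
  sum_n a n <= sum_n b n.
Proof.
  intros H. induction n as [|n IH]; [rewrite !sum_O; auto|].
  rewrite !sum_Sn. unfold plus; simpl. apply Rplus_le_compat; auto.
Qed.

Lemma exp_ge_quadratic a : 0 <= a -> 1 + a + a ^ 2 / 2 <= exp a.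
Proof.
  intros Ha.
  assert (M : exp 0 - (1 + 0 + 0 ^ 2 / 2) <= exp a - (1 + a + a ^ 2 / 2)).
  { apply (monotone_of_derive (fun t => exp t - (1 + t + t ^ 2 / 2)) (fun t => exp t - (1 + t)));
      auto.
    - intros s _. apply derivable_continuous_pt. reg.
    - intros s _. auto_derive; auto. field.
    - intros s Hs. pose proof (exp_ineq1_le s). lra. }
  rewrite exp_0 in M. lra.
Qed.

Lemma regular_of_Re_pos z : 0 < Re z -> regular z.
Proof.
  intros H. split; intros E.
  - rewrite E in H. simpl in H; lra.
  - apply (f_equal Cmod) in E. rewrite Cmod_Cexp, Cmod_1, <- exp_0 in E.
    apply exp_inv in E. lra.
Qed.

Lemma inv_sq_facts a : 1 <= a -> 0 < / (1 + a ^ 2) /\ / (1 + a ^ 2) <= / a /\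
  2 / (1 + a ^ 2) <= 1 /\ / a ^ 2 <= 2 / (1 + a ^ 2).
Proof.
  intros H. assert (0 < 1 + a ^ 2) by nra.
  repeat split.
  - now apply Rinv_0_lt_compat.
  - apply Rinv_le_contravar; nra.
  - apply (Rmult_le_reg_r (1 + a ^ 2)); auto. unfold Rdiv.
    rewrite Rmult_assoc, Rinv_l; nra.
  - replace (2 / (1 + a ^ 2)) with (/ ((1 + a ^ 2) / 2)) by (field; lra).
    apply Rinv_le_contravar; nra.
Qed.

Lemma bose_bound z : 1 <= Re z -> Cmod (bose z) <= 2 / (1 + Re z ^ 2).
Proof.
  intros Hz. set (a := Re z) in *.
  unfold bose. assert (N : (Cexp z - 1 <> 0)%C).
  { apply regular_minus, regular_of_Re_pos. fold a; lra. }
  rewrite Cmod_inv by auto.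
  replace (2 / (1 + a ^ 2)) with (/ ((1 + a ^ 2) / 2)) by (field; nra).
  apply Rinv_le_contravar; [nra|].
  pose proof (Cmod_ge_minus (Cexp z) (- (1))) as Q.
  rewrite Cmod_opp, Cmod_1, Cmod_Cexp in Q. fold a in Q.
  pose proof (exp_ge_quadratic a). unfold Cminus. lra.
Qed.

Lemma Li_neg_bound m z : 1 <= Re z ->
  Cmod (Li_neg m z) <= sum_n (fun j => Rabs (Li_neg_coef m j)) (S m) * (2 / (1 + Re z ^ 2)).
Proof.
  intros Hz. pose proof (bose_bound z Hz) as Hu.
  destruct (inv_sq_facts _ Hz) as (Hp & _ & Hu1 & _).
  unfold Li_neg. eapply Rle_trans; [apply Cmod_sum_n|].
  rewrite <- (sum_n_mult_r (K := R_Ring)).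
  apply sum_n_Rle. intros k Hk. unfold mult; simpl.
  rewrite Cmod_mult, Cmod_R, Cmod_pow.
  destruct k as [|k].
  - rewrite Li_neg_coef_0, Rabs_R0. lra.
  - apply Rmult_le_compat_l; [apply Rabs_pos|].
    apply Rle_trans with (2 := Hu). pose proof (Cmod_ge_0 (bose z)).
    assert (Q : Cmod (bose z) ^ k <= 1 ^ k) by (apply pow_incr; lra).
    rewrite pow1 in Q. change (Cmod (bose z) ^ S k) with (Cmod (bose z) * Cmod (bose z) ^ k).
    rewrite <- (Rmult_1_r (Cmod (bose z))) at 3. now apply Rmult_le_compat_l.
Qed.

Lemma polefree_bounded_right m : exists M, 0 <= M /\ forall z, 1 <= Re z ->
  Cmod (polefree m z) <= M / Re z /\ ((1 <= m)%nat -> Cmod (polefree m z) <= M / (1 + Re z ^ 2)).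
Proof.
  set (S1 := sum_n (fun j => Rabs (Li_neg_coef m j)) (S m)).
  set (F := INR (fact m)).
  assert (HS : 0 <= S1).
  { apply Rle_trans with (sum_n (fun _ => 0) (S m)).
    - rewrite sum_n_const. lra.
    - apply sum_n_Rle. intros; apply Rabs_pos. }
  assert (HF : 0 <= F) by apply pos_INR.
  exists (2 * S1 + 2 * F). split; [lra|]. intros z Hz.
  pose proof (Li_neg_bound m z Hz) as HL. fold S1 in HL.
  destruct (inv_sq_facts _ Hz) as (Hp & A1 & _ & A2).
  set (a := Re z) in *.
  assert (Ha : a <= Cmod z) by apply Re_le_Cmod.
  assert (HG : Cmod (polefree m z) <= S1 * (2 / (1 + a ^ 2)) + F * / Cmod z ^ S m).
  { unfold polefree. rewrite Cmod_mult, Cmod_pow.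
    replace (Cmod (-1)) with 1 by (rewrite Cmod_R, Rabs_left; lra).
    rewrite pow1, Rmult_1_l.
    eapply Rle_trans; [apply Cmod_triangle|]. apply Rplus_le_compat; auto.
    rewrite Cmod_opp, Cmod_mult, Cmod_R, Cmod_inv, Cmod_pow, Rabs_right.
    - apply Rle_refl.
    - apply Rle_ge, pos_INR.
    - apply Cpow_nz. apply regular_of_Re_pos. fold a; lra. }
  assert (Pm : 1 <= Cmod z ^ m) by (apply pow_R1_Rle; lra).
  assert (Hz1 : / Cmod z ^ S m <= / a).
  { apply Rinv_le_contravar; [lra|]. simpl. nra. }
  split; [|intros Hm]; (eapply Rle_trans; [exact HG|]); unfold Rdiv in *;
    rewrite Rmult_plus_distr_r; apply Rplus_le_compat.
  - nra.
  - assert (0 < / a) by (apply Rinv_0_lt_compat; lra). nra.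
  - nra.
  - rewrite (Rmult_comm 2 F), Rmult_assoc. apply Rmult_le_compat_l; auto.
    apply Rle_trans with (2 := A2).
    apply Rinv_le_contravar; [nra|]. destruct m as [|m]; [lia|].
    change (Cmod z ^ S (S m)) with (Cmod z * (Cmod z * Cmod z ^ m)).
    assert (1 <= Cmod z ^ m) by (apply pow_R1_Rle; lra).
    assert (a * a <= Cmod z * Cmod z) by (apply Rmult_le_compat; lra). nra.
Qed.

(** * Distance of the region from the periods of the exponential *)

(** Near [0] because the cosine is at least [1/2], further on because the sine is at
    least the smaller of its values at [pi/3] and [x1]. *)
Lemma sin_lower x1 : 0 < x1 < PI -> exists k, 0 < k <= 1/2 /\
  forall x, 0 <= x <= x1 -> k * x <= sin x.
Proof.
  intros Hx1. pose proof PI_RGT_0.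
  assert (S3 : 0 < sin (PI / 3)) by (apply sin_gt_0; lra).
  assert (S1 : 0 < sin x1) by (apply sin_gt_0; lra).
  pose proof (Rmin_l (sin (PI/3)) (sin x1)) as M1.
  pose proof (Rmin_r (sin (PI/3)) (sin x1)) as M2.
  assert (Hmu : 0 < Rmin (sin (PI/3)) (sin x1)) by (apply Rmin_pos; auto).
  set (mu := Rmin (sin (PI/3)) (sin x1)) in *.
  assert (Hmp : 0 < mu / PI) by (apply Rdiv_lt_0_compat; auto).
  pose proof (Rmin_l (1/2) (mu / PI)) as K1. pose proof (Rmin_r (1/2) (mu / PI)) as K2.
  exists (Rmin (1/2) (mu / PI)). split; [split; auto; apply Rmin_pos; lra|].
  assert (K0 : 0 < Rmin (1/2) (mu / PI)) by (apply Rmin_pos; lra).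
  set (k := Rmin (1/2) (mu / PI)) in *.
  intros x Hx. destruct (Rle_lt_dec x (PI / 3)) as [L|L].
  - apply Rle_trans with (x / 2); [nra|].
    assert (Q : sin 0 - 0 / 2 <= sin x - x / 2).
    { apply (monotone_of_derive (fun t => sin t - t / 2) (fun t => cos t - 1 / 2)); [lra|..].
      - intros s _. apply derivable_continuous_pt. reg.
      - intros s _. auto_derive; auto. field.
      - intros s Hs. rewrite <- cos_PI3.
        assert (cos (PI / 3) <= cos s) by (apply cos_decr_1; lra). lra. }
    rewrite sin_0 in Q. lra.
  - apply Rle_trans with mu.
    + apply Rle_trans with (mu / PI * PI); [|right; field; lra].
      apply Rmult_le_compat; lra.
    + destruct (Rle_lt_dec x (PI / 2)) as [L2|L2].
      * apply Rle_trans with (1 := M1). apply sin_incr_1; lra.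
      * apply Rle_trans with (1 := M2). apply sin_decr_1; lra.
Qed.

Lemma Cmod_Cexp_minus_1 z :
  Cmod (Cexp z - 1) ^ 2 = (exp (Re z) - 1) ^ 2 + 4 * exp (Re z) * sin (Im z / 2) ^ 2.
Proof.
  rewrite Cmod2_alt.
  assert (E1 : cos (Im z) = 1 - 2 * sin (Im z / 2) * sin (Im z / 2)).
  { rewrite <- cos_2a_sin. f_equal. field. }
  assert (E2 : sin (Im z) ^ 2 = 1 - cos (Im z) ^ 2).
  { pose proof (sin2_cos2 (Im z)) as Q. unfold Rsqr in Q. lra. }
  replace (Re (Cexp z - 1)) with (exp (Re z) * cos (Im z) - 1) by csimp_ring.
  replace (Im (Cexp z - 1)) with (exp (Re z) * sin (Im z)) by csimp_ring.
  replace ((exp (Re z) * sin (Im z)) ^ 2) with (exp (Re z) ^ 2 * sin (Im z) ^ 2) by ring.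
  rewrite E2, E1. ring.
Qed.

(** Where the Euler-Maclaurin remainder has to be bounded: the rays of direction
    [e^{i theta}] issued from the region. *)
Definition swept (theta Y : R) (z : C) : Prop :=
  exists (y : C) (s : R), 0 <= s /\ Rabs (Im y) <= PI /\ - Y <= Re y /\
    z = (y + RtoC s * (cos theta, sin theta))%C.

Lemma pow2_le_inv x y : 0 <= y -> x ^ 2 <= y ^ 2 -> x <= y.
Proof. intros Hy H. apply Rnot_lt_le. intros L. nra. Qed.

(** With [z = a + ib], [|e^z - 1|^2 = (e^a - 1)^2 + 4 e^a sin(b/2)^2]; the sine is
    bounded below by a multiple of [b/2] as long as [|b|/2] stays away from [pi]. *)
Lemma exp_minus_1_lower_strip k b1 z : 0 < k <= 1/2 ->
  (forall x, 0 <= x <= b1 / 2 -> k * x <= sin x) ->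
  Rabs (Re z) <= 1 -> Rabs (Im z) <= b1 ->
  exp (-1) * k * Cmod z <= Cmod (Cexp z - 1).
Proof.
  intros Hk Hsin La Hbb. pose proof (Cmod_Cexp_minus_1 z) as EE.
  assert (Hzz : Cmod z ^ 2 = Re z ^ 2 + Im z ^ 2) by apply Cmod2_alt.
  set (a := Re z) in *. set (b := Im z) in *.
  pose proof (exp_pos a) as Hea.
  apply Rabs_le_between in La.
  assert (E1 : exp (-1) <= exp a) by (apply exp_mono; lra).
  assert (He1 : 0 < exp (-1)) by apply exp_pos.
  assert (He1' : exp (-1) < 1) by (rewrite <- exp_0; apply exp_increasing; lra).
  set (e1 := exp (-1)) in *.
  apply pow2_le_inv; [apply Cmod_ge_0|].
  assert (E2 : (e1 * a) ^ 2 <= (exp a - 1) ^ 2).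
  { destruct (Rle_lt_dec 0 a) as [P|P].
    - pose proof (exp_ineq1_le a). apply pow_incr. nra.
    - pose proof (exp_ineq1_le (- a)) as Q.
      assert (exp a * exp (- a) = 1) by (rewrite <- exp_plus, Rplus_opp_r; apply exp_0).
      replace ((e1 * a) ^ 2) with ((e1 * - a) ^ 2) by ring.
      replace ((exp a - 1) ^ 2) with ((1 - exp a) ^ 2) by ring.
      apply pow_incr. split; [nra|].
      apply Rle_trans with (exp a * - a); [apply Rmult_le_compat_r; lra|].
      apply Rle_trans with (exp a * (exp (-a) - 1)); [|lra].
      apply Rmult_le_compat_l; lra. }
  assert (E3 : (k * b / 2) ^ 2 <= sin (b / 2) ^ 2).
  { destruct (Rle_lt_dec 0 b) as [P|P].
    - rewrite Rabs_right in Hbb by lra. apply pow_incr. split; [nra|].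
      replace (k * b / 2) with (k * (b / 2)) by field. apply Hsin. lra.
    - rewrite Rabs_left in Hbb by lra.
      replace ((k * b / 2) ^ 2) with ((k * (- b / 2)) ^ 2) by field.
      replace (sin (b / 2) ^ 2) with (sin (- b / 2) ^ 2)
        by (replace (- b / 2) with (- (b / 2)) by field; rewrite sin_neg; ring).
      apply pow_incr. split; [|apply Hsin; lra].
      apply Rmult_le_pos; lra. }
  rewrite EE.
  replace ((e1 * k * Cmod z) ^ 2) with (e1 ^ 2 * k ^ 2 * Cmod z ^ 2) by ring.
  rewrite Hzz.
  assert (Q1 : e1 ^ 2 * k ^ 2 * a ^ 2 <= (exp a - 1) ^ 2).
  { eapply Rle_trans; [|exact E2].
    replace ((e1 * a) ^ 2) with (e1 ^ 2 * 1 * a ^ 2) by ring.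
    apply Rmult_le_compat_r; [nra|]. apply Rmult_le_compat_l; nra. }
  assert (Q2 : e1 ^ 2 * k ^ 2 * b ^ 2 <= 4 * exp a * sin (b / 2) ^ 2).
  { apply Rle_trans with (4 * exp a * (k * b / 2) ^ 2);
      [|apply Rmult_le_compat_l; [lra|exact E3]].
    replace (4 * exp a * (k * b / 2) ^ 2) with (exp a * (k * b) ^ 2) by field.
    replace (e1 ^ 2 * k ^ 2 * b ^ 2) with (e1 ^ 2 * (k * b) ^ 2) by ring.
    apply Rmult_le_compat_r; [apply pow2_ge_0|nra]. }
  lra.
Qed.

Lemma exp_minus_1_lower_Re eta z : 0 < eta -> eta <= Rabs (Re z) ->
  Rmin eta (1 - exp (- eta)) <= Cmod (Cexp z - 1).
Proof.
  intros He La. pose proof (Cmod_Cexp_minus_1 z) as EE.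
  set (a := Re z) in *. pose proof (exp_pos a) as Hea.
  assert (Hee : exp (- eta) < 1) by (rewrite <- exp_0; apply exp_increasing; lra).
  apply pow2_le_inv; [apply Cmod_ge_0|].
  assert (0 < Rmin eta (1 - exp (- eta))) by (apply Rmin_pos; lra).
  rewrite EE. pose proof (pow2_ge_0 (sin (Im z / 2))).
  assert (0 <= 4 * exp a * sin (Im z / 2) ^ 2) by (apply Rmult_le_pos; lra).
  apply Rle_trans with ((exp a - 1) ^ 2); [|lra].
  destruct (Rle_lt_dec 0 a) as [P|P].
  + rewrite Rabs_right in La by lra. apply pow_incr. split; [lra|].
    apply Rle_trans with eta; [apply Rmin_l|]. pose proof (exp_ineq1_le a). lra.
  + rewrite Rabs_left in La by lra.
    replace ((exp a - 1) ^ 2) with ((1 - exp a) ^ 2) by ring.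
    apply pow_incr. split; [lra|].
    apply Rle_trans with (1 - exp (- eta)); [apply Rmin_r|].
    assert (exp a <= exp (- eta)) by (apply exp_mono; lra). lra.
Qed.

Lemma slope_bound theta Y : Rabs theta < PI / 2 -> 0 < Y ->
  (theta <> 0 -> Y < PI * Rabs (cos theta / sin theta)) ->
  Y * (Rabs (sin theta) / cos theta) < PI.
Proof.
  intros Ht HY HYt. pose proof PI_RGT_0.
  assert (Hc : 0 < cos theta) by (apply cos_gt_0; apply Rabs_def2 in Ht; lra).
  destruct (Req_dec theta 0) as [E|N].
  - rewrite E, sin_0, Rabs_R0. unfold Rdiv. lra.
  - specialize (HYt N). assert (Hs : 0 < Rabs (sin theta)).
    { apply Rabs_pos_lt. intros E. apply N. apply Rabs_def2 in Ht.
      destruct (Rtotal_order theta 0) as [L|[L|L]]; auto.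
      - assert (0 < sin (- theta)) by (apply sin_gt_0; lra). rewrite sin_neg in H0. lra.
      - assert (0 < sin theta) by (apply sin_gt_0; lra). lra. }
    rewrite Rabs_div, (Rabs_right (cos theta)) in HYt;
      [|lra|intros E; rewrite E, Rabs_R0 in Hs; lra].
    apply (Rmult_lt_compat_r (Rabs (sin theta) / cos theta)) in HYt.
    + eapply Rlt_le_trans; [exact HYt|]. right. field. lra.
    + apply Rdiv_lt_0_compat; auto.
Qed.

(** The condition on [Y] keeps the swept points with small real part inside a
    strip narrower than [|Im z| < 2 pi], hence away from the nonzero
    periods of the exponential. *)
Lemma swept_away theta Y : Rabs theta < PI / 2 -> 0 < Y ->
  (theta <> 0 -> Y < PI * Rabs (cos theta / sin theta)) ->
  exists R0 c, 0 < c /\ forall z, swept theta Y z -> Re z <= 1 ->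
    Cmod z <= R0 /\ c * Cmod z <= Cmod (Cexp z - 1).
Proof.
  intros Ht HY HYt. pose proof PI_RGT_0.
  assert (HT := slope_bound theta Y Ht HY HYt).
  assert (Hc : 0 < cos theta) by (apply cos_gt_0; apply Rabs_def2 in Ht; lra).
  assert (HT0 : 0 <= Rabs (sin theta) / cos theta).
  { apply Rdiv_le_0_compat; [apply Rabs_pos|auto]. }
  assert (HTs : Rabs (sin theta) = cos theta * (Rabs (sin theta) / cos theta)) by (field; lra).
  set (T := Rabs (sin theta) / cos theta) in *.
  (* Up to real part [eta] the swept points satisfy [|Im z| <= b1 < 2 pi]; the
     remaining ones have [|e^z - 1|] bounded below through [|Re z| >= eta]. *)
  set (eta := Rmin 1 ((PI - Y * T) / (2 * (T + 1)))).
  assert (Heta : 0 < eta).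
  { apply Rmin_pos; [lra|]. apply Rdiv_lt_0_compat; lra. }
  assert (Heta1 : eta <= 1) by apply Rmin_l.
  assert (Heta2 : (Y + eta) * T < PI).
  { assert (E : eta * (2 * (T + 1)) <= PI - Y * T).
    { apply Rle_trans with ((PI - Y * T) / (2 * (T + 1)) * (2 * (T + 1))).
      - apply Rmult_le_compat_r; [lra|apply Rmin_r].
      - right; field; lra. }
    nra. }
  set (b1 := PI + (Y + eta) * T).
  assert (HYe : 0 <= (Y + eta) * T) by (apply Rmult_le_pos; lra).
  destruct (sin_lower (b1 / 2)) as (k & Hk & Hsin); [unfold b1; lra|].
  set (R0 := (Y + 1) + (PI + (Y + 1) * T)).
  assert (HY1 : 0 <= (Y + 1) * T) by (apply Rmult_le_pos; lra).
  assert (HR0 : 0 < R0) by (unfold R0; lra).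
  assert (He1 : 0 < exp (-1)) by apply exp_pos.
  assert (Hee : exp (- eta) < 1) by (rewrite <- exp_0; apply exp_increasing; lra).
  set (c1 := Rmin eta (1 - exp (- eta))).
  assert (Hc1 : 0 < c1) by (apply Rmin_pos; lra).
  assert (Hc0 : 0 < Rmin (c1 / R0) (exp (-1) * k)).
  { apply Rmin_pos; [apply Rdiv_lt_0_compat; auto|apply Rmult_lt_0_compat; lra]. }
  exists R0, (Rmin (c1 / R0) (exp (-1) * k)). split; auto.
  intros z (y & s & Hs & Hy & HYy & Ez) Hz.
  assert (Ea : Re z = Re y + s * cos theta) by (rewrite Ez; csimp_ring).
  assert (Eb : Im z = Im y + s * sin theta) by (rewrite Ez; csimp_ring).
  assert (Hsc : 0 <= s * cos theta) by (apply Rmult_le_pos; lra).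
  assert (Ha : - Y <= Re z) by lra.
  assert (Hb : Rabs (Im z) <= PI + (Y + Re z) * T).
  { rewrite Eb. eapply Rle_trans; [apply Rabs_triang|].
    apply Rplus_le_compat; auto.
    rewrite Rabs_mult, (Rabs_right s), HTs, <- Rmult_assoc by lra.
    apply Rmult_le_compat_r; lra. }
  assert (HzR : Cmod z <= R0).
  { eapply Rle_trans; [apply Cmod_le_ReIm|]. unfold R0.
    apply Rplus_le_compat; [apply Rabs_le; lra|].
    apply Rle_trans with (1 := Hb), Rplus_le_compat_l, Rmult_le_compat_r; lra. }
  split; auto.
  assert (Hz0 := Cmod_ge_0 z).
  destruct (Rlt_le_dec (Rabs (Re z)) eta) as [La|La].
  - apply Rle_trans with (exp (-1) * k * Cmod z).
    { apply Rmult_le_compat_r; auto. apply Rmin_r. }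
    apply (exp_minus_1_lower_strip k b1); auto; [lra|].
    apply Rle_trans with (1 := Hb). unfold b1. apply Rabs_def2 in La.
    apply Rplus_le_compat_l, Rmult_le_compat_r; lra.
  - apply Rle_trans with c1; [|now apply exp_minus_1_lower_Re].
    apply Rle_trans with (c1 / R0 * R0); [|right; field; lra].
    apply Rmult_le_compat; try lra. apply Rmin_l.
Qed.

Lemma swept_regular theta Y z : Rabs theta < PI / 2 -> 0 < Y ->
  (theta <> 0 -> Y < PI * Rabs (cos theta / sin theta)) ->
  swept theta Y z -> z <> 0 -> regular z.
Proof.
  intros Ht HY HYt Hz Hz0.
  destruct (Rle_lt_dec (Re z) 1) as [L|L]; [|apply regular_of_Re_pos; lra].
  destruct (swept_away theta Y Ht HY HYt) as (R0 & c & Hc & HS).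
  destruct (HS z Hz L) as [B1 B2]. split; auto. intros E. rewrite E in B2.
  replace (1 - 1)%C with (RtoC 0) in B2 by ring. rewrite Cmod_0 in B2.
  apply Cmod_gt_0 in Hz0. nra.
Qed.

Lemma swept_Re theta Y z : Rabs theta < PI / 2 -> swept theta Y z -> - Y <= Re z.
Proof.
  intros Ht (y & s & Hs & _ & HY' & E).
  rewrite E. replace (Re _) with (Re y + s * cos theta) by csimp_ring.
  assert (0 < cos theta) by (apply cos_gt_0; apply Rabs_def2 in Ht; lra).
  assert (0 <= s * cos theta) by (apply Rmult_le_pos; lra). lra.
Qed.

(** Decay comes from the right half-plane; on the bounded remaining part a constant
    bound is enough. *)
Lemma polefree_bounded_swept theta Y m : Rabs theta < PI / 2 -> 0 < Y ->
  (theta <> 0 -> Y < PI * Rabs (cos theta / sin theta)) -> (1 <= m)%nat ->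
  exists M, 0 <= M /\ forall z, swept theta Y z -> z <> 0 ->
    Cmod (polefree m z) <= M / (1 + Re z ^ 2).
Proof.
  intros Ht HY HYt Hm.
  destruct (swept_away theta Y Ht HY HYt) as (R0 & c & Hc & HS).
  destruct (polefree_bounded_compact R0 c m Hc) as (M0 & HM0).
  destruct (polefree_bounded_right m) as (M1 & HM1p & HM1).
  set (Q := (Rabs M0) * (2 + Y ^ 2)).
  assert (HQ : 0 <= Q).
  { apply Rmult_le_pos; [apply Rabs_pos|]. pose proof (pow2_ge_0 Y). lra. }
  exists (M1 + Q). split; [lra|]. intros z Hz Hz0.
  pose proof (pow2_ge_0 (Re z)).
  assert (P : 0 < / (1 + Re z ^ 2)) by (apply Rinv_0_lt_compat; lra).
  destruct (Rle_lt_dec (Re z) 1) as [L|L].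
  - destruct (HS z Hz L) as [B1 B2].
    assert (B : Cmod (polefree m z) <= M0).
    { apply HM0; auto. now apply (swept_regular theta Y). }
    apply Rle_trans with (Q / (1 + Re z ^ 2)).
    + apply (Rmult_le_reg_r (1 + Re z ^ 2)); [lra|]. unfold Rdiv.
      rewrite Rmult_assoc, Rinv_l, Rmult_1_r by lra. unfold Q.
      pose proof (swept_Re theta Y z Ht Hz).
      apply Rmult_le_compat; [apply Cmod_ge_0|lra| |destruct (Rle_lt_dec 0 (Re z)); nra].
      eapply Rle_trans; [exact B|apply Rle_abs].
    + unfold Rdiv. nra.
  - eapply Rle_trans; [apply HM1; [lra|auto]|]. unfold Rdiv. nra.
Qed.

(** * Bernoulli numbers and the Euler-Maclaurin formula on one step *)

(** The scaled Bernoulli numbers [B_k / k!]. *)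
Definition bernoulli_coefs (c : nat -> R) : Prop :=
  c 0%nat = 1 /\ c 1%nat = - 1 / 2 /\
  (forall n, (1 <= n)%nat -> sum_n (fun k => c k / INR (fact (n - k + 1))) n = 0) /\
  (forall k, (1 <= k)%nat -> c (2 * k + 1)%nat = 0).

Lemma exp_div_series x : x <> 0 ->
  is_pseries (fun j => / INR (fact (S j))) x ((exp x - 1) / x).
Proof.
  intros Hx.
  pose proof (is_pseries_decr_1 (V := R_NormedModule) _ x (/ x) _ (Rinv_l x Hx) (is_exp_Reals x)) as H.
  replace ((exp x - 1) / x) with (scal (/ x) (plus (exp x) (opp (/ INR (fact 0))))).
  - exact H.
  - unfold scal, plus, opp; simpl. unfold mult; simpl. rewrite Rinv_1. field. auto.
Qed.

Lemma sum_n_sum_f_R0 (u : nat -> R) n : sum_f_R0 u n = sum_n u n.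
Proof. now rewrite sum_n_Reals. Qed.

Lemma bernoulli_pseries B : is_bernoulli B -> exists r, 0 < r /\
  forall x, x <> 0 -> Rabs x < r ->
  is_pseries (fun k => B k / INR (fact k)) x (x / (exp x - 1)).
Proof.
  intros (r & Hr & H). exists r. split; auto. intros x Hx Hxr.
  apply is_pseries_R. specialize (H x Hx Hxr).
  apply (is_series_scal_l x) in H. eapply is_series_ext; [|exact H].
  intros k. simpl. replace (Z.of_nat k - 1)%Z with (Z.of_nat k + (-1))%Z by ring.
  rewrite powerRZ_add, <- pow_powerRZ by auto. simpl.
  unfold scal; simpl; unfold mult; simpl. field. split; auto. apply INR_fact_neq_0.
Qed.

Lemma exp_minus_1_neq x : x <> 0 -> exp x - 1 <> 0.
Proof. intros H E. apply H. apply exp_inv. rewrite exp_0. lra. Qed.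

Lemma pseries_coef_eq (a b : nat -> R) r (g : R -> R) : 0 < r ->
  (forall x, 0 < Rabs x < r -> is_pseries a x (g x)) ->
  (forall x, 0 < Rabs x < r -> is_pseries b x (g x)) -> forall n, a n = b n.
Proof.
  intros Hr Ha Hb n.
  assert (Hd : forall x, 0 < Rabs x < r -> is_pseries (PS_minus a b) x 0).
  { intros x Hx. replace 0 with (plus (g x) (opp (g x)))
      by (unfold plus, opp; simpl; ring).
    apply @is_pseries_minus; auto. }
  assert (Z : PS_minus a b n = 0).
  { apply (PSeries_zero_right _ r); auto.
    - apply Rbar_lt_le_trans with (Finite r); auto.
      apply (CV_radius_ge _ r (fun h => PSeries (PS_minus a b) h)).
      intros h Hh. apply PSeries_correct.
      destruct (Req_dec h 0) as [->|N].
      + exists (PS_minus a b 0%nat). apply @is_pseries_0.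
      + exists 0. apply Hd. split; auto. now apply Rabs_pos_lt.
    - intros h Hh. apply is_pseries_unique, Hd. rewrite Rabs_right; lra. }
  unfold PS_minus, plus, opp in Z; simpl in Z. unfold PS_plus, PS_opp, plus, opp in Z.
  simpl in Z. lra.
Qed.

(** The Cauchy product of [x/(e^x-1)] and [(e^x-1)/x]. *)
Lemma bernoulli_recurrence B : is_bernoulli B -> forall n,
  sum_n (fun k => B k / INR (fact k) / INR (fact (n - k + 1))) n = if Nat.eqb n 0 then 1 else 0.
Proof.
  intros HB. destruct (bernoulli_pseries B HB) as (r & Hr & H).
  set (c := fun k => B k / INR (fact k)) in *.
  set (a := fun j => / INR (fact (S j))).
  assert (Rc : Rbar_le r (CV_radius c)).
  { apply (CV_radius_ge c r (PSeries c)). intros h Hh. apply PSeries_correct.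
    destruct (Req_dec h 0) as [->|N]; [exists (c 0%nat); apply @is_pseries_0|].
    eexists; now apply H. }
  assert (Ra : Rbar_le r (CV_radius a)).
  { apply (CV_radius_ge a r (PSeries a)). intros h Hh. apply PSeries_correct.
    destruct (Req_dec h 0) as [->|N]; [exists (a 0%nat); apply @is_pseries_0|].
    eexists; now apply exp_div_series. }
  intros n.
  transitivity (PS_mult c a n).
  { unfold PS_mult. rewrite sum_n_sum_f_R0. apply sum_n_ext_loc. intros k Hk.
    unfold a, Rdiv. now rewrite Nat.add_1_r. }
  apply (pseries_coef_eq (PS_mult c a) (fun n => if Nat.eqb n 0 then 1 else 0) r (fun _ => 1)); auto.
  - intros x [Hx1 Hx2]. assert (Hx : x <> 0) by (intros E; rewrite E, Rabs_R0 in Hx1; lra).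
    replace 1 with (x / (exp x - 1) * ((exp x - 1) / x))
      by (field; split; auto; now apply exp_minus_1_neq).
    apply is_pseries_mult; auto; try now apply exp_div_series.
    + now apply (Rbar_lt_le_trans _ r).
    + now apply (Rbar_lt_le_trans _ r).
  - intros x _. apply is_pseries_R.
    apply (is_series_ext (fun k => if Nat.eqb k 0 then 1 else 0)).
    { intros [|k]; simpl; ring. }
    apply is_series_decr_1. unfold plus, opp; simpl. rewrite Rplus_opp_r.
    apply (is_series_ext (fun _ => 0)); auto.
    eapply filterlim_ext; [|apply filterlim_const].
    intros m. simpl. rewrite sum_n_const. ring.
Qed.

(** [x/(e^x-1) + x/2] is even. *)
Lemma bernoulli_odd B : is_bernoulli B -> forall k, (1 <= k)%nat ->
  B (2 * k + 1)%nat / INR (fact (2 * k + 1)) = 0.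
Proof.
  intros HB k Hk. destruct (bernoulli_pseries B HB) as (r & Hr & H).
  set (c := fun k => B k / INR (fact k)) in *.
  change (c (2 * k + 1)%nat = 0).
  assert (E : forall n, c n - (-1) ^ n * c n = if Nat.eqb n 1 then -1 else 0).
  { apply (pseries_coef_eq _ _ r (fun x => - x)); auto.
    - intros x [Hx1 Hx2]. assert (Hx : x <> 0) by (intros E; rewrite E, Rabs_R0 in Hx1; lra).
      assert (Hm : - x <> 0) by lra.
      pose proof (H x Hx Hx2) as H1.
      assert (H2 := H (- x) Hm). rewrite Rabs_Ropp in H2. specialize (H2 Hx2).
      apply is_pseries_R. apply is_pseries_R in H1, H2.
      replace (- x) with (minus (x / (exp x - 1)) (- x / (exp (- x) - 1))).
      + eapply is_series_ext; [|apply @is_series_minus; [exact H1|exact H2]].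
        intros n. change (c n * x ^ n - c n * (- x) ^ n = (c n - (-1) ^ n * c n) * x ^ n).
        replace ((- x) ^ n) with ((-1) ^ n * x ^ n)
          by (rewrite <- Rpow_mult_distr; f_equal; ring).
        ring.
      + unfold minus, plus, opp; simpl.
        pose proof (exp_minus_1_neq x Hx). pose proof (exp_minus_1_neq (- x) Hm).
        assert (P : exp (- x) = / exp x) by apply exp_Ropp.
        pose proof (exp_pos x). rewrite P in *.
        replace (/ exp x - 1) with ((1 - exp x) / exp x) by (field; lra).
        field. repeat split; lra.
    - intros x _. apply is_pseries_R. apply is_series_decr_1.
      apply is_series_decr_1. simpl.
      replace (plus _ _) with 0 by (unfold plus, opp; simpl; ring).
      apply (is_series_ext (fun _ => 0)); [intros; simpl; ring|].
      eapply filterlim_ext; [|apply filterlim_const].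
      intros m. simpl. rewrite sum_n_const. ring. }
  specialize (E (2 * k + 1)%nat).
  rewrite pow_add, pow_1_even in E. destruct (Nat.eqb_spec (2 * k + 1) 1); [lia|]. lra.
Qed.

Lemma bernoulli_coefs_of B : is_bernoulli B -> bernoulli_coefs (fun k => B k / INR (fact k)).
Proof.
  intros HB. pose proof (bernoulli_recurrence B HB) as Hrec.
  assert (E0 : B 0%nat / INR (fact 0) = 1).
  { specialize (Hrec 0%nat). rewrite sum_O in Hrec. simpl in *. lra. }
  assert (E1 : B 1%nat / INR (fact 1) = - 1 / 2).
  { specialize (Hrec 1%nat). rewrite sum_Sn, sum_O in Hrec. unfold plus in Hrec. simpl in *. lra. }
  repeat split; auto.
  - intros n Hn. rewrite Hrec. destruct (Nat.eqb_spec n 0); auto; lia.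
  - now apply bernoulli_odd.
Qed.

Lemma bernoulli_unique B B' : is_bernoulli B -> is_bernoulli B' ->
  forall n, B n / INR (fact n) = B' n / INR (fact n).
Proof.
  intros HB HB'. pose proof (bernoulli_recurrence B HB) as H.
  pose proof (bernoulli_recurrence B' HB') as H'.
  intros n. induction n as [n IH] using lt_wf_ind.
  specialize (H n). specialize (H' n). rewrite <- H' in H.
  destruct n as [|n].
  - rewrite !sum_O in H. simpl in *. lra.
  - rewrite !sum_Sn in H. rewrite Nat.sub_diag in H. unfold plus in H; simpl AbelianMonoid.sort in H.
    rewrite (sum_n_ext_loc _ (fun k => B' k / INR (fact k) / INR (fact (S n - k + 1)))) in H.
    + simpl (INR (fact (0 + 1))) in H. unfold plus in H. simpl in H. simpl. lra.
    + intros k Hk. rewrite IH by lia. reflexivity.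
Qed.

(** The Bernoulli polynomial [B_j(t)] divided by [j!]. *)
Definition bpoly (c : nat -> R) (j : nat) (t : R) : R :=
  sum_n (fun i => c i * (t ^ (j - i) / INR (fact (j - i)))) j.

Lemma bpoly_0 c t : c 0%nat = 1 -> bpoly c 0 t = 1.
Proof. intros H. unfold bpoly. rewrite sum_O, H. simpl. field. Qed.

Lemma bpoly_derive c j t : is_derive (bpoly c (S j)) t (bpoly c j t).
Proof.
  unfold bpoly.
  apply (is_derive_ext (fun t => sum_n (fun i => c i * (t ^ (S j - i) / INR (fact (S j - i)))) j
     + c (S j))).
  { intros s. rewrite sum_Sn, Nat.sub_diag. unfold plus; simpl. field. }
  rewrite <- (Rplus_0_r (sum_n _ j)).
  apply @is_derive_plus; [|apply @is_derive_const].
  apply (is_derive_sum_n (K := R_AbsRing) (V := R_NormedModule)). intros k Hk.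
  replace (S j - k)%nat with (S (j - k)) by lia.
  apply is_derive_scal.
  evar_last.
  - apply (is_derive_ext (fun t => / INR (fact (S (j - k))) * t ^ S (j - k)));
      [intros; unfold Rdiv; apply Rmult_comm|].
    apply is_derive_scal, (is_derive_pow (fun t => t)), @is_derive_id.
  - simpl pred. rewrite fact_simpl, mult_INR. change one with 1.
    field. split; [apply INR_fact_neq_0|apply not_0_INR; lia].
Qed.

Lemma bpoly_at_0 c j : bpoly c j 0 = c j.
Proof.
  unfold bpoly. destruct j as [|j].
  - rewrite sum_O. simpl. field.
  - rewrite sum_Sn, Nat.sub_diag.
    rewrite (sum_n_ext_loc _ (fun _ => 0)).
    + rewrite sum_n_const. unfold plus; simpl. field.
    + intros k Hk. replace (S j - k)%nat with (S (j - k)) by lia. simpl. unfold Rdiv; ring.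
Qed.

Lemma bpoly_at_1 c j : bernoulli_coefs c -> (2 <= j)%nat -> bpoly c j 1 = c j.
Proof.
  intros (_ & _ & H & _) Hj. destruct j as [|j]; [lia|].
  unfold bpoly. rewrite sum_Sn, Nat.sub_diag.
  rewrite (sum_n_ext_loc _ (fun k => c k / INR (fact (j - k + 1)))).
  - rewrite H by lia. unfold plus; simpl. field.
  - intros k Hk. rewrite pow1. replace (S j - k)%nat with (j - k + 1)%nat by lia.
    match goal with |- ?a = ?b => change (@eq R a b) end. unfold Rdiv. ring.
Qed.

Definition bpoly_bound (c : nat -> R) (j : nat) : R := sum_n (fun i => Rabs (c i)) j.

Lemma bpoly_bounded c j t : 0 <= t <= 1 -> Rabs (bpoly c j t - c j) <= bpoly_bound c j.
Proof.
  intros Ht. unfold bpoly, bpoly_bound.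
  assert (G : forall u n, Rabs (sum_n u n) <= sum_n (fun k => Rabs (u k)) n).
  { intros u n. apply (norm_sum_n_m (K := R_AbsRing) (V := R_NormedModule)). }
  assert (L : forall n, (n <= j)%nat ->
    Rabs (sum_n (fun i => c i * (t ^ (j - i) / INR (fact (j - i)))) n) <=
    sum_n (fun i => Rabs (c i)) n).
  { intros n Hn. eapply Rle_trans; [apply G|]. apply sum_n_m_le.
    intros k. rewrite Rabs_mult.
    rewrite <- (Rmult_1_r (Rabs (c k))) at 2. apply Rmult_le_compat_l; [apply Rabs_pos|].
    pose proof (INR_fact_lt_0 (j - k)).
    assert (1 <= INR (fact (j - k))) by (apply (le_INR 1), lt_O_fact).
    assert (0 <= t ^ (j - k)) by (apply pow_le; lra).
    assert (t ^ (j - k) <= 1) by (rewrite <- (pow1 (j - k)); apply pow_incr; lra).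
    rewrite Rabs_right by (apply Rle_ge, Rdiv_le_0_compat; lra).
    apply (Rmult_le_reg_r (INR (fact (j - k)))); auto. unfold Rdiv.
    rewrite Rmult_assoc, Rinv_l by lra. lra. }
  destruct j as [|j].
  - rewrite !sum_O. simpl. replace (c 0%nat * (1 / 1) - c 0%nat) with 0 by field.
    rewrite Rabs_R0. apply Rabs_pos.
  - rewrite !sum_Sn, Nat.sub_diag. unfold plus; simpl AbelianMonoid.sort.
    specialize (L j). pose proof (Rabs_pos (c (S j))).
    assert (E : forall v : R, v + c (S j) * (t ^ 0 / INR (fact 0)) - c (S j) = v)
      by (intros; simpl; field).
    rewrite E.
    apply Rle_trans with (1 := L ltac:(lia)).
    rewrite <- (Rplus_0_r (sum_n (fun i => Rabs (c i)) j)) at 1.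
    now apply Rplus_le_compat_l.
Qed.

(** Repeated integration by parts of [f 0] against [B_0(t) = 1]: up to a last term in
    [f M], the derivative of this sum telescopes to [f 0]. *)
Fixpoint em_sum (c : nat -> R) (f : nat -> R -> C) (M : nat) (t : R) : C :=
  match M with
  | O => 0
  | S m => (em_sum c f m t + RtoC ((-1) ^ m * bpoly c (S m) t) * f m t)%C
  end.

Lemma em_sum_derive c f M t : c 0%nat = 1 ->
  (forall j, (j < M)%nat -> Cderive (f j) t (f (S j) t)) ->
  Cderive (em_sum c f M) t (f 0%nat t - RtoC ((-1) ^ M * bpoly c M t) * f M t)%C.
Proof.
  intros Hc. induction M as [|m IH]; intros Hf.
  - eapply Cderive_eq; [apply Cderive_const|]. rewrite bpoly_0 by auto. simpl. rewrite Rmult_1_l. ring.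
  - eapply Cderive_eq.
    + apply (Cderive_plus (em_sum c f m) (fun t => RtoC ((-1) ^ m * bpoly c (S m) t) * f m t)%C);
        [apply IH; auto|].
      apply (Cderive_mult (fun t => RtoC ((-1) ^ m * bpoly c (S m) t)) (f m)); [|apply Hf; lia].
      apply Cderive_real. apply is_derive_scal, bpoly_derive.
    + cbv beta. replace ((-1) ^ S m * bpoly c (S m) t) with (- ((-1) ^ m * bpoly c (S m) t)) by (simpl; ring).
      rewrite RtoC_opp. ring.
Qed.

Lemma em_sum_Ccont c f M t : (forall j, (j < M)%nat -> Ccont (f j) t) -> Ccont (em_sum c f M) t.
Proof.
  induction M as [|m IH]; intros Hf; [apply Ccont_const|].
  apply (Ccont_plus (em_sum c f m)); [apply IH; auto|].
  apply (Ccont_mult (fun t => RtoC ((-1) ^ m * bpoly c (S m) t)) (f m)); [|apply Hf; lia].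
  eapply Ccont_of_Cderive. apply Cderive_real. apply is_derive_scal, bpoly_derive.
Qed.

Lemma em_sum_increment c f N : bernoulli_coefs c ->
  (em_sum c f (2 * N + 1) 1 - em_sum c f (2 * N + 1) 0 =
   (f 0%nat 0 + f 0%nat 1) / 2 -
   sum_n_m (fun k => RtoC (c (2 * k)%nat) * (f (2 * k - 1)%nat 1 - f (2 * k - 1)%nat 0)) 1 N)%C.
Proof.
  intros Hc. destruct (Hc) as (H0 & H1 & _ & Ho).
  induction N as [|N IH].
  - rewrite sum_n_m_zero by lia. simpl.
    assert (E : forall t, bpoly c 1 t = t - 1 / 2).
    { intros t. unfold bpoly. rewrite sum_Sn, sum_O, H0, H1. unfold plus; simpl. field. }
    rewrite !E. unfold zero; simpl.
    apply C_eq; unfold Cinv; csimp; field.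
  - rewrite sum_n_Sm by lia.
    replace (2 * S N + 1)%nat with (S (S (2 * N + 1))) by lia.
    change (em_sum c f (S (S (2 * N + 1))) 1) with
      (em_sum c f (2 * N + 1) 1 + RtoC ((-1) ^ (2 * N + 1) * bpoly c (S (2 * N + 1)) 1) * f (2 * N + 1)%nat 1
       + RtoC ((-1) ^ (S (2 * N + 1)) * bpoly c (S (S (2 * N + 1))) 1) * f (S (2 * N + 1)) 1)%C.
    change (em_sum c f (S (S (2 * N + 1))) 0) with
      (em_sum c f (2 * N + 1) 0 + RtoC ((-1) ^ (2 * N + 1) * bpoly c (S (2 * N + 1)) 0) * f (2 * N + 1)%nat 0
       + RtoC ((-1) ^ (S (2 * N + 1)) * bpoly c (S (S (2 * N + 1))) 0) * f (S (2 * N + 1)) 0)%C.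
    rewrite !bpoly_at_1, !bpoly_at_0 by (auto; lia).
    replace (c (S (S (2 * N + 1)))) with 0.
    2: { rewrite <- (Ho (S N)) by lia. f_equal. lia. }
    replace (2 * S N - 1)%nat with (2 * N + 1)%nat by lia.
    replace (S (2 * N + 1)) with (2 * S N)%nat by lia.
    replace ((-1) ^ (2 * N + 1)) with (-1) by (rewrite pow_add, pow_1_even; simpl; ring).
    rewrite Rmult_0_r.
    replace (-1 * c (2 * S N)%nat) with (- c (2 * S N)%nat) by ring. rewrite RtoC_opp.
    unfold plus; simpl plus.
    match goal with |- (?a + ?b + ?d - (?a' + ?b' + ?d') = _)%C =>
      replace (a + b + d - (a' + b' + d'))%C with ((a - a') + (b - b') + (d - d'))%C by ring end.
    rewrite IH. change (@plus C_AbelianMonoid) with Cplus.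
    simpl. ring.
Qed.

(** In the last integration by parts the Bernoulli polynomial of even degree [M] is
    replaced by its difference with [B_M], which vanishes at both ends. So the sum
    stops at the derivative of order [2N-1] while the remainder involves the one of
    order [2N+2]: this is what produces [|beta|^(2N+1)] and not [|beta|^(2N)] after
    summation over all steps. No integral is needed: the remainder is measured by
    any function [A] whose derivative dominates [f M]. *)
Lemma euler_maclaurin_step c N (f : nat -> R -> C) (F : R -> C) (A A' : R -> R) :
  bernoulli_coefs c ->
  (forall s, 0 <= s <= 1 -> Ccont F s) ->
  (forall j s, (j < 2 * N + 2)%nat -> 0 <= s <= 1 -> Ccont (f j) s) ->
  (forall s, 0 <= s <= 1 -> continuity_pt A s) ->
  (forall s, 0 < s < 1 -> Cderive F s (f 0%nat s)) ->
  (forall j s, (j < 2 * N + 2)%nat -> 0 < s < 1 -> Cderive (f j) s (f (S j) s)) ->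
  (forall s, 0 < s < 1 -> is_derive A s (A' s)) ->
  (forall s, 0 < s < 1 -> Cmod (f (2 * N + 2)%nat s) <= A' s) ->
  Cmod ((f 0%nat 0 + f 0%nat 1) / 2 -
    sum_n_m (fun k => RtoC (c (2 * k)%nat) * (f (2 * k - 1)%nat 1 - f (2 * k - 1)%nat 0)) 1 N
    - (F 1 - F 0))%C <= bpoly_bound c (2 * N + 2) * (A 1 - A 0).
Proof.
  intros Hc HF Hf HA DF Df DA HB. destruct (Hc) as (H0 & _).
  set (M := (2 * N + 2)%nat) in *.
  set (W := fun t => (em_sum c f M t + RtoC (c M) * f (2 * N + 1)%nat t - F t)%C).
  pose proof (mean_value_ineq W (fun t => - (RtoC (bpoly c M t - c M) * f M t))%C
    (fun t => bpoly_bound c M * A t) (fun t => bpoly_bound c M * A' t) 0 1) as Q.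
  assert (Pm : (-1) ^ M = 1).
  { unfold M. replace (2 * N + 2)%nat with (2 * (S N))%nat by lia. apply pow_1_even. }
  replace (_ - _)%C with (W 1 - W 0)%C.
  - rewrite Rmult_minus_distr_l. apply Q; [lra|..].
    + intros s Hs. unfold W. apply Ccont_minus; auto. apply Ccont_plus.
      * apply em_sum_Ccont. auto.
      * apply Ccont_mult; [apply Ccont_const|]. apply Hf; auto. unfold M; lia.
    + intros s Hs. apply continuity_pt_scal; auto.
    + intros s Hs. unfold W. eapply Cderive_eq.
      * apply Cderive_minus; [apply Cderive_plus|apply DF; auto].
        -- apply em_sum_derive; auto.
        -- apply Cderive_scal. apply Df; auto. unfold M; lia.
      * replace (S (2 * N + 1)) with M by (unfold M; lia).
        rewrite Pm, Rmult_1_l, RtoC_minus. ring.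
    + intros s Hs. apply is_derive_scal; auto.
    + intros s Hs. rewrite Cmod_opp, Cmod_mult, Cmod_R.
      apply Rmult_le_compat; [apply Rabs_pos|apply Cmod_ge_0| |auto].
      apply bpoly_bounded; lra.
  - rewrite <- em_sum_increment by auto. unfold W.
    replace M with (S (2 * N + 1)) by (unfold M; lia).
    change (em_sum c f (S (2 * N + 1)) 1) with
      (em_sum c f (2 * N + 1) 1 + RtoC ((-1) ^ (2 * N + 1) * bpoly c (S (2 * N + 1)) 1) * f (2 * N + 1)%nat 1)%C.
    change (em_sum c f (S (2 * N + 1)) 0) with
      (em_sum c f (2 * N + 1) 0 + RtoC ((-1) ^ (2 * N + 1) * bpoly c (S (2 * N + 1)) 0) * f (2 * N + 1)%nat 0)%C.
    rewrite bpoly_at_1, bpoly_at_0 by (auto; lia).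
    replace ((-1) ^ (2 * N + 1)) with (-1) by (rewrite pow_add, pow_1_even; simpl; ring).
    replace (-1 * c (S (2 * N + 1))) with (- c (S (2 * N + 1))) by ring.
    rewrite RtoC_opp. ring.
Qed.

(** * The constant in Stirling's formula *)

(** Only the value of the constant is at stake here; convergence will follow from
    the summability of the defect of Stirling's main terms. *)
Definition wallis (k : nat) : R := RInt (fun x => sin x ^ k) 0 (PI / 2).

Lemma wallis_is_RInt k : is_RInt (fun x => sin x ^ k) 0 (PI / 2) (wallis k).
Proof.
  apply (RInt_correct (V := R_CompleteNormedModule)).
  apply (ex_RInt_continuous (V := R_CompleteNormedModule)). intros z _.
  apply continuity_pt_filterlim. reg.
Qed.

(** From the derivative of [- cos x * (sin x)^(k+1)]. *)
Lemma wallis_recurrence k : INR (k + 2) * wallis (k + 2) = INR (k + 1) * wallis k.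
Proof.
  assert (H : is_RInt (fun x => INR (k + 2) * sin x ^ (k + 2) - INR (k + 1) * sin x ^ k) 0 (PI / 2)
    (INR (k + 2) * wallis (k + 2) - INR (k + 1) * wallis k)).
  { apply @is_RInt_minus; apply @is_RInt_scal; apply wallis_is_RInt. }
  assert (H' : is_RInt (fun x => INR (k + 2) * sin x ^ (k + 2) - INR (k + 1) * sin x ^ k) 0 (PI / 2)
    (minus (- cos (PI / 2) * sin (PI / 2) ^ (k + 1)) (- cos 0 * sin 0 ^ (k + 1)))).
  { apply (is_RInt_derive (fun x => - cos x * sin x ^ (k + 1))).
    - intros x _. auto_derive; auto.
      replace (k + 2)%nat with (S (S k)) by lia. replace (k + 1)%nat with (S k) by lia.
      simpl pred. rewrite (S_INR (S k)). simpl pow.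
      assert (E : cos x * cos x = 1 - sin x * sin x).
      { pose proof (sin2_cos2 x) as Q. unfold Rsqr in Q. lra. }
      transitivity (sin x * sin x * sin x ^ k - INR (S k) * sin x ^ k * (cos x * cos x)).
      + ring.
      + rewrite E. ring.
    - intros x _. apply continuity_pt_filterlim. reg. }
  pose proof (is_RInt_unique _ _ _ _ H) as E1. pose proof (is_RInt_unique _ _ _ _ H') as E2.
  rewrite E1 in E2. rewrite cos_PI2, sin_0, (pow_i (k + 1)) in E2 by lia.
  unfold minus, plus, opp in E2; simpl in E2. lra.
Qed.

Lemma wallis_0 : wallis 0 = PI / 2.
Proof.
  unfold wallis. simpl. rewrite RInt_const. unfold scal; simpl; unfold mult; simpl. ring.
Qed.

Lemma wallis_1 : wallis 1 = 1.
Proof.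
  apply is_RInt_unique.
  replace 1 with (minus (- cos (PI / 2)) (- cos 0))
    by (rewrite cos_PI2, cos_0; unfold minus, plus, opp; simpl; ring).
  apply (is_RInt_derive (fun x => - cos x)).
  - intros x _. auto_derive; auto. ring.
  - intros x _. apply continuity_pt_filterlim. reg.
Qed.

Lemma wallis_decr k : wallis (k + 1) <= wallis k.
Proof.
  pose proof PI_RGT_0.
  apply (is_RInt_le (fun x => sin x ^ (k + 1)) (fun x => sin x ^ k) 0 (PI / 2));
    [lra|apply wallis_is_RInt|apply wallis_is_RInt|].
  intros x Hx. rewrite Nat.add_1_r. simpl.
  assert (0 <= sin x) by (apply sin_ge_0; lra). pose proof (SIN_bound x).
  assert (0 <= sin x ^ k) by now apply pow_le. nra.
Qed.

Lemma wallis_invariant k : INR (k + 1) * wallis k * wallis (k + 1) = PI / 2.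
Proof.
  induction k as [|k IH].
  - simpl. rewrite wallis_0, wallis_1. ring.
  - rewrite <- IH. replace (S k + 1)%nat with (k + 2)%nat by lia.
    rewrite Rmult_assoc, (Rmult_comm (wallis (S k))), <- Rmult_assoc, wallis_recurrence.
    rewrite Nat.add_1_r. ring.
Qed.

Lemma wallis_pos k : 0 < wallis k.
Proof.
  assert (P : forall k, 0 < wallis k /\ 0 < wallis (k + 1)).
  { clear k. induction k as [|k [IH1 IH2]].
    - simpl. rewrite wallis_0, wallis_1. pose proof PI_RGT_0. lra.
    - replace (S k) with (k + 1)%nat by lia. split; auto.
      replace (k + 1 + 1)%nat with (k + 2)%nat by lia.
      assert (0 < INR (k + 2)) by (apply lt_0_INR; lia).
      assert (0 < INR (k + 1)) by (apply lt_0_INR; lia).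
      apply (Rmult_lt_reg_l (INR (k + 2))); auto. rewrite wallis_recurrence, Rmult_0_r.
      now apply Rmult_lt_0_compat. }
  exact (proj1 (P k)).
Qed.

Lemma wallis_even n : wallis (2 * n) * (4 ^ n * INR (fact n) ^ 2) = PI / 2 * INR (fact (2 * n)).
Proof.
  induction n as [|n IH].
  - simpl. rewrite wallis_0. ring.
  - replace (2 * S n)%nat with (2 * n + 2)%nat by lia.
    assert (E : INR (fact (2 * n + 2)) = INR (2 * n + 2) * INR (2 * n + 1) * INR (fact (2 * n))).
    { replace (2 * n + 2)%nat with (S (S (2 * n))) by lia.
      rewrite !fact_simpl, !mult_INR. replace (2 * n + 1)%nat with (S (2 * n)) by lia. ring. }
    rewrite E, fact_simpl, mult_INR.
    assert (E2 : INR (2 * n + 2) = 2 * INR (S n)).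
    { replace (2 * n + 2)%nat with (2 * S n)%nat by lia. rewrite mult_INR. simpl; ring. }
    pose proof (wallis_recurrence (2 * n)) as R.
    transitivity (INR (2 * n + 2) * (INR (2 * n + 2) * wallis (2 * n + 2)) * (4 ^ n * INR (fact n) ^ 2)).
    + rewrite E2. replace (4 ^ S n) with (4 * 4 ^ n) by reflexivity. ring.
    + rewrite R. transitivity (INR (2 * n + 2) * INR (2 * n + 1) * (wallis (2 * n) * (4 ^ n * INR (fact n) ^ 2))).
      * ring.
      * rewrite IH. ring.
Qed.

(** With [w_k] the integral of [sin^k], [P] is both [(pi/2)/w_{2n}] and
    [m w_{2n+1}]; the bounds follow from [w_{2n+2} <= w_{2n+1} <= w_{2n}]. *)
Lemma central_binomial_bounds n :
  let P := 4 ^ n * INR (fact n) ^ 2 / INR (fact (2 * n)) in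
  let m := INR (2 * n + 1) in
  0 < P /\ PI / 2 * m * (m / (m + 1)) <= P ^ 2 <= PI / 2 * m.
Proof.
  intros P m. pose proof (INR_fact_lt_0 n) as F1. pose proof (INR_fact_lt_0 (2 * n)) as F2.
  pose proof PI_RGT_0 as HPI.
  assert (HP : 0 < P).
  { apply Rdiv_lt_0_compat; auto. apply Rmult_lt_0_compat; apply pow_lt; lra. }
  assert (Hm : 1 <= m) by (apply (le_INR 1); lia).
  assert (E : wallis (2 * n) * P = PI / 2).
  { unfold P. pose proof (wallis_even n) as W. unfold Rdiv at 1.
    rewrite <- Rmult_assoc, W. field. lra. }
  pose proof (wallis_invariant (2 * n)) as I. fold m in I.
  pose proof (wallis_pos (2 * n)) as W0. pose proof (wallis_pos (2 * n + 1)) as W1.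
  pose proof (wallis_decr (2 * n)) as D1.
  pose proof (wallis_decr (2 * n + 1)) as D2.
  pose proof (wallis_recurrence (2 * n)) as R.
  replace (2 * n + 1 + 1)%nat with (2 * n + 2)%nat in D2 by lia.
  replace (INR (2 * n + 2)) with (m + 1) in R
    by (unfold m; rewrite <- S_INR; f_equal; lia).
  fold m in R.
  set (w0 := wallis (2 * n)) in *. set (w1 := wallis (2 * n + 1)) in *.
  set (w2 := wallis (2 * n + 2)) in *.
  assert (E1 : m * w1 = P).
  { apply (Rmult_eq_reg_l w0); [|lra]. rewrite E, <- I. ring. }
  split; auto. split.
  - assert (w0 * (m / (m + 1)) <= w1).
    { replace (w0 * (m / (m + 1))) with (m * w0 / (m + 1)) by (field; lra).
      rewrite <- R. replace ((m + 1) * w2 / (m + 1)) with w2 by (field; lra). auto. }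
    rewrite <- E.
    replace (w0 * P * m * (m / (m + 1))) with (w0 * (m / (m + 1)) * (P * m)) by ring.
    replace (P ^ 2) with (w1 * (P * m)) by (rewrite <- E1; ring).
    apply Rmult_le_compat_r; auto. nra.
  - rewrite <- E. replace (P ^ 2) with (w1 * (P * m)) by (rewrite <- E1; ring).
    replace (w0 * P * m) with (w0 * (P * m)) by ring.
    apply Rmult_le_compat_r; auto. nra.
Qed.

Lemma ln_step_bounds x : 0 < x -> / (x + 1) <= ln (x + 1) - ln x <= / x.
Proof.
  intros Hx.
  assert (Hx1 : 0 < / x) by now apply Rinv_0_lt_compat.
  split.
  - pose proof (exp_ineq1_le (ln (x / (x + 1)))) as Q.
    assert (0 < x / (x + 1)) by (apply Rdiv_lt_0_compat; lra).
    rewrite exp_ln in Q by auto. rewrite ln_div in Q by lra.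
    replace (x / (x + 1)) with (1 - / (x + 1)) in Q by (field; lra). lra.
  - pose proof (exp_ineq1_le (ln ((x + 1) / x))) as Q.
    assert (0 < (x + 1) / x) by (apply Rdiv_lt_0_compat; lra).
    rewrite exp_ln in Q by auto. rewrite ln_div in Q by lra.
    replace ((x + 1) / x) with (1 + / x) in Q by (field; lra). lra.
Qed.

Definition stirling_term (n : nat) : R :=
  ln (INR (fact n)) - ((INR n + 1 / 2) * ln (INR n + 1) - (INR n + 1)).

(** In the combination [2 s_n - s_{2n}] the factorials only occur through the
    central binomial coefficient. *)
Lemma stirling_duplication n :
  Rabs (2 * stirling_term n - stirling_term (2 * n) - ln (2 * PI) / 2) <= 2 / (INR n + 1).
Proof.
  destruct (central_binomial_bounds n) as (HP & L & U).
  set (P := 4 ^ n * INR (fact n) ^ 2 / INR (fact (2 * n))) in *.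
  set (m := INR (2 * n + 1)) in *.
  pose proof (INR_fact_lt_0 n) as F1. pose proof (INR_fact_lt_0 (2 * n)) as F2.
  pose proof PI_RGT_0 as HPI. pose proof (pos_INR n) as Hn.
  assert (Em : m = 2 * INR n + 1).
  { unfold m. rewrite plus_INR, mult_INR. simpl; ring. }
  assert (E2n : INR (2 * n) = 2 * INR n) by (rewrite mult_INR; simpl; ring).
  destruct (ln_step_bounds m ltac:(lra)) as [D1 D2].
  set (d := ln (m + 1) - ln m) in *.
  assert (LP : ln P = 2 * INR n * ln 2 + 2 * ln (INR (fact n)) - ln (INR (fact (2 * n)))).
  { unfold P. rewrite ln_div; auto.
    - rewrite ln_mult by (apply pow_lt; lra). rewrite !ln_pow by lra.
      replace 4 with (2 * 2) by ring. rewrite ln_mult by lra. simpl; ring.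
    - apply Rmult_lt_0_compat; apply pow_lt; lra. }
  assert (L2 : ln (INR n + 1) = ln (m + 1) - ln 2).
  { rewrite <- ln_div by lra. f_equal. rewrite Em. field. }
  assert (LPI : ln (2 * PI) = ln 2 + ln PI) by (apply ln_mult; lra).
  assert (LU : 2 * ln P <= ln PI - ln 2 + ln m).
  { replace (2 * ln P) with (ln (P ^ 2)) by (rewrite ln_pow by auto; simpl; ring).
    replace (ln PI - ln 2 + ln m) with (ln (PI / 2 * m))
      by (rewrite ln_mult, ln_div by lra; ring).
    apply ln_le; auto. apply pow_lt; auto. }
  assert (LL : ln PI - ln 2 + ln m - d <= 2 * ln P).
  { replace (2 * ln P) with (ln (P ^ 2)) by (rewrite ln_pow by auto; simpl; ring).
    replace (ln PI - ln 2 + ln m - d) with (ln (PI / 2 * m * (m / (m + 1)))).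
    - apply ln_le; auto. apply Rmult_lt_0_compat.
      + apply Rmult_lt_0_compat; lra.
      + apply Rdiv_lt_0_compat; lra.
    - unfold d. rewrite ln_mult, ln_mult, !ln_div; try lra.
      + apply Rmult_lt_0_compat; lra.
      + apply Rdiv_lt_0_compat; lra. }
  assert (Main : 2 * stirling_term n - stirling_term (2 * n) - ln (2 * PI) / 2 =
     (2 * ln P - (ln PI - ln 2 + ln m)) / 2 + (1 - m * d)).
  { unfold stirling_term. rewrite E2n. replace (2 * INR n + 1) with m by lra.
    rewrite L2, LPI, LP. unfold d. replace (INR n) with ((m - 1) / 2) by lra. field. }
  assert (B1 : m * d <= 1).
  { apply Rle_trans with (m * / m); [apply Rmult_le_compat_l; lra|right; field; lra]. }
  assert (B2 : 1 - m * d <= / (m + 1)).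
  { assert (m * / (m + 1) <= m * d) by (apply Rmult_le_compat_l; lra).
    replace (m * / (m + 1)) with (1 - / (m + 1)) in H by (field; lra). lra. }
  assert (B3 : / m <= / (INR n + 1) * 2).
  { apply Rle_trans with (/ ((INR n + 1) / 2)); [apply Rinv_le_contravar; lra|].
    right; field; lra. }
  assert (B4 : / (m + 1) <= / (INR n + 1)) by (apply Rinv_le_contravar; lra).
  rewrite Main. unfold Rdiv at 2. apply Rabs_le. lra.
Qed.

Lemma stirling_limit (l : R) : is_lim_seq stirling_term l -> l = ln (2 * PI) / 2.
Proof.
  intros H.
  assert (H2 : is_lim_seq (fun n => stirling_term (2 * n)) l).
  { apply (is_lim_seq_subseq stirling_term l (fun n => (2 * n)%nat)); auto.
    apply eventually_subseq. intros; lia. }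
  assert (H3 : is_lim_seq (fun n => 2 * stirling_term n - stirling_term (2 * n)) (2 * l - l)).
  { apply is_lim_seq_minus'; auto. apply (is_lim_seq_scal_l _ 2 l); auto. }
  assert (Hinv : is_lim_seq (fun n => 2 / (INR n + 1)) 0).
  { replace (Finite 0) with (Rbar_mult 2 0) by (simpl; f_equal; ring).
    apply is_lim_seq_scal_l.
    apply (is_lim_seq_ext (fun n => / INR (S n))); [intros; now rewrite S_INR|].
    apply (is_lim_seq_incr_1 (fun n => / INR n)).
    replace (Finite 0) with (Rbar_inv p_infty) by reflexivity.
    apply is_lim_seq_inv; [apply is_lim_seq_INR|easy]. }
  assert (H4 : is_lim_seq (fun n => 2 * stirling_term n - stirling_term (2 * n)) (ln (2 * PI) / 2)).
  { apply (is_lim_seq_le_le (fun n => ln (2 * PI) / 2 - 2 / (INR n + 1)) _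
      (fun n => ln (2 * PI) / 2 + 2 / (INR n + 1))).
    - intros n. pose proof (stirling_duplication n) as Q. apply Rabs_le_between in Q. lra.
    - replace (Finite (ln (2 * PI) / 2)) with (Finite (ln (2 * PI) / 2 - 0)) by (f_equal; ring).
      apply is_lim_seq_minus'; auto. apply is_lim_seq_const.
    - replace (Finite (ln (2 * PI) / 2)) with (Finite (ln (2 * PI) / 2 + 0)) by (f_equal; ring).
      apply is_lim_seq_plus'; auto. apply is_lim_seq_const. }
  apply is_lim_seq_unique in H3, H4. rewrite H3 in H4. injection H4. intros. lra.
Qed.

(** * Complex sequences *)

Definition Ctends (u : nat -> C) (l : C) : Prop := is_lim_seq (fun n => Cmod (u n - l)) 0.

Lemma Ctends_squeeze u l (e : nat -> R) N0 :
  (forall n, (N0 <= n)%nat -> Cmod (u n - l) <= e n) -> is_lim_seq e 0 -> Ctends u l.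
Proof.
  intros H He. apply (is_lim_seq_le_le_loc (fun _ => 0) _ e); auto.
  - exists N0. intros n Hn. split; [apply Cmod_ge_0|auto].
  - apply is_lim_seq_const.
Qed.

Lemma Ctends_Re u l : Ctends u l -> is_lim_seq (fun n => Re (u n)) (Re l).
Proof.
  intros H. apply is_lim_seq_spec. intros eps.
  apply is_lim_seq_spec in H. destruct (H eps) as [N HN]. exists N. intros n Hn.
  specialize (HN n Hn). rewrite Rminus_0_r, Rabs_right in HN by (apply Rle_ge, Cmod_ge_0).
  eapply Rle_lt_trans; [|exact HN].
  replace (Re (u n) - Re l) with (Re (u n - l)) by csimp_ring. apply re_le_Cmod.
Qed.

Lemma Ctends_Im u l : Ctends u l -> is_lim_seq (fun n => Im (u n)) (Im l).
Proof.
  intros H. apply is_lim_seq_spec. intros eps.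
  apply is_lim_seq_spec in H. destruct (H eps) as [N HN]. exists N. intros n Hn.
  specialize (HN n Hn). rewrite Rminus_0_r, Rabs_right in HN by (apply Rle_ge, Cmod_ge_0).
  eapply Rle_lt_trans; [|exact HN].
  replace (Im (u n) - Im l) with (Im (u n - l)) by csimp_ring. apply im_le_Cmod.
Qed.

Lemma Clim_seq_eq u l : Ctends u l -> Clim_seq u = l.
Proof.
  intros H. apply C_eq; unfold Clim_seq.
  - simpl Re. now rewrite (is_lim_seq_unique _ _ (Ctends_Re _ _ H)).
  - simpl Im. now rewrite (is_lim_seq_unique _ _ (Ctends_Im _ _ H)).
Qed.

Lemma Ctends_of_ReIm u l : is_lim_seq (fun n => Re (u n)) (Re l) ->
  is_lim_seq (fun n => Im (u n)) (Im l) -> Ctends u l.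
Proof.
  intros HR HI.
  apply (Ctends_squeeze u l (fun n => Rabs (Re (u n) - Re l) + Rabs (Im (u n) - Im l)) 0).
  - intros n _. eapply Rle_trans; [apply Cmod_le_ReIm|]. right.
    f_equal; f_equal; csimp_ring.
  - replace (Finite 0) with (Finite (Rabs (Re l - Re l) + Rabs (Im l - Im l)))
      by (f_equal; rewrite !Rminus_diag, Rabs_R0; ring).
    apply is_lim_seq_plus';
      apply (is_lim_seq_abs _ (Finite _)), is_lim_seq_minus'; auto; apply is_lim_seq_const.
Qed.

Lemma Cmod_limit_le u l x B N : Ctends u l ->
  (forall m, (N <= m)%nat -> Cmod (x - u m) <= B) -> Cmod (x - l) <= B.
Proof.
  intros H HB.
  assert (Q : Rbar_le (Cmod (x - l)) (B + 0)); [|simpl in Q; lra].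
  apply (is_lim_seq_le_loc (fun _ => Cmod (x - l)) (fun m => B + Cmod (u m - l))).
  - exists N. intros m Hm. specialize (HB m Hm).
    replace (x - l)%C with ((x - u m) + (u m - l))%C by ring.
    eapply Rle_trans; [apply Cmod_triangle|]. lra.
  - apply is_lim_seq_const.
  - apply is_lim_seq_plus'; [apply is_lim_seq_const|exact H].
Qed.

Lemma C_complete u (e : nat -> R) :
  (forall n m, (n <= m)%nat -> Cmod (u m - u n) <= e n) -> is_lim_seq e 0 ->
  exists l, Ctends u l /\ forall n, Cmod (u n - l) <= e n.
Proof.
  intros H He.
  assert (G : forall p : C -> R, (forall z w, Rabs (p z - p w) <= Cmod (z - w)) ->
    ex_finite_lim_seq (fun n => p (u n))).
  { intros p Hp. apply ex_lim_seq_cauchy_corr. intros eps.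
    apply is_lim_seq_spec in He. destruct (He (pos_div_2 eps)) as [N HN]. exists N.
    assert (HN' : e N < eps / 2).
    { specialize (HN N (le_n N)). simpl in HN. rewrite Rminus_0_r in HN.
      eapply Rle_lt_trans; [apply Rle_abs|exact HN]. }
    intros n m Hn Hm.
    replace (p (u n) - p (u m)) with ((p (u n) - p (u N)) - (p (u m) - p (u N))) by ring.
    eapply Rle_lt_trans; [apply Rabs_triang|]. rewrite Rabs_Ropp.
    pose proof (Hp (u n) (u N)). pose proof (Hp (u m) (u N)).
    pose proof (H N n Hn). pose proof (H N m Hm). lra. }
  destruct (G Re) as [a Ha].
  { intros z w. replace (Re z - Re w) with (Re (z - w)) by csimp_ring. apply re_le_Cmod. }
  destruct (G Im) as [b Hb].
  { intros z w. replace (Im z - Im w) with (Im (z - w)) by csimp_ring. apply im_le_Cmod. }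
  assert (L : Ctends u (a, b)) by (apply Ctends_of_ReIm; auto).
  exists (a, b). split; auto. intros n.
  apply (Cmod_limit_le u (a, b) (u n) (e n) n L).
  intros m Hm. rewrite Cmod_minus_sym. auto.
Qed.

Lemma Cexp_minus_1_bound h : Cmod (Cexp h - 1) <= exp (Cmod h) * Cmod h.
Proof.
  pose proof (exp_tail_bound 1 h) as Q. simpl in Q. rewrite Rmult_1_r in Q.
  replace (Cexp h - 1)%C with (Cexp h - RtoC (/ 1) * 1)%C by (rewrite Rinv_1; ring). exact Q.
Qed.

Lemma Ctends_exp u l : Ctends u l -> Ctends (fun n => Cexp (u n)) (Cexp l).
Proof.
  intros H.
  assert (E : is_lim_seq (fun n => Cmod (Cexp l) * (exp (Cmod (u n - l)) * Cmod (u n - l))) 0).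
  { replace (Finite 0) with (Rbar_mult (Cmod (Cexp l)) (Finite (exp 0 * 0)))
      by (simpl; f_equal; ring).
    apply is_lim_seq_scal_l, is_lim_seq_mult'; auto.
    apply (is_lim_seq_continuous exp (fun n => Cmod (u n - l)) 0); auto.
    apply derivable_continuous_pt, derivable_pt_exp. }
  refine (Ctends_squeeze _ _ _ 0%nat _ E). intros n _.
  replace (Cexp (u n) - Cexp l)%C with (Cexp l * (Cexp (u n - l) - 1))%C.
  - rewrite Cmod_mult. apply Rmult_le_compat_l; [apply Cmod_ge_0|apply Cexp_minus_1_bound].
  - rewrite Cexp_minus. field. apply Cexp_neq_0.
Qed.

Lemma is_lim_seq_inv_INR (a : R) : is_lim_seq (fun n => / (a + INR n)) 0.
Proof.
  replace (Finite 0) with (Rbar_inv p_infty) by reflexivity.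
  apply is_lim_seq_inv; [|easy].
  apply (is_lim_seq_plus _ _ a p_infty); [apply is_lim_seq_const|apply is_lim_seq_INR|easy].
Qed.

Lemma is_lim_seq_scal_0 (k : R) u : is_lim_seq u 0 -> is_lim_seq (fun n => k * u n) 0.
Proof.
  intros H. replace (Finite 0) with (Rbar_mult k 0) by (simpl; f_equal; ring).
  now apply is_lim_seq_scal_l.
Qed.

(** * The logarithm on the slit plane *)

Lemma slit_plane_iff w : slit_plane w <-> 0 < Re w \/ Im w <> 0.
Proof.
  split.
  - intros H. destruct (Req_dec (Im w) 0) as [E|]; auto. left.
    apply Rnot_le_lt. intros L. apply H. exists (Re w). split; auto. apply C_eq; auto.
  - intros H (t & Ht & E). rewrite E in H. simpl in H. lra.
Qed.

Lemma slit_plane_pos w : 0 < Re w -> slit_plane w.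
Proof. intros; apply slit_plane_iff; auto. Qed.

Lemma slit_plane_plus w t : 0 <= t -> slit_plane w -> slit_plane (w + RtoC t).
Proof.
  rewrite !slit_plane_iff. intros Ht.
  replace (Re (w + t)) with (Re w + t) by csimp_ring.
  replace (Im (w + t)) with (Im w) by csimp_ring. intros []; auto. left; lra.
Qed.

Lemma slit_plane_neq_0 w : slit_plane w -> w <> 0.
Proof. rewrite slit_plane_iff. intros H E. rewrite E in H. simpl in H. lra. Qed.

Lemma slit_plane_locally w z0 d s0 : slit_plane w -> w = (z0 + RtoC s0 * d)%C ->
  locally s0 (fun s => slit_plane (z0 + RtoC s * d)%C).
Proof.
  intros H ->. destruct (Ccont_of_Cderive _ _ _ (Cderive_line z0 d s0)) as [HR HI].
  apply continuity_pt_filterlim in HR, HI.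
  apply slit_plane_iff in H. destruct H as [H|H].
  - eapply filter_imp; [|apply (HR (fun x => 0 < x)); now apply open_gt].
    intros s Hs. apply slit_plane_iff. auto.
  - eapply filter_imp; [|apply (HI (fun x => x <> 0)); now apply open_neq].
    intros s Hs. apply slit_plane_iff. auto.
Qed.

Section Slit.

Variable Log : C -> C.
Hypothesis HLog : is_log_slit Log.

Lemma Log_exp w : slit_plane w -> Cexp (Log w) = w.
Proof. intros H. apply HLog, H. Qed.

Lemma Log_derive w : slit_plane w -> holo Log w (/ w)%C.
Proof.
  intros Hw. destruct (analytic_holo Log w) as (l & Hl); [now apply HLog|].
  pose proof (slit_plane_neq_0 w Hw) as N.
  replace (/ w)%C with l; auto.
  assert (E : w = (w + RtoC 0 * 1)%C) by ring.
  assert (D1 : Cderive (fun s => Cexp (Log (w + RtoC s * 1)%C)) 0 1).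
  { apply (Cderive_ext_loc (fun s => (w + RtoC s * 1)%C)); [|apply Cderive_line].
    eapply filter_imp; [|apply (slit_plane_locally w w 1 0 Hw E)].
    intros s Hs. symmetry. now apply Log_exp. }
  pose proof (Cderive_exp _ _ _ (Hl w 1 0 E)) as D2. simpl in D2.
  rewrite <- E, Log_exp in D2 by auto.
  pose proof (Cderive_unique _ _ _ _ D1 D2) as Q.
  replace l with ((1 * l * w) / w)%C by (field; auto). rewrite <- Q. field; auto.
Qed.

Lemma Log_real t : 0 < t -> Log (RtoC t) = RtoC (ln t).
Proof.
  intros Ht. pose proof (proj2 HLog t Ht) as HI.
  assert (E : Cexp (Log (RtoC t)) = RtoC t).
  { apply Log_exp, slit_plane_pos. auto. }
  apply C_eq; auto. simpl.
  apply (f_equal Cmod) in E. rewrite Cmod_Cexp, Cmod_R, Rabs_right in E by lra.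
  apply (f_equal ln) in E. now rewrite ln_exp in E.
Qed.

Lemma Log_Ccont_line z0 d s : slit_plane (z0 + RtoC s * d)%C -> Ccont (fun s => Log (z0 + RtoC s * d)%C) s.
Proof. intros H. apply analytic_line_Ccont. now apply HLog. Qed.

(** Stirling's main terms. An exact [log Gamma] would satisfy
    [f (w + 1) - f w = Log w]; the defect measures the failure of this equation. *)
Definition stir (w : C) : C := ((w - 1 / 2) * Log w - w)%C.
Definition stir_defect (w : C) : C := (stir (w + 1) - stir w - Log w)%C.
Fixpoint stir_sum (n : nat) (w : C) : C :=
  match n with
  | O => 0
  | S m => (stir_sum m w + stir_defect (w + RtoC (INR m)))%C
  end.

Variable c : nat -> R.
Hypothesis Hc : bernoulli_coefs c.
Let K := bpoly_bound c 2.

Lemma stir_const_pos : 0 <= K.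
Proof.
  unfold K, bpoly_bound. rewrite !sum_Sn, sum_O. unfold plus; simpl.
  pose proof (Rabs_pos (c 0%nat)). pose proof (Rabs_pos (c 1%nat)).
  pose proof (Rabs_pos (c 2%nat)). lra.
Qed.

(** The defect is, up to sign, an Euler-Maclaurin step for [Log] with [N = 0]. *)
Lemma stir_defect_bound w : 0 < Re w -> Cmod (stir_defect w) <= K * (/ Re w - / (Re w + 1)).
Proof.
  intros Hw.
  assert (Sl : forall s, 0 <= s -> slit_plane (w + RtoC s * 1)%C).
  { intros s Hs. rewrite Cmult_1_r. apply slit_plane_plus; auto. now apply slit_plane_pos. }
  assert (Nz : forall s, 0 <= s -> (w + RtoC s * 1)%C <> 0).
  { intros s Hs. now apply slit_plane_neq_0, Sl. }
  assert (DL : forall s, 0 <= s -> Cderive (fun s => Log (w + RtoC s * 1)%C) s (/ (w + RtoC s * 1))%C).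
  { intros s Hs. eapply Cderive_eq; [apply holo_line, Log_derive; auto|]. ring. }
  set (f := fun j s => match j with
    | O => Log (w + RtoC s * 1)%C
    | 1%nat => (/ (w + RtoC s * 1))%C
    | _ => (- (1) / ((w + RtoC s * 1) * (w + RtoC s * 1)))%C end).
  set (F := fun s => ((w + RtoC s * 1) * Log (w + RtoC s * 1) - (w + RtoC s * 1))%C).
  assert (DF : forall s, 0 <= s -> Cderive F s (f 0%nat s)).
  { intros s Hs. unfold F, f. eapply Cderive_eq.
    - apply Cderive_minus; [|apply Cderive_line].
      apply (Cderive_mult (fun s => (w + RtoC s * 1)%C)); [apply Cderive_line|apply DL; auto].
    - simpl. field. rewrite <- (Cmult_1_r (RtoC s)). auto. }
  assert (Df : forall j s, (j < 2)%nat -> 0 <= s -> Cderive (f j) s (f (S j) s)).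
  { intros [|[|j]] s Hj Hs; [apply DL; auto| |lia].
    apply (Cderive_inv (fun s => (w + RtoC s * 1)%C)); [apply Cderive_line|auto]. }
  pose proof (euler_maclaurin_step c 0 f F (fun s => - / (Re w + s)) (fun s => / (Re w + s) ^ 2) Hc) as Q.
  rewrite sum_n_m_zero in Q by lia.
  assert (E : stir_defect w = (- ((f 0%nat 0 + f 0%nat 1) / 2 - zero - (F 1 - F 0)))%C).
  { unfold stir_defect, stir, f, F, zero; simpl.
    replace (w + 0 * 1)%C with w by ring. replace (w + 1 * 1)%C with (w + 1)%C by ring.
    set (L0 := Log w). set (L1 := Log (w + 1)).
    apply C_eq; unfold Cinv; csimp; field. }
  rewrite E, Cmod_opp.
  replace (/ Re w - / (Re w + 1)) with (- / (Re w + 1) - - / (Re w + 0))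
    by (rewrite Rplus_0_r; ring).
  apply Q.
  - intros s Hs. eapply Ccont_of_Cderive, DF; lra.
  - intros j s Hj Hs. eapply Ccont_of_Cderive, Df; [exact Hj|lra].
  - intros s Hs. apply derivable_continuous_pt.
    exists (/ (Re w + s) ^ 2). apply is_derive_Reals. auto_derive; [lra|]. field. lra.
  - intros s Hs. apply DF; lra.
  - intros j s Hj Hs. apply Df; [exact Hj|lra].
  - intros s Hs. auto_derive; [lra|]. field. lra.
  - intros s Hs. simpl f.
    assert (P : Re w + s <= Cmod (w + RtoC s * 1)).
    { eapply Rle_trans; [|apply Re_le_Cmod]. right. csimp_ring. }
    rewrite Cmod_div, Cmod_opp, Cmod_1, Cmod_mult.
    + unfold Rdiv. rewrite Rmult_1_l. apply Rinv_le_contravar; [nra|]. simpl. nra.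
    + apply Cmult_neq_0; apply Nz; lra.
Qed.

Lemma stir_sum_bound w n m : 0 < Re w + INR n -> (n <= m)%nat ->
  Cmod (stir_sum m w - stir_sum n w) <= K * (/ (Re w + INR n) - / (Re w + INR m)).
Proof.
  intros Hw H. induction H as [|m H IH].
  - replace (stir_sum n w - stir_sum n w)%C with (RtoC 0) by ring. rewrite Cmod_0. lra.
  - simpl stir_sum.
    replace (stir_sum m w + stir_defect (w + RtoC (INR m)) - stir_sum n w)%C with
      ((stir_sum m w - stir_sum n w) + stir_defect (w + RtoC (INR m)))%C by ring.
    eapply Rle_trans; [apply Cmod_triangle|].
    assert (P : 0 < Re (w + RtoC (INR m))).
    { replace (Re _) with (Re w + INR m) by csimp_ring. apply le_INR in H. lra. }
    pose proof (stir_defect_bound _ P) as Q.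
    replace (Re (w + RtoC (INR m))) with (Re w + INR m) in Q by csimp_ring.
    rewrite S_INR, <- Rplus_assoc. lra.
Qed.

Lemma stir_sum_limit w : exists D, Ctends (fun n => stir_sum n w) D /\
  forall n, 0 < Re w + INR n -> Cmod (stir_sum n w - D) <= K / (Re w + INR n).
Proof.
  destruct (nfloor_ex (Rabs (Re w) + 1)) as [N0 HN0]; [pose proof (Rabs_pos (Re w)); lra|].
  assert (P : forall n, (S N0 <= n)%nat -> 0 < Re w + INR n).
  { intros n Hn. apply le_INR in Hn. rewrite S_INR in Hn.
    pose proof (Rle_abs (- Re w)) as Q. rewrite Rabs_Ropp in Q. lra. }
  assert (B : forall n m, 0 < Re w + INR n -> (n <= m)%nat ->
    Cmod (stir_sum m w - stir_sum n w) <= K / (Re w + INR n)).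
  { intros n m Hn Hm. eapply Rle_trans; [apply stir_sum_bound; auto|].
    assert (0 < Re w + INR m) by (apply le_INR in Hm; lra).
    pose proof stir_const_pos. assert (0 < / (Re w + INR m)) by now apply Rinv_0_lt_compat.
    unfold Rdiv. apply Rmult_le_compat_l; lra. }
  destruct (C_complete (fun n => stir_sum (n + S N0) w) (fun n => K * / (Re w + INR (n + S N0)))) as (D & HD1 & HD2).
  - intros n m Hnm. apply B; [apply P; lia|lia].
  - apply (is_lim_seq_incr_n (fun n => K * / (Re w + INR n)) (S N0)).
    apply is_lim_seq_scal_0, is_lim_seq_inv_INR.
  - exists D.
    assert (HD : Ctends (fun n => stir_sum n w) D).
    { unfold Ctends in *. now apply (is_lim_seq_incr_n (fun n => Cmod (stir_sum n w - D)) (S N0)). }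
    split; auto. intros n Hn.
    apply (Cmod_limit_le (fun n => stir_sum n w) D _ _ n HD).
    intros m Hm. rewrite Cmod_minus_sym. auto.
Qed.

End Slit.

(** * The Gamma function *)

Section Gamma.

Variable Log : C -> C.
Hypothesis HLog : is_log_slit Log.
Variable c : nat -> R.
Hypothesis Hc : bernoulli_coefs c.
Let K := bpoly_bound c 2.

Lemma stir_sum_succ n w :
  stir_sum Log (S n) w = (stir_defect Log w + stir_sum Log n (w + 1))%C.
Proof.
  induction n as [|n IH].
  - simpl. rewrite Cplus_0_r. ring.
  - change (stir_sum Log (S (S n)) w) with
      (stir_sum Log (S n) w + stir_defect Log (w + RtoC (INR (S n))))%C.
    rewrite IH. simpl stir_sum. rewrite S_INR, RtoC_plus.
    replace (w + (INR n + 1))%C with (w + 1 + INR n)%C by ring. ring.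
Qed.

Lemma Cprod_stir w n : slit_plane w ->
  Cprod (fun k => w + RtoC (INR k))%C n =
  Cexp (stir Log (w + RtoC (INR n)) - stir Log w - stir_sum Log n w)%C.
Proof.
  intros Hw. induction n as [|n IH].
  - simpl. rewrite Cplus_0_r, <- Cexp_0. f_equal. ring.
  - simpl Cprod. rewrite IH.
    assert (Hn : slit_plane (w + RtoC (INR n))) by (apply slit_plane_plus; auto; apply pos_INR).
    transitivity (Cexp (stir Log (w + RtoC (INR n)) - stir Log w - stir_sum Log n w) *
      Cexp (Log (w + RtoC (INR n))))%C; [now rewrite (Log_exp Log HLog _ Hn)|].
    rewrite <- Cexp_plus. f_equal.
    simpl stir_sum. unfold stir_defect. rewrite S_INR, RtoC_plus.
    replace (w + (INR n + 1))%C with (w + INR n + 1)%C by ring. ring.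
Qed.

Lemma stir_real t : 0 < t -> stir Log (RtoC t) = RtoC ((t - 1 / 2) * ln t - t).
Proof.
  intros Ht. unfold stir. rewrite (Log_real Log HLog) by auto.
  rewrite RtoC_minus, RtoC_mult, RtoC_minus, RtoC_div by lra. reflexivity.
Qed.

Lemma stir_1 : stir Log 1 = (- (1))%C.
Proof.
  rewrite stir_real by lra. rewrite ln_1, <- RtoC_opp. f_equal. ring.
Qed.

Lemma ln_fact_stir n : RtoC (ln (INR (fact n))) =
  (stir Log (1 + RtoC (INR n)) - stir Log 1 - stir_sum Log n 1)%C.
Proof.
  induction n as [|n IH].
  - simpl. rewrite ln_1, Cplus_0_r. ring.
  - assert (P : 0 < INR n + 1) by (pose proof (pos_INR n); lra).
    rewrite fact_simpl, mult_INR, ln_mult by (try apply INR_fact_lt_0; apply lt_0_INR; lia).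
    rewrite RtoC_plus, IH, S_INR. simpl stir_sum. unfold stir_defect.
    replace (RtoC (ln (INR n + 1))) with (Log (1 + INR n)%C).
    + rewrite RtoC_plus. replace (1 + (INR n + 1))%C with (1 + INR n + 1)%C by ring. ring.
    + rewrite <- RtoC_plus, Rplus_comm. now apply Log_real.
Qed.

Lemma stirling_term_stir n : RtoC (stirling_term n) = (1 - stir_sum Log n 1)%C.
Proof.
  unfold stirling_term. rewrite RtoC_minus, ln_fact_stir, stir_1.
  assert (P : 0 < 1 + INR n) by (pose proof (pos_INR n); lra).
  rewrite <- RtoC_plus, stir_real by auto.
  replace ((1 + INR n - 1 / 2) * ln (1 + INR n) - (1 + INR n)) with
    ((INR n + 1 / 2) * ln (INR n + 1) - (INR n + 1)).
  - ring.
  - replace (1 + INR n) with (INR n + 1) by ring. field.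
Qed.

Lemma stirling_term_limit : Ctends (fun n => RtoC (stirling_term n)) (RtoC (ln (2 * PI) / 2)).
Proof.
  destruct (stir_sum_limit Log HLog c Hc 1) as (D & HD & _).
  assert (E : Ctends (fun n => RtoC (stirling_term n)) (1 - D)%C).
  { apply (is_lim_seq_ext (fun n => Cmod (stir_sum Log n 1 - D))); auto.
    intros n. rewrite stirling_term_stir, Cmod_minus_sym. f_equal. ring. }
  pose proof (stirling_limit _ (Ctends_Re _ _ E)) as ER.
  pose proof (is_lim_seq_unique _ _ (Ctends_Im _ _ E)) as EI. simpl Im at 1 in EI.
  rewrite Lim_seq_const in EI. injection EI as EI.
  replace (RtoC (ln (2 * PI) / 2)) with (1 - D)%C; auto. apply C_eq; auto.
Qed.

(** Second-order expansion of the logarithm at infinity, by integrating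
    [w/(N+tw) - w/N] over [0 <= t <= 1]. *)
Lemma Log_shift_bound w N : 2 * Cmod w + 1 <= N ->
  Cmod (Log (w + RtoC N) - Log (RtoC N) - w / RtoC N) <= 2 * Cmod w ^ 2 / N ^ 2.
Proof.
  intros HN. pose proof (Cmod_ge_0 w) as W0.
  assert (NN : RtoC N <> 0) by (apply RtoC_neq; lra).
  assert (P : forall t, 0 <= t <= 1 -> N / 2 <= Re (RtoC N + RtoC t * w)%C).
  { intros t Ht. replace (Re _) with (N + t * Re w) by csimp_ring.
    pose proof (re_le_Cmod w) as Q. apply Rabs_le_between in Q. nra. }
  assert (S : forall t, 0 <= t <= 1 -> slit_plane (RtoC N + RtoC t * w)%C).
  { intros t Ht. apply slit_plane_pos. pose proof (P t Ht). lra. }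
  assert (D : forall t, 0 <= t <= 1 -> Cderive (fun t => Log (RtoC N + RtoC t * w)%C - (0 + RtoC t * (w / RtoC N)))%C t
    (w * / (RtoC N + RtoC t * w) - w / RtoC N)%C).
  { intros t Ht. apply Cderive_minus; [|apply Cderive_line].
    apply holo_line, Log_derive; auto. }
  set (M := 2 * Cmod w ^ 2 / N ^ 2).
  pose proof (mean_value_ineq
    (fun t => Log (RtoC N + RtoC t * w)%C - (0 + RtoC t * (w / RtoC N)))%C
    (fun t => w * / (RtoC N + RtoC t * w) - w / RtoC N)%C
    (fun t => M * t) (fun _ => M) 0 1) as Q.
  cbv beta in Q.
  replace (M * 1 - M * 0) with M in Q by ring.
  replace (Log (w + N) - Log N - w / N)%C with
    (Log (N + 1 * w) - (0 + 1 * (w / N)) - (Log (N + 0 * w) - (0 + 0 * (w / N))))%C.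
  - apply Q; [lra|..].
    + intros t Ht. eapply Ccont_of_Cderive, D; auto.
    + intros t _. apply derivable_continuous_pt. reg.
    + intros t Ht. apply D; lra.
    + intros t _. auto_derive; auto. ring.
    + intros t Ht. pose proof (P t ltac:(lra)) as Pt.
      assert (Nt : (RtoC N + RtoC t * w)%C <> 0) by (apply slit_plane_neq_0, S; lra).
      assert (Nt' : (RtoC N + w * RtoC t)%C <> 0)
        by (replace (RtoC N + w * RtoC t)%C with (RtoC N + RtoC t * w)%C by ring; auto).
      replace (w * / (N + t * w) - w / N)%C with (- RtoC t * (w * w) * / (N * (N + t * w)))%C
        by (field; auto).
      rewrite !Cmod_mult, Cmod_inv, !Cmod_mult, Cmod_opp, !Cmod_R by (apply Cmult_neq_0; auto).
      rewrite (Rabs_right t), (Rabs_right N) by lra.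
      assert (MN : N / 2 <= Cmod (N + t * w)) by (eapply Rle_trans; [exact Pt|apply Re_le_Cmod]).
      assert (I : / (N * Cmod (N + t * w)) <= 2 / N ^ 2).
      { replace (2 / N ^ 2) with (/ (N * (N / 2))) by (field; lra).
        apply Rinv_le_contravar; nra. }
      replace M with (1 * (Cmod w * Cmod w) * (2 / N ^ 2)) by (unfold M; field; lra).
      assert (0 < N * Cmod (N + t * w)) by nra.
      apply Rmult_le_compat; auto.
      * apply Rmult_le_pos; [lra|nra].
      * left. now apply Rinv_0_lt_compat.
      * apply Rmult_le_compat_r; [nra|lra].
  - replace (N + 1 * w)%C with (w + N)%C by ring.
    replace (N + 0 * w)%C with (RtoC N) by ring. ring.
Qed.

(** What is left of Gauss's quotient once the products are written through [stir]. *)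
Lemma stir_shift_limit w :
  Ctends (fun n => stir Log (1 + RtoC (INR n)) + w * RtoC (ln (INR n)) -
                stir Log (w + RtoC (INR (S n))))%C 0.
Proof.
  set (W := Cmod w). pose proof (Cmod_ge_0 w) as W0. fold W in W0.
  destruct (nfloor_ex (2 * W + 1)) as [N0 HN0]; [lra|].
  set (B := W + (W + 1 / 2) * W + (W + 3 / 2) * (2 * W ^ 2)).
  apply (Ctends_squeeze _ _ (fun n => B * / (0 + INR n)) (S N0)).
  - intros n Hn. apply le_INR in Hn. rewrite S_INR in Hn.
    assert (Pn : 0 < INR n) by lra. rewrite Rplus_0_l.
    rewrite S_INR. set (N := INR n + 1).
    pose proof (Log_shift_bound w N) as Q. fold W in Q. specialize (Q ltac:(unfold N; lra)).
    set (E := (Log (w + RtoC N) - Log (RtoC N) - w / RtoC N)%C) in *.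
    assert (NN : RtoC N <> 0) by (apply RtoC_neq; unfold N; lra).
    replace (1 + RtoC (INR n))%C with (RtoC N) by (unfold N; rewrite RtoC_plus; ring).
    assert (LN : Log (RtoC N) = RtoC (ln N)) by (apply Log_real; auto; unfold N; lra).
    replace (_ - _)%C with
      (w * (RtoC (ln (INR n)) - RtoC (ln N)) - (w - 1 / 2) * w / RtoC N - (w + RtoC N - 1 / 2) * E)%C.
    2: { unfold stir, E. rewrite LN. field. auto. }
    rewrite <- RtoC_minus.
    destruct (ln_step_bounds (INR n) Pn) as [S1 S2]. fold N in S1, S2.
    assert (IN : / N <= / INR n) by (apply Rinv_le_contravar; unfold N; lra).
    assert (I0 : 0 < / N) by (apply Rinv_0_lt_compat; unfold N; lra).
    assert (H2 : Cmod (1 / 2) = 1 / 2).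
    { rewrite <- RtoC_div, Cmod_R, Rabs_right; lra. }
    assert (T1 : Cmod (w * RtoC (ln (INR n) - ln N)) <= W * / INR n).
    { rewrite Cmod_mult, Cmod_R. apply Rmult_le_compat_l; auto.
      rewrite Rabs_left1; lra. }
    assert (T2 : Cmod ((w - 1 / 2) * w / RtoC N) <= (W + 1 / 2) * W * / INR n).
    { rewrite Cmod_div, Cmod_mult, Cmod_R, Rabs_right by (auto; unfold N; lra).
      unfold Rdiv. apply Rmult_le_compat; auto; try lra.
      - apply Rmult_le_pos; apply Cmod_ge_0.
      - apply Rmult_le_compat_r; auto. unfold Cminus.
        eapply Rle_trans; [apply Cmod_triangle|]. rewrite Cmod_opp, H2. fold W. lra. }
    assert (T3 : Cmod ((w + RtoC N - 1 / 2) * E) <= (W + 3 / 2) * (2 * W ^ 2) * / INR n).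
    { rewrite Cmod_mult.
      assert (A : Cmod (w + RtoC N - 1 / 2) <= (W + 3 / 2) * N).
      { unfold Cminus. eapply Rle_trans; [apply Cmod_triangle|].
        eapply Rle_trans; [apply Rplus_le_compat_r, Cmod_triangle|].
        rewrite Cmod_opp, H2, Cmod_R, Rabs_right by (unfold N; lra). fold W.
        assert (1 <= N) by (unfold N; lra). nra. }
      apply Rle_trans with ((W + 3 / 2) * N * (2 * W ^ 2 / N ^ 2)).
      - apply Rmult_le_compat; auto; apply Cmod_ge_0.
      - replace ((W + 3 / 2) * N * (2 * W ^ 2 / N ^ 2)) with
          ((W + 3 / 2) * (2 * W ^ 2) * / N) by (field; unfold N; lra).
        apply Rmult_le_compat_l; auto. apply Rmult_le_pos; [lra|nra]. }
    unfold B.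
    unfold Cminus at 1 2. eapply Rle_trans; [apply Cmod_triangle|].
    eapply Rle_trans; [apply Rplus_le_compat_r, Cmod_triangle|]. rewrite !Cmod_opp. lra.
  - apply is_lim_seq_scal_0, is_lim_seq_inv_INR.
Qed.

Lemma Ctends_plus u v a b : Ctends u a -> Ctends v b -> Ctends (fun n => u n + v n)%C (a + b)%C.
Proof.
  intros Hu Hv. apply (Ctends_squeeze _ _ (fun n => Cmod (u n - a) + Cmod (v n - b)) 0).
  - intros n _. replace (u n + v n - (a + b))%C with ((u n - a) + (v n - b))%C by ring.
    apply Cmod_triangle.
  - replace (Finite 0) with (Finite (0 + 0)) by (f_equal; ring). now apply is_lim_seq_plus'.
Qed.

Lemma Ctends_const a : Ctends (fun _ => a) a.
Proof.
  unfold Ctends. replace (a - a)%C with (RtoC 0) by ring. rewrite Cmod_0. apply is_lim_seq_const.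
Qed.

Lemma Ctends_ext u v l : (forall n, u n = v n) -> Ctends u l -> Ctends v l.
Proof. intros E. apply is_lim_seq_ext. intros n. now rewrite E. Qed.

Lemma Ctends_incr_1 u l : Ctends u l -> Ctends (fun n => u (S n)) l.
Proof. intros H. exact (proj1 (is_lim_seq_incr_1 (fun n => Cmod (u n - l)) 0) H). Qed.

(** Gauss's formula: the factorial and the product are both expressed by [stir] and
    sums of defects, and the constant of the factorial is Stirling's. *)
Lemma CGamma_stir w D : slit_plane w -> Ctends (fun n => stir_sum Log n w) D ->
  CGamma w = Cexp (RtoC (ln (2 * PI) / 2) + stir Log w + D).
Proof.
  intros Hw HD. apply Clim_seq_eq.
  set (T := fun n => (RtoC (stirling_term n) + ((stir Log (1 + RtoC (INR n)) + w * RtoC (ln (INR n)) -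
                stir Log (w + RtoC (INR (S n)))) + stir Log w + stir_sum Log (S n) w))%C).
  assert (HT : Ctends T (RtoC (ln (2 * PI) / 2) + (0 + stir Log w + D))%C).
  { unfold T. apply Ctends_plus; [apply stirling_term_limit|].
    apply Ctends_plus; [apply Ctends_plus; [apply stir_shift_limit|apply Ctends_const]|].
    now apply (Ctends_incr_1 (fun n => stir_sum Log n w)). }
  replace (RtoC (ln (2 * PI) / 2) + stir Log w + D)%C with
    (RtoC (ln (2 * PI) / 2) + (0 + stir Log w + D))%C by ring.
  apply (Ctends_ext (fun n => Cexp (T (S n)))).
  - intros n. cbv zeta. rewrite Cprod_stir by auto.
    rewrite <- (exp_ln (INR (fact (S n)))) by apply INR_fact_lt_0.
    rewrite <- Cexp_RtoC, <- Cexp_plus. unfold Cdiv. rewrite <- Cexp_opp, <- Cexp_plus.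
    f_equal. unfold T. rewrite stirling_term_stir, ln_fact_stir, stir_1. ring.
  - apply Ctends_exp. now apply Ctends_incr_1.
Qed.

Variable LogGamma : C -> C.
Hypothesis HLG : is_log_Gamma_slit LogGamma.

Definition stir_rem (w : C) : C := (LogGamma w - stir Log w - RtoC (ln (2 * PI) / 2))%C.

Lemma stir_rem_mod_2piI w D : slit_plane w -> Ctends (fun n => stir_sum Log n w) D ->
  Re (stir_rem w - D) = 0 /\ exists k : Z, Im (stir_rem w - D) = 2 * PI * IZR k.
Proof.
  intros Hw HD. apply Cexp_eq_1. unfold stir_rem.
  replace (LogGamma w - stir Log w - (ln (2 * PI) / 2)%R - D)%C with
    (LogGamma w - (RtoC (ln (2 * PI) / 2) + stir Log w + D))%C by ring.
  rewrite Cexp_minus, <- CGamma_stir by auto.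
  rewrite (proj2 (proj1 HLG) w Hw). unfold Cdiv. apply Cinv_r.
  rewrite (CGamma_stir w D) by auto. apply Cexp_neq_0.
Qed.

Lemma stir_sum_Ccont z0 d n s : slit_plane (z0 + RtoC s * d)%C ->
  Ccont (fun s => stir_sum Log n (z0 + RtoC s * d)%C) s.
Proof.
  intros Hs.
  assert (L : forall t, 0 <= t -> Ccont (fun s => Log (z0 + RtoC s * d + RtoC t)%C) s).
  { intros t Ht. apply (Ccont_ext (fun s => Log (z0 + RtoC t + RtoC s * d)%C)).
    - intros x. f_equal. ring.
    - apply Log_Ccont_line; auto. replace (z0 + t + s * d)%C with (z0 + s * d + t)%C by ring.
      now apply slit_plane_plus. }
  assert (Li : forall t, Ccont (fun s => (z0 + RtoC s * d + RtoC t)%C) s).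
  { intros t. apply Ccont_plus; [eapply Ccont_of_Cderive, Cderive_line|apply Ccont_const]. }
  assert (St : forall t, 0 <= t -> Ccont (fun s => stir Log (z0 + RtoC s * d + RtoC t)%C) s).
  { intros t Ht. unfold stir. apply Ccont_minus; auto.
    apply (Ccont_mult (fun s => (z0 + RtoC s * d + RtoC t - 1/2)%C)); auto.
    apply Ccont_minus; auto. apply Ccont_const. }
  induction n as [|n IH]; [apply (Ccont_const 0)|]. simpl stir_sum.
  apply Ccont_plus; auto. unfold stir_defect. pose proof (pos_INR n).
  apply Ccont_minus; [apply Ccont_minus|]; auto.
  apply (Ccont_ext (fun s => stir Log (z0 + RtoC s * d + RtoC (INR n + 1))%C)).
  - intros x. f_equal. rewrite RtoC_plus. ring.
  - apply St. lra.
Qed.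

Lemma stir_sum_1_real n : Im (stir_sum Log n 1) = 0.
Proof.
  pose proof (f_equal Im (stirling_term_stir n)) as E.
  replace (Im (1 - stir_sum Log n 1)) with (- Im (stir_sum Log n 1)) in E by csimp_ring.
  simpl in E. lra.
Qed.

(** The branch of [log Gamma] is identified along the segment from [1]: there
    [Im (stir_rem - stir_sum n)] is continuous, vanishes at [1], and is always
    within [1] of a multiple of [2 pi]. *)
Lemma stir_rem_limit w : slit_plane w -> Ctends (fun n => stir_sum Log n w) (stir_rem w).
Proof.
  intros Hw. pose proof PI_RGT_0. pose proof (stir_const_pos c) as K0. fold K in K0.
  assert (P3 : 3 < 2 * PI) by (pose proof PI2_3_2; unfold PI2 in *; lra).
  set (d := (w - 1)%C).
  assert (Sl : forall s, 0 <= s <= 1 -> slit_plane (1 + RtoC s * d)%C).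
  { intros s Hs. apply slit_plane_iff. apply slit_plane_iff in Hw. unfold d.
    replace (Re _) with (1 - s + s * Re w) by csimp_ring.
    replace (Im _) with (s * Im w) by csimp_ring.
    destruct Hw as [H1|H1].
    - left. destruct (Req_dec s 0); [subst; lra|]. nra.
    - destruct (Req_dec s 0) as [->|N]; [left; lra|]. right. now apply Rmult_integral_contrapositive. }
  (* One index [m] that brings the partial sums within [1] of their limits at all
     points of the segment. *)
  destruct (nfloor_ex (Rabs (Re w) + K + 1)) as [n Hn]; [pose proof (Rabs_pos (Re w)); lra|].
  set (m := S n).
  assert (Hm : Rabs (Re w) + K + 1 < INR m) by (unfold m; rewrite S_INR; lra).
  assert (Hk : forall s D, 0 <= s <= 1 -> Ctends (fun n => stir_sum Log n (1 + RtoC s * d)%C) D ->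
    Cmod (stir_sum Log m (1 + RtoC s * d)%C - D) < 1).
  { intros s D Hs HD. destruct (stir_sum_limit Log HLog c Hc (1 + RtoC s * d)%C) as (D' & HD' & HB).
    replace D with D' by (rewrite <- (Clim_seq_eq _ _ HD), <- (Clim_seq_eq _ _ HD'); auto).
    assert (R : Re (1 + RtoC s * d)%C = 1 - s + s * Re w) by (unfold d; csimp_ring).
    assert (R' : - Rabs (Re w) <= Re (1 + RtoC s * d)%C).
    { rewrite R. pose proof (Rle_abs (- Re w)) as Q. rewrite Rabs_Ropp in Q.
      pose proof (Rabs_pos (Re w)). nra. }
    eapply Rle_lt_trans; [apply HB; lra|].
    apply (Rmult_lt_reg_r (Re (1 + RtoC s * d)%C + INR m)); [lra|].
    unfold Rdiv. rewrite Rmult_assoc, Rinv_l by lra. fold K. lra. }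
  set (v := fun s => Im (stir_rem (1 + RtoC s * d)%C - stir_sum Log m (1 + RtoC s * d)%C)).
  assert (V : forall s, 0 <= s <= 1 -> exists (k : Z) D,
    Ctends (fun n => stir_sum Log n (1 + RtoC s * d)%C) D /\
    Im (stir_rem (1 + RtoC s * d)%C - D) = 2 * PI * IZR k /\
    Re (stir_rem (1 + RtoC s * d)%C - D) = 0 /\
    Rabs (v s - 2 * PI * IZR k) < 1).
  { intros s Hs. destruct (stir_sum_limit Log HLog c Hc (1 + RtoC s * d)%C) as (D & HD & _).
    destruct (stir_rem_mod_2piI _ D (Sl s Hs) HD) as [E1 [k E2]].
    exists k, D. repeat split; auto.
    rewrite <- E2. unfold v.
    replace (Im _ - Im _) with (- Im (stir_sum Log m (1 + s * d) - D)%C) by csimp_ring.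
    rewrite Rabs_Ropp. eapply Rle_lt_trans; [apply im_le_Cmod|]. now apply Hk. }
  assert (V1 : Rabs (v 1) < PI).
  { apply (stays_inside v 0 1 PI).
    - rewrite Rmin_left, Rmax_right by lra. intros s Hs.
      apply (Ccont_minus (fun s => stir_rem (1 + RtoC s * d)%C) (fun s => stir_sum Log m (1 + RtoC s * d)%C));
        [|apply stir_sum_Ccont; auto].
      unfold stir_rem. apply Ccont_minus; [|apply Ccont_const]. apply Ccont_minus.
      + apply analytic_line_Ccont. apply HLG; auto.
      + apply (Ccont_ext (fun s => stir Log (1 + RtoC s * d))%C); auto.
        unfold stir. apply Ccont_minus; [|eapply Ccont_of_Cderive, Cderive_line].
        apply (Ccont_mult (fun s => (1 + RtoC s * d - 1/2)%C)).
        * apply Ccont_minus; [eapply Ccont_of_Cderive, Cderive_line|apply Ccont_const].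
        * apply Log_Ccont_line; auto.
    - rewrite Rmin_left, Rmax_right by lra. intros s Hs E.
      destruct (V s Hs) as (k & D & _ & _ & _ & B).
      apply Rabs_def2 in B.
      destruct (Rle_lt_dec 0 (v s)) as [Q|Q].
      + rewrite Rabs_right in E by lra. rewrite E in B.
        assert (0 < IZR k < 1) as [k1 k2] by nra. apply lt_IZR in k1, k2. lia.
      + rewrite Rabs_left in E by lra.
        assert (-1 < IZR k < 0) as [k1 k2] by nra. apply lt_IZR in k1, k2. lia.
    - unfold v. replace (1 + 0 * d)%C with (RtoC 1) by ring.
      unfold stir_rem. rewrite stir_1.
      replace (Im _) with (Im (LogGamma 1) - Im (stir_sum Log m 1)) by csimp_ring.
      rewrite stir_sum_1_real, (proj2 HLG) by lra. rewrite Rminus_0_r, Rabs_R0. auto. }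
  destruct (V 1) as (k & D & HD & E2 & E1 & B); [lra|].
  assert (k = 0%Z) as ->.
  { apply Rabs_def2 in B, V1.
    assert (-1 < IZR k < 1) as [k1 k2] by nra. apply lt_IZR in k1, k2. lia. }
  replace (1 + 1 * d)%C with w in * by (unfold d; ring).
  replace (stir_rem w) with D; auto.
  rewrite Rmult_0_r in E2.
  assert (Z : (stir_rem w - D = 0)%C) by (apply C_eq; auto).
  replace D with (stir_rem w - (stir_rem w - D))%C by ring. rewrite Z. ring.
Qed.

Lemma stir_rem_bound w : 0 < Re w -> Cmod (stir_rem w) <= K / Re w.
Proof.
  intros Hw. pose proof (stir_rem_limit w (slit_plane_pos w Hw)) as HD.
  destruct (stir_sum_limit Log HLog c Hc w) as (D' & HD' & HB).
  replace (stir_rem w) with D' by (rewrite <- (Clim_seq_eq _ _ HD), <- (Clim_seq_eq _ _ HD'); auto).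
  specialize (HB 0%nat). simpl in HB. rewrite Rplus_0_r in HB.
  replace (0 - D')%C with (- D')%C in HB by ring. rewrite Cmod_opp in HB. auto.
Qed.

Lemma stir_rem_step w : slit_plane w ->
  (stir_rem w - stir_rem (w + 1) = stir_defect Log w)%C.
Proof.
  intros Hw. assert (Hw1 : slit_plane (w + 1)) by (apply slit_plane_plus; auto; lra).
  pose proof (Ctends_incr_1 _ _ (stir_rem_limit w Hw)) as L1.
  pose proof (Ctends_plus _ _ _ _ (Ctends_const (stir_defect Log w)) (stir_rem_limit _ Hw1)) as L2.
  assert (E : stir_rem w = (stir_defect Log w + stir_rem (w + 1))%C).
  { rewrite <- (Clim_seq_eq _ _ L1), <- (Clim_seq_eq _ _ L2).
    unfold Clim_seq. f_equal; f_equal; apply Lim_seq_ext; intros n; now rewrite stir_sum_succ. }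
  rewrite E. ring.
Qed.

End Gamma.

(** * Polylogarithm series in the variable [e^{-y}] *)

Lemma is_series_Ctends (u : nat -> C) l :
  @is_series C_AbsRing C_NormedModule u l -> Ctends (sum_n u) l.
Proof.
  intros H. assert (ER : forall n, Re (sum_n u n) = sum_n (fun k => Re (u k)) n).
  { induction n as [|n IH]; [now rewrite !sum_O|]. rewrite !sum_Sn, <- IH. reflexivity. }
  assert (EI : forall n, Im (sum_n u n) = sum_n (fun k => Im (u k)) n).
  { induction n as [|n IH]; [now rewrite !sum_O|]. rewrite !sum_Sn, <- IH. reflexivity. }
  apply Ctends_of_ReIm.
  - apply (is_lim_seq_ext (sum_n (fun k => Re (u k)))); [auto|]. exact (is_series_Re u l H).
  - apply (is_lim_seq_ext (sum_n (fun k => Im (u k)))); [auto|]. exact (is_series_Im u l H).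
Qed.

Lemma is_series_C_unique (u : nat -> C) l l' :
  @is_series C_AbsRing C_NormedModule u l -> @is_series C_AbsRing C_NormedModule u l' -> l = l'.
Proof.
  intros H H'. rewrite <- (Clim_seq_eq _ _ (is_series_Ctends _ _ H)).
  apply Clim_seq_eq. now apply is_series_Ctends.
Qed.

Lemma Cmod_series_le (u : nat -> C) l (b : nat -> R) B :
  @is_series C_AbsRing C_NormedModule u l -> (forall k, Cmod (u k) <= b k) ->
  is_series b B -> Cmod l <= B.
Proof.
  intros Hu Hb HB.
  rewrite <- Cmod_opp. replace (- l)%C with (0 - l)%C by ring.
  apply (Cmod_limit_le (sum_n u) l 0 B 0 (is_series_Ctends _ _ Hu)).
  intros m _. replace (0 - sum_n u m)%C with (- sum_n u m)%C by ring. rewrite Cmod_opp.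
  eapply Rle_trans; [apply Cmod_sum_n|].
  apply Rle_trans with (sum_n b m); [apply sum_n_Rle; auto|].
  assert (Q : Rbar_le (sum_n b m) B); [|exact Q].
  apply (is_lim_seq_le_loc (fun _ => sum_n b m) (sum_n b)).
  - exists m. intros n Hn. induction Hn as [|n Hn IH]; [lra|].
    rewrite sum_Sn. unfold plus; simpl. pose proof (Hb (S n)).
    pose proof (Cmod_ge_0 (u (S n))). lra.
  - apply is_lim_seq_const.
  - exact HB.
Qed.

Lemma ex_series_power_geom p r : 0 < r < 1 -> ex_series (fun k => INR (S k) ^ p * r ^ S k).
Proof.
  intros Hr. assert (P : forall k, 0 < INR (S k)) by (intros; apply lt_0_INR; lia).
  assert (Q : forall k, 0 < INR (S k) ^ p * r ^ S k).
  { intros k. apply Rmult_lt_0_compat; apply pow_lt; auto; lra. }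
  apply (ex_series_ext (fun k => Rabs (INR (S k) ^ p * r ^ S k))).
  { intros k. apply Rabs_right. specialize (Q k). lra. }
  apply (ex_series_DAlembert _ r); [lra| |].
  - intros k. specialize (Q k). lra.
  - apply (is_lim_seq_ext (fun k => (1 + / (1 + INR k)) ^ p * r)).
    + intros k. pose proof (Q k). pose proof (Q (S k)). pose proof (P k).
      rewrite Rabs_right.
      * replace (1 + / (1 + INR k)) with (INR (S (S k)) / INR (S k)).
        -- unfold Rdiv. rewrite Rpow_mult_distr, pow_inv.
           change (r ^ S (S k)) with (r * r ^ S k). field.
           split; apply pow_nonzero; lra.
        -- rewrite !S_INR. field. rewrite S_INR in H1. lra.
      * apply Rle_ge, Rdiv_le_0_compat; lra.
    + assert (L : is_lim_seq (fun k => (1 + / (1 + INR k)) ^ p * r) ((1 + 0) ^ p * r)).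
      { apply (is_lim_seq_continuous (fun x => (1 + x) ^ p * r) (fun k => / (1 + INR k)) 0).
        - reg.
        - apply is_lim_seq_inv_INR. }
      now rewrite Rplus_0_r, pow1, Rmult_1_l in L.
Qed.

Definition polylog_term (n : Z) (x : C) (k : nat) : C :=
  (x ^ S k / RtoC (powerRZ (INR (S k)) n))%C.

Lemma INR_S_ge_1 k : 1 <= INR (S k).
Proof. apply (le_INR 1). lia. Qed.

Lemma powerRZ_weight n k : (n <= 2)%Z ->
  0 < / powerRZ (INR (S k)) n <= INR (S k) ^ Z.to_nat (2 - n) /\
  INR (S k) ^ 2 * / powerRZ (INR (S k)) n = INR (S k) ^ Z.to_nat (2 - n).
Proof.
  intros Hn. pose proof (INR_S_ge_1 k) as H1.
  assert (P : 0 < powerRZ (INR (S k)) n) by (apply powerRZ_lt; lra).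
  assert (PI : 0 < / powerRZ (INR (S k)) n) by now apply Rinv_0_lt_compat.
  assert (E : INR (S k) ^ 2 * / powerRZ (INR (S k)) n = INR (S k) ^ Z.to_nat (2 - n)).
  { rewrite (pow_powerRZ _ (Z.to_nat _)), Z2Nat.id by lia.
    unfold Z.sub. rewrite powerRZ_add, powerRZ_neg' by lra. reflexivity. }
  split; auto. split; auto. rewrite <- E.
  assert (1 <= INR (S k) ^ 2) by (apply pow_R1_Rle; auto). nra.
Qed.

Lemma polylog_term_bound n x k : (n <= 2)%Z ->
  Cmod (polylog_term n x k) <= INR (S k) ^ Z.to_nat (2 - n) * Cmod x ^ S k.
Proof.
  intros Hn. destruct (powerRZ_weight n k Hn) as [[P Q] _].
  assert (P' : powerRZ (INR (S k)) n <> 0) by (intros E; rewrite E, Rinv_0 in P; lra).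
  unfold polylog_term. rewrite Cmod_div, Cmod_pow, Cmod_R by now apply RtoC_neq.
  rewrite Rabs_right by (apply Rle_ge; left; rewrite <- (Rinv_inv (powerRZ _ _)); now apply Rinv_0_lt_compat).
  unfold Rdiv. rewrite Rmult_comm. apply Rmult_le_compat_r; auto. apply pow_le, Cmod_ge_0.
Qed.

(** [Li_n(e^{-y})] for [Re y > 0]; taking componentwise sums makes it a total
    function. *)
Definition Li_series (n : Z) (y : C) : C :=
  (Series (fun k => Re (polylog_term n (Cexp (- y)) k)), Series (fun k => Im (polylog_term n (Cexp (- y)) k))).

Lemma Cmod_Cexp_opp y : Cmod (Cexp (- y)) = exp (- Re y).
Proof. rewrite Cmod_Cexp. f_equal. Qed.

Lemma exp_opp_bounds t : 0 < t -> 0 < exp (- t) < 1.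
Proof.
  intros Ht. split; [apply exp_pos|]. rewrite <- exp_0. apply exp_increasing. lra.
Qed.

Lemma pow_exp x n : exp x ^ n = exp (INR n * x).
Proof.
  induction n as [|n IH]; [simpl; now rewrite Rmult_0_l, exp_0|].
  rewrite S_INR. simpl. rewrite IH, <- exp_plus. f_equal. ring.
Qed.

Lemma Li_series_series n y : (n <= 2)%Z -> 0 < Re y ->
  @is_series C_AbsRing C_NormedModule (polylog_term n (Cexp (- y))) (Li_series n y).
Proof.
  intros Hn Hy.
  destruct (@ex_series_le C_AbsRing C_CompleteNormedModule (polylog_term n (Cexp (- y)))
    (fun k => INR (S k) ^ Z.to_nat (2 - n) * exp (- Re y) ^ S k)) as [l Hl].
  - intros k. change (Cmod (polylog_term n (Cexp (- y)) k) <= INR (S k) ^ Z.to_nat (2 - n) * exp (- Re y) ^ S k).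
    rewrite <- Cmod_Cexp_opp. now apply polylog_term_bound.
  - apply ex_series_power_geom. now apply exp_opp_bounds.
  - replace (Li_series n y) with l; [exact Hl|]. apply C_eq; unfold Li_series; simpl.
    + symmetry. apply is_series_unique. exact (is_series_Re _ _ Hl).
    + symmetry. apply is_series_unique. exact (is_series_Im _ _ Hl).
Qed.

Lemma Cexp_pow z k : (Cexp z ^ k)%C = Cexp (RtoC (INR k) * z).
Proof.
  induction k as [|k IH].
  - simpl. rewrite Cmult_0_l, Cexp_0. reflexivity.
  - rewrite Cpow_S, IH, <- Cexp_plus, S_INR, RtoC_plus. f_equal. ring.
Qed.

Lemma is_derive_of_quadratic (g : R -> R) s l M rho : 0 < rho ->
  (forall h, Rabs h < rho -> Rabs (g (s + h) - g s - h * l) <= M * h ^ 2) -> is_derive g s l.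
Proof.
  intros Hr H. apply is_derive_Reals. intros eps Heps.
  assert (HM : 0 < Rabs M + 1) by (pose proof (Rabs_pos M); lra).
  assert (Hd : 0 < Rmin rho (eps / (Rabs M + 1))).
  { apply Rmin_pos; auto. apply Rdiv_lt_0_compat; auto. }
  exists (mkposreal _ Hd). intros h Hh0 Hh. simpl in Hh.
  assert (H1 : Rabs h < rho) by (eapply Rlt_le_trans; [exact Hh|apply Rmin_l]).
  assert (H2 : Rabs h < eps / (Rabs M + 1)) by (eapply Rlt_le_trans; [exact Hh|apply Rmin_r]).
  specialize (H h H1).
  replace ((g (s + h) - g s) / h - l) with ((g (s + h) - g s - h * l) / h) by (field; auto).
  rewrite Rabs_div by auto.
  assert (Ph : 0 < Rabs h) by now apply Rabs_pos_lt.
  apply (Rmult_lt_reg_r (Rabs h)); auto. unfold Rdiv.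
  rewrite Rmult_assoc, Rinv_l, Rmult_1_r by lra.
  eapply Rle_lt_trans; [exact H|].
  replace (h ^ 2) with (Rabs h ^ 2) by apply pow2_abs.
  apply (Rmult_lt_compat_r (Rabs M + 1)) in H2; auto.
  unfold Rdiv in H2. rewrite Rmult_assoc, Rinv_l, Rmult_1_r in H2 by lra.
  pose proof (Rle_abs M). nra.
Qed.

Lemma holo_of_quadratic (f : C -> C) (z l : C) (M rho : R) : 0 < rho ->
  (forall w, Cmod w < rho -> Cmod (f (z + w) - f z - w * l)%C <= M * Cmod w ^ 2) -> holo f z l.
Proof.
  intros Hr H z0 d s0 Ez. pose proof (Cmod_ge_0 d) as Hd.
  assert (Hr' : 0 < rho / (Cmod d + 1)) by (apply Rdiv_lt_0_compat; lra).
  assert (B : forall h, Rabs h < rho / (Cmod d + 1) ->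
    Cmod (f (z0 + RtoC (s0 + h) * d) - f (z0 + RtoC s0 * d) - RtoC h * (d * l))%C <= (M * Cmod d ^ 2) * h ^ 2).
  { intros h Hh. specialize (H (RtoC h * d)%C).
    replace (z + RtoC h * d)%C with (z0 + RtoC (s0 + h) * d)%C in H by (rewrite Ez, RtoC_plus; ring).
    rewrite <- Ez. rewrite Cmult_assoc. eapply Rle_trans; [apply H|].
    - rewrite Cmod_mult, Cmod_R.
      apply (Rmult_lt_compat_r (Cmod d + 1)) in Hh; [|lra].
      unfold Rdiv in Hh. rewrite Rmult_assoc, Rinv_l in Hh by lra.
      pose proof (Rabs_pos h). nra.
    - rewrite Cmod_mult, Cmod_R, Rpow_mult_distr, pow2_abs. right; ring. }
  split; apply (is_derive_of_quadratic _ _ _ (M * Cmod d ^ 2) (rho / (Cmod d + 1)) Hr');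
    intros h Hh; (eapply Rle_trans; [|apply (B h Hh)]).
  - eapply Rle_trans; [|apply re_le_Cmod]. right; f_equal. csimp_ring.
  - eapply Rle_trans; [|apply im_le_Cmod]. right; f_equal. csimp_ring.
Qed.

Lemma Cexp_taylor_2 w : Cmod (Cexp w - 1 - w) <= exp (Cmod w) * Cmod w ^ 2.
Proof.
  pose proof (exp_tail_bound 2 w) as Q.
  replace (exp_tail 2 w) with (Cexp w - 1 - w)%C in Q; auto.
  simpl. rewrite Rinv_1. ring.
Qed.

(** Termwise differentiation: the quadratic Taylor remainders of the terms are
    summable uniformly for [|w| < Re y / 2]. *)
Lemma holo_Li_series n y : (n <= 2)%Z -> 0 < Re y -> holo (Li_series n) y (- Li_series (n - 1) y)%C.
Proof.
  intros Hn Hy. set (r := exp (- (Re y / 2))).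
  assert (Hr : 0 < r < 1) by (apply exp_opp_bounds; lra).
  destruct (ex_series_power_geom (Z.to_nat (2 - n)) r Hr) as [M HM].
  apply (holo_of_quadratic _ _ _ M (Re y / 2)); [lra|].
  intros w Hw.
  assert (Hyw : 0 < Re (y + w)).
  { pose proof (re_le_Cmod w) as Q. apply Rabs_le_between in Q.
    replace (Re (y + w)) with (Re y + Re w) by csimp_ring. lra. }
  apply (Cmod_series_le (fun k => polylog_term n (Cexp (- (y + w))) k - polylog_term n (Cexp (- y)) k
    - w * - polylog_term (n - 1) (Cexp (- y)) k)%C _
    (fun k => Cmod w ^ 2 * (INR (S k) ^ Z.to_nat (2 - n) * r ^ S k))).
  - pose proof (Li_series_series n (y + w) Hn Hyw) as S1. pose proof (Li_series_series n y Hn Hy) as S2.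
    pose proof (Li_series_series (n - 1) y ltac:(lia) Hy) as S3.
    apply (is_series_opp _ _) in S3. apply (is_series_scal w) in S3.
    apply @is_series_minus; [apply @is_series_minus; auto|]. exact S3.
  - intros k.
    assert (P : 0 < INR (S k)) by (apply lt_0_INR; lia).
    assert (P2 : 0 < powerRZ (INR (S k)) n) by (apply powerRZ_lt; lra).
    set (m := INR (S k)) in *.
    assert (E : (polylog_term n (Cexp (- (y + w))) k - polylog_term n (Cexp (- y)) k
      - w * - polylog_term (n - 1) (Cexp (- y)) k)%C =
      (RtoC (/ powerRZ m n) * Cexp (RtoC m * - y) * (Cexp (RtoC m * - w) - 1 - RtoC m * - w))%C).
    { unfold polylog_term. rewrite !Cexp_pow. fold m.
      replace (RtoC m * - (y + w))%C with (RtoC m * - y + RtoC m * - w)%C by ring.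
      rewrite Cexp_plus. unfold Z.sub. rewrite powerRZ_add by lra.
      change (powerRZ m (- (1))) with (/ (m * 1)). rewrite Rmult_1_r.
      rewrite RtoC_mult, !RtoC_inv by lra. field. split; apply RtoC_neq; lra. }
    rewrite E, !Cmod_mult, Cmod_R, Cmod_Cexp.
    rewrite Rabs_right by (apply Rle_ge; left; now apply Rinv_0_lt_compat).
    replace (Re (RtoC m * - y)) with (- (m * Re y)) by csimp_ring.
    pose proof (Cexp_taylor_2 (RtoC m * - w)) as T.
    rewrite Cmod_mult, Cmod_opp, Cmod_R, (Rabs_right m) in T by lra.
    destruct (powerRZ_weight n k Hn) as [[W1 _] W2]. fold m in W1, W2.
    rewrite <- W2.
    assert (Er : r ^ S k = exp (- (m * Re y)) * exp (m * (Re y / 2))).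
    { rewrite <- exp_plus. unfold r. rewrite pow_exp. f_equal. fold m. field. }
    rewrite Er.
    assert (X : exp (m * Cmod w) <= exp (m * (Re y / 2))) by (apply exp_mono; nra).
    pose proof (exp_pos (- (m * Re y))) as X0.
    assert (T' : Cmod (Cexp (RtoC m * - w) - 1 - RtoC m * - w) <= exp (m * (Re y / 2)) * (m * Cmod w) ^ 2).
    { eapply Rle_trans; [exact T|]. apply Rmult_le_compat_r; auto. apply pow2_ge_0. }
    replace (Cmod w ^ 2 * (m ^ 2 * / powerRZ m n * (exp (- (m * Re y)) * exp (m * (Re y / 2))))) with
      (/ powerRZ m n * exp (- (m * Re y)) * (exp (m * (Re y / 2)) * (m * Cmod w) ^ 2)) by ring.
    apply Rmult_le_compat_l; auto. left. now apply Rmult_lt_0_compat.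
  - rewrite Rmult_comm. apply (is_series_scal_l (Cmod w ^ 2)) in HM. exact HM.
Qed.

Lemma Li_series_bound n : (n <= 2)%Z -> exists M, 0 <= M /\
  forall y, 1 <= Re y -> Cmod (Li_series n y) <= M * exp (- Re y).
Proof.
  intros Hn.
  destruct (ex_series_power_geom (Z.to_nat (2 - n)) (exp (- (1)))) as [M HM].
  { apply exp_opp_bounds. lra. }
  assert (B : forall y, 1 <= Re y -> Cmod (Li_series n y) <= (M * exp 1) * exp (- Re y)).
  { intros y Hy.
    apply (Cmod_series_le _ _ (fun k => exp (1 - Re y) * (INR (S k) ^ Z.to_nat (2 - n) * exp (- (1)) ^ S k)) _
      (Li_series_series n y Hn ltac:(lra))).
    - intros k. eapply Rle_trans; [now apply polylog_term_bound|]. rewrite Cmod_Cexp_opp.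
      rewrite (Rmult_comm (exp (1 - Re y))), Rmult_assoc.
      apply Rmult_le_compat_l; [apply pow_le, pos_INR|].
      rewrite !pow_exp, <- exp_plus. apply exp_mono.
      pose proof (INR_S_ge_1 k). nra.
    - replace (M * exp 1 * exp (- Re y)) with (exp (1 - Re y) * M)
        by (unfold Rminus; rewrite exp_plus; ring).
      apply (is_series_scal_l (exp (1 - Re y))) in HM. exact HM. }
  exists (Rabs (M * exp 1)). split; [apply Rabs_pos|]. intros y Hy.
  eapply Rle_trans; [apply B; auto|]. apply Rmult_le_compat_r; [left; apply exp_pos|apply Rle_abs].
Qed.

Lemma Li_series_0 y : 0 < Re y -> Li_series 0 y = bose y.
Proof.
  intros Hy. pose proof (Li_series_series 0 y ltac:(lia) Hy) as H.
  pose proof (is_series_Ctends _ _ H) as L.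
  set (x := Cexp (- y)) in *.
  assert (Hx : Cmod x < 1) by (unfold x; rewrite Cmod_Cexp_opp; apply exp_opp_bounds; auto).
  assert (N : (1 - x)%C <> 0).
  { intros E. replace x with (1 - (1 - x))%C in Hx by ring. rewrite E in Hx.
    replace (1 - 0)%C with (RtoC 1) in Hx by ring. rewrite Cmod_1 in Hx. lra. }
  assert (E : forall n, sum_n (polylog_term 0 x) n = ((x - x ^ S (S n)) / (1 - x))%C).
  { induction n as [|n IH].
    - rewrite sum_O. unfold polylog_term. simpl. field. auto.
    - rewrite sum_Sn, IH. unfold polylog_term, plus. simpl. field. auto. }
  assert (U : bose y = (x / (1 - x))%C).
  { unfold bose, x. rewrite Cexp_opp.
    assert (R : (Cexp y - 1)%C <> 0) by now apply regular_minus, regular_of_Re_pos.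
    field. pose proof (Cexp_neq_0 y). repeat split; auto. }
  rewrite U. rewrite <- (Clim_seq_eq _ _ L). apply Clim_seq_eq.
  apply (Ctends_squeeze _ _ (fun n => / Cmod (1 - x) * (Cmod x * Cmod x) * Cmod x ^ n) 0).
  - intros n _. rewrite E.
    replace ((x - x ^ S (S n)) / (1 - x) - x / (1 - x))%C with (- (/ (1 - x) * (x * x) * x ^ n))%C
      by (simpl; field; auto).
    rewrite Cmod_opp, !Cmod_mult, Cmod_inv, Cmod_pow by auto. lra.
  - apply is_lim_seq_scal_0. apply is_lim_seq_geom.
    rewrite Rabs_right; [auto|apply Rle_ge, Cmod_ge_0].
Qed.

(** * Convergence of the q-Pochhammer product *)

Lemma Cprod_qpoch_bound z q n : Cmod q < 1 ->
  Cmod (Cprod (fun j => 1 - z * q ^ j)%C n) <= exp (Cmod z * ((1 - Cmod q ^ n) / (1 - Cmod q))).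
Proof.
  intros Hq. induction n as [|n IH].
  - simpl. rewrite Cmod_1. unfold Rdiv. rewrite Rminus_diag, Rmult_0_l, Rmult_0_r, exp_0. lra.
  - simpl Cprod. rewrite Cmod_mult.
    replace (Cmod z * ((1 - Cmod q ^ S n) / (1 - Cmod q))) with
      (Cmod z * ((1 - Cmod q ^ n) / (1 - Cmod q)) + Cmod z * Cmod q ^ n) by (simpl; field; lra).
    rewrite exp_plus. apply Rmult_le_compat; auto; try apply Cmod_ge_0.
    eapply Rle_trans; [apply Cmod_triangle|].
    rewrite Cmod_opp, Cmod_1, Cmod_mult, Cmod_pow. apply exp_ineq1_le.
Qed.

Lemma qpoch_limit z q : Cmod q < 1 ->
  Ctends (Cprod (fun j => 1 - z * q ^ j)%C) (qpoch z q).
Proof.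
  intros Hq. pose proof (Cmod_ge_0 q) as Hq0. pose proof (Cmod_ge_0 z) as Hz0.
  set (u := Cprod (fun j => 1 - z * q ^ j)%C).
  set (B := exp (Cmod z * (1 / (1 - Cmod q)))).
  assert (HB : forall n, Cmod (u n) <= B).
  { intros n. eapply Rle_trans; [apply Cprod_qpoch_bound; auto|]. apply exp_mono.
    apply Rmult_le_compat_l; auto. unfold Rdiv. apply Rmult_le_compat_r.
    - left. apply Rinv_0_lt_compat. lra.
    - assert (0 <= Cmod q ^ n) by now apply pow_le. lra. }
  assert (B0 : 0 < B) by apply exp_pos.
  assert (Hi : 0 < / (1 - Cmod q)) by (apply Rinv_0_lt_compat; lra).
  assert (T : forall n m, (n <= m)%nat ->
    Cmod (u m - u n) <= B * Cmod z * ((Cmod q ^ n - Cmod q ^ m) / (1 - Cmod q))).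
  { intros n m Hm. induction Hm as [|m Hm IH].
    - replace (u n - u n)%C with (RtoC 0) by ring. rewrite Cmod_0.
      unfold Rdiv. rewrite Rminus_diag, Rmult_0_l, Rmult_0_r. lra.
    - replace (u (S m) - u n)%C with ((u m - u n) + - (u m * (z * q ^ m)))%C
        by (unfold u; simpl; ring).
      eapply Rle_trans; [apply Cmod_triangle|]. rewrite Cmod_opp, !Cmod_mult, Cmod_pow.
      replace (B * Cmod z * ((Cmod q ^ n - Cmod q ^ S m) / (1 - Cmod q))) with
        (B * Cmod z * ((Cmod q ^ n - Cmod q ^ m) / (1 - Cmod q)) + B * (Cmod z * Cmod q ^ m))
        by (simpl; field; lra).
      apply Rplus_le_compat; auto. apply Rmult_le_compat_r; auto.
      apply Rmult_le_pos; auto. now apply pow_le. }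
  destruct (C_complete u (fun n => B * Cmod z * / (1 - Cmod q) * Cmod q ^ n)) as (l & Hl & _).
  - intros n m Hm. eapply Rle_trans; [apply T; auto|].
    assert (0 <= Cmod q ^ m) by now apply pow_le.
    replace (B * Cmod z * / (1 - Cmod q) * Cmod q ^ n) with
      (B * Cmod z * (Cmod q ^ n / (1 - Cmod q))) by (unfold Rdiv; ring).
    apply Rmult_le_compat_l; [nra|]. unfold Rdiv. apply Rmult_le_compat_r; lra.
  - apply is_lim_seq_scal_0, is_lim_seq_geom. rewrite Rabs_right; lra.
  - replace (qpoch z q) with l; auto. symmetry. now apply Clim_seq_eq.
Qed.

Lemma qpoch_shift z q : Cmod q < 1 -> qpoch z q = ((1 - z) * qpoch (z * q) q)%C.
Proof.
  intros Hq.
  assert (E : forall n, Cprod (fun j => 1 - z * q ^ j)%C (S n) =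
    ((1 - z) * Cprod (fun j => 1 - z * q * q ^ j)%C n)%C).
  { induction n as [|n IH]; [simpl; ring|].
    change (Cprod (fun j => 1 - z * q ^ j)%C (S (S n))) with
      (Cprod (fun j => 1 - z * q ^ j)%C (S n) * (1 - z * q ^ (S n)))%C.
    rewrite IH. simpl. ring. }
  pose proof (proj1 (is_lim_seq_incr_1 _ _) (qpoch_limit z q Hq)) as L1.
  rewrite <- (Clim_seq_eq (fun n => Cprod (fun j => 1 - z * q ^ j)%C (S n)) _ L1).
  apply Clim_seq_eq.
  apply (Ctends_squeeze _ _ (fun n => Cmod (1 - z) * Cmod (Cprod (fun j => 1 - z * q * q ^ j)%C n - qpoch (z * q) q)) 0).
  - intros n _. rewrite E, <- Cmod_mult. right. f_equal. ring.
  - apply is_lim_seq_scal_0. now apply qpoch_limit.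
Qed.

(** * The branches on the cut domain *)

Section Branches.

Variable beta : C.
Hypothesis Hbeta : 0 < Re beta.

Lemma cut_domain_pos y : 0 < Re y -> cut_domain beta y.
Proof.
  intros Hy (m & t & Ht & E). rewrite E in Hy.
  replace (Re _) with (Re beta * t) in Hy by csimp_ring. nra.
Qed.

Lemma cut_domain_add y s : 0 <= s -> cut_domain beta y -> cut_domain beta (y + RtoC s * beta).
Proof.
  intros Hs Hy (m & t & Ht & E). apply Hy. exists m, (t - s). split; [lra|].
  replace y with (y + RtoC s * beta - RtoC s * beta)%C by ring. rewrite E, RtoC_minus. ring.
Qed.

Lemma Re_ray y s : Re (y + RtoC s * beta) = Re y + s * Re beta.
Proof. csimp_ring. Qed.

Variable L1 : C -> C.
Hypothesis HL1 : is_log_1m_exp_branch beta L1.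

Lemma L1_exp y : cut_domain beta y -> Cexp (L1 y) = (1 - Cexp (- y))%C.
Proof. apply HL1. Qed.

Lemma cut_domain_exp y : cut_domain beta y -> Cexp y <> 1.
Proof.
  intros Hy E. pose proof (L1_exp y Hy) as Q. rewrite Cexp_opp, E in Q.
  apply (Cexp_neq_0 (L1 y)). rewrite Q. field.
Qed.

Lemma L1_Ccont y s : cut_domain beta (y + RtoC s * beta) -> Ccont (fun s => L1 (y + RtoC s * beta)%C) s.
Proof. intros H. apply analytic_line_Ccont. now apply HL1. Qed.

Lemma L1_derive y s : 0 < s -> cut_domain beta y ->
  Cderive (fun s => L1 (y + RtoC s * beta)%C) s (beta * bose (y + RtoC s * beta))%C.
Proof.
  intros Hs Hy. assert (Hys := cut_domain_add y s ltac:(lra) Hy).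
  destruct (analytic_holo L1 _ (proj1 (proj1 HL1) _ Hys)) as (l & Hl).
  pose proof (holo_line _ _ _ _ _ Hl) as D1.
  pose proof (Cderive_exp _ _ _ D1) as D2. cbv beta in D2. rewrite L1_exp in D2 by auto.
  assert (D3 : Cderive (fun s => 1 - Cexp (- (y + RtoC s * beta)))%C s (0 - - beta * Cexp (- (y + RtoC s * beta)))%C).
  { apply Cderive_minus; [apply Cderive_const|].
    apply (Cderive_exp (fun s => - (y + RtoC s * beta))%C). apply Cderive_opp, Cderive_line. }
  assert (D4 : Cderive (fun s => Cexp (L1 (y + RtoC s * beta)%C)) s (0 - - beta * Cexp (- (y + RtoC s * beta)))%C).
  { eapply Cderive_ext_loc; [|exact D3].
    exists (mkposreal s Hs). intros t Ht. change (Rabs (t - s) < s) in Ht.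
    apply Rabs_def2 in Ht. symmetry. apply L1_exp, cut_domain_add; auto. lra. }
  pose proof (Cderive_unique _ _ _ _ D2 D4) as E.
  eapply Cderive_eq; [exact D1|].
  set (x := (y + RtoC s * beta)%C) in *.
  pose proof (cut_domain_exp x Hys) as N.
  assert (N1 : (Cexp x - 1)%C <> 0).
  { intros Q. apply N. replace (Cexp x) with (Cexp x - 1 + 1)%C by ring. rewrite Q. ring. }
  pose proof (Cexp_neq_0 x) as N0.
  rewrite Cexp_opp in E. unfold bose.
  replace (beta * l)%C with ((beta * l * (1 - / Cexp x)) * Cexp x / (Cexp x - 1))%C
    by (field; auto).
  rewrite E. field. auto.
Qed.

(** On [Re y > 0] the branch is the principal logarithm of [1 - e^{-y}], whose
    argument has positive real part. *)
Lemma L1_Im_small y : 0 < Re y -> Rabs (Im (L1 y)) < PI / 2.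
Proof.
  intros Hy.
  assert (Cut : forall s, cut_domain beta (RtoC (Re y) + RtoC s * (0, Im y))%C).
  { intros s. apply cut_domain_pos. replace (Re _) with (Re y) by csimp_ring. auto. }
  assert (Q : Rabs (Im (L1 (RtoC (Re y) + RtoC 1 * (0, Im y))%C)) < PI / 2).
  { apply (stays_inside (fun s => Im (L1 (RtoC (Re y) + RtoC s * (0, Im y))%C)) 0 1).
    - intros s _. apply (analytic_line_Ccont L1). apply HL1, Cut.
    - intros s _ E. pose proof (L1_exp _ (Cut s)) as X.
      set (x := (RtoC (Re y) + RtoC s * (0, Im y))%C) in *.
      apply (f_equal Re) in X. simpl Re at 1 in X.
      assert (C0 : cos (Im (L1 x)) = 0).
      { destruct (Rle_lt_dec 0 (Im (L1 x))) as [P|P].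
        - rewrite Rabs_right in E by lra. rewrite E. apply cos_PI2.
        - rewrite Rabs_left in E by lra. rewrite <- cos_neg, E. apply cos_PI2. }
      rewrite C0, Rmult_0_r in X.
      replace (Re (1 - Cexp (- x))) with (1 - Re (Cexp (- x))) in X by csimp_ring.
      pose proof (Re_le_Cmod (Cexp (- x))) as B. rewrite Cmod_Cexp_opp in B.
      replace (Re x) with (Re y) in B by (unfold x; csimp_ring).
      pose proof (exp_opp_bounds _ Hy). lra.
    - replace (RtoC (Re y) + RtoC 0 * (0, Im y))%C with (RtoC (Re y)) by ring.
      rewrite (proj2 HL1) by auto. rewrite Rabs_R0. pose proof PI_RGT_0. lra. }
  replace (RtoC (Re y) + RtoC 1 * (0, Im y))%C with y in Q; auto.
  apply C_eq; csimp_ring.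
Qed.

(** Modulus and argument of [1 - e^{-y}] are controlled separately; the bound on the
    argument needs it to be less than [pi/2]. *)
Lemma L1_bound : exists M, 0 <= M /\ forall y, 1 <= Re y -> Cmod (L1 y) <= M * exp (- Re y).
Proof.
  pose proof PI_RGT_0 as HPI.
  destruct (sin_lower (PI / 2)) as (k & Hk & Hs); [lra|].
  pose proof (exp_opp_bounds 1 ltac:(lra)) as H1.
  set (d := 1 - exp (- (1))). assert (Hd : 0 < d) by (unfold d; lra).
  assert (Hdi : 0 < / d) by now apply Rinv_0_lt_compat.
  assert (Hki : 0 < / k) by (apply Rinv_0_lt_compat; lra).
  exists (/ d + / k * / d). split; [nra|]. intros y Hy.
  pose proof (L1_Im_small y ltac:(lra)) as HI.
  pose proof (L1_exp y (cut_domain_pos y ltac:(lra))) as E.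
  set (x := Cexp (- y)) in *.
  assert (Hx : Cmod x = exp (- Re y)) by apply Cmod_Cexp_opp.
  assert (Hx1 : exp (- Re y) <= exp (- (1))) by (apply exp_mono; lra).
  rewrite <- Hx in *. pose proof (Cmod_ge_0 x) as Hx0.
  assert (A1 : 1 - Cmod x <= Cmod (1 - x)).
  { pose proof (Cmod_ge_minus 1 (- x)) as Q. rewrite Cmod_1, Cmod_opp in Q. exact Q. }
  assert (A2 : Cmod (1 - x) <= 1 + Cmod x).
  { unfold Cminus. eapply Rle_trans; [apply Cmod_triangle|]. rewrite Cmod_1, Cmod_opp. lra. }
  assert (Em : exp (Re (L1 y)) = Cmod (1 - x)) by (rewrite <- E, Cmod_Cexp; auto).
  assert (Dx : d <= Cmod (1 - x)) by (unfold d; lra).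
  assert (R : Rabs (Re (L1 y)) <= / d * Cmod x).
  { set (a := Re (L1 y)) in *.
    pose proof (exp_ineq1_le a) as Q1. pose proof (exp_ineq1_le (- a)) as Q2.
    rewrite exp_Ropp, Em in Q2.
    assert (/ d >= 1).
    { apply Rle_ge. rewrite <- Rinv_1. apply Rinv_le_contravar; auto. unfold d. lra. }
    apply Rabs_le. split.
    - assert (/ Cmod (1 - x) <= / d * Cmod x + 1); [|lra].
      apply Rle_trans with (/ (1 - Cmod x)); [apply Rinv_le_contravar; lra|].
      replace (/ (1 - Cmod x)) with (/ (1 - Cmod x) * Cmod x + 1) by (field; lra).
      apply Rplus_le_compat_r, Rmult_le_compat_r; auto. apply Rinv_le_contravar; auto. unfold d; lra.
    - nra. }
  assert (I : Rabs (Im (L1 y)) <= / k * / d * Cmod x).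
  { set (b := Im (L1 y)) in *.
    assert (S : k * Rabs b <= Rabs (sin b)).
    { destruct (Rle_lt_dec 0 b) as [P|P].
      - rewrite Rabs_right in HI |- * by lra.
        eapply Rle_trans; [apply Hs; lra|apply Rle_abs].
      - rewrite Rabs_left in HI |- * by lra.
        eapply Rle_trans; [apply Hs; lra|]. rewrite sin_neg, <- Rabs_Ropp. apply Rle_abs. }
    assert (S2 : exp (Re (L1 y)) * Rabs (sin b) <= Cmod x).
    { rewrite <- (Rabs_right (exp _)) by (apply Rle_ge; left; apply exp_pos).
      rewrite <- Rabs_mult.
      change (Rabs (Im (Cexp (L1 y))) <= Cmod x). rewrite E.
      replace (Im (1 - x)) with (- Im x) by csimp_ring. rewrite Rabs_Ropp. apply im_le_Cmod. }
    rewrite Em in S2.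
    assert (S3 : d * (k * Rabs b) <= Cmod x).
    { eapply Rle_trans; [|exact S2]. apply Rmult_le_compat; try lra.
      apply Rmult_le_pos; [lra|apply Rabs_pos]. }
    replace (Rabs b) with (/ k * / d * (d * (k * Rabs b))) by (field; lra).
    apply Rmult_le_compat_l; auto. nra. }
  eapply Rle_trans; [apply Cmod_le_ReIm|]. lra.
Qed.

Lemma exp_opp_le_inv a : 0 < a -> exp (- a) <= / a.
Proof.
  intros Ha. rewrite exp_Ropp. apply Rinv_le_contravar; auto.
  pose proof (exp_ineq1_le a). lra.
Qed.

Variable LogQ : C -> C.
Hypothesis HQ : is_log_qpoch beta LogQ.

Lemma Cmod_exp_beta : Cmod (Cexp (- beta)) < 1.
Proof. rewrite Cmod_Cexp_opp. now apply exp_opp_bounds. Qed.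

Lemma LogQ_defect_exp y : cut_domain beta y ->
  Cexp (LogQ y - LogQ (y + beta) - L1 y) = 1.
Proof.
  intros Hy.
  assert (Hyb : cut_domain beta (y + beta)).
  { replace (y + beta)%C with (y + RtoC 1 * beta)%C by ring. apply cut_domain_add; auto. lra. }
  rewrite !Cexp_minus, L1_exp by auto.
  rewrite (proj2 (proj1 HQ) y Hy), qpoch_shift by apply Cmod_exp_beta.
  replace (Cexp (- y) * Cexp (- beta))%C with (Cexp (- (y + beta)))
    by (rewrite <- Cexp_plus; f_equal; ring).
  rewrite <- (proj2 (proj1 HQ) _ Hyb), <- L1_exp by auto. field.
  split; apply Cexp_neq_0.
Qed.

(** The functional equation [(z;q) = (1-z)(zq;q)] holds for the logarithms up to
    a multiple of [2 pi i], which is constant along the ray [y + s beta] and tends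
    to [0]. *)
Lemma LogQ_step y : cut_domain beta y -> LogQ y = (LogQ (y + beta) + L1 y)%C.
Proof.
  intros Hy. pose proof PI_RGT_0 as HPI.
  assert (P3 : 3 < PI) by (pose proof PI2_3_2; unfold PI2 in *; lra).
  set (h := fun s => (LogQ (y + RtoC s * beta) - LogQ (y + beta + RtoC s * beta) - L1 (y + RtoC s * beta))%C).
  assert (Hyb : cut_domain beta (y + beta)).
  { replace (y + beta)%C with (y + RtoC 1 * beta)%C by ring. apply cut_domain_add; auto. lra. }
  assert (Hh : forall s, 0 <= s -> Re (h s) = 0 /\ exists k : Z, Im (h s) = 2 * PI * IZR k).
  { intros s Hs. apply Cexp_eq_1. unfold h.
    replace (y + beta + s * beta)%C with (y + s * beta + beta)%C by ring.
    apply LogQ_defect_exp. now apply cut_domain_add. }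
  destruct L1_bound as (M1 & HM1 & B1).
  destruct (proj2 HQ 1 ltac:(lra)) as (M & HM).
  (* So far out on the ray that all three logarithms are at most [1]. *)
  set (T := (Rabs (Re y) + Rabs M + M1 + 2) / Re beta).
  pose proof (Rabs_pos (Re y)) as Ry. pose proof (Rabs_pos M) as RM.
  assert (HT : 0 <= T) by (apply Rdiv_le_0_compat; lra).
  assert (ET : T * Re beta = Rabs (Re y) + Rabs M + M1 + 2) by (unfold T; field; lra).
  pose proof (Rle_abs (- Re y)) as Ry2. rewrite Rabs_Ropp in Ry2.
  pose proof (Rle_abs M) as RM2.
  assert (VT : Rabs (Im (h T)) < PI).
  { eapply Rle_lt_trans; [apply im_le_Cmod|]. eapply Rle_lt_trans; [|exact P3].
    unfold h, Cminus. eapply Rle_trans; [apply Cmod_triangle|].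
    eapply Rle_trans; [apply Rplus_le_compat_r, Cmod_triangle|]. rewrite !Cmod_opp.
    assert (A1 : Cmod (LogQ (y + RtoC T * beta)%C) < 1).
    { apply HM; [now apply cut_domain_add|]. rewrite Re_ray. lra. }
    assert (A2 : Cmod (LogQ (y + beta + RtoC T * beta)%C) < 1).
    { apply HM; [now apply cut_domain_add|]. rewrite Re_ray.
      replace (Re (y + beta)) with (Re y + Re beta) by csimp_ring. lra. }
    assert (A3 : Cmod (L1 (y + RtoC T * beta)%C) <= 1).
    { eapply Rle_trans; [apply B1; rewrite Re_ray; lra|]. rewrite Re_ray.
      apply Rle_trans with (M1 * / (Re y + T * Re beta)).
      - apply Rmult_le_compat_l; auto. apply exp_opp_le_inv. lra.
      - apply (Rmult_le_reg_r (Re y + T * Re beta)); [lra|].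
        rewrite Rmult_assoc, Rinv_l by lra. lra. }
    lra. }
  assert (V0 : Rabs (Im (h 0)) < PI).
  { apply (stays_inside (fun s => Im (h s)) T 0); auto.
    - rewrite Rmin_right, Rmax_left by lra. intros s Hs.
      apply (Ccont_minus (fun s => LogQ (y + RtoC s * beta) - LogQ (y + beta + RtoC s * beta))%C
        (fun s => L1 (y + RtoC s * beta))%C).
      + apply Ccont_minus; apply analytic_line_Ccont, HQ, cut_domain_add; auto; lra.
      + apply L1_Ccont, cut_domain_add; auto; lra.
    - rewrite Rmin_right, Rmax_left by lra. intros s Hs.
      destruct (Hh s ltac:(lra)) as [_ [k Hk]]. exact (two_pi_Z_neq_pi _ k Hk). }
  destruct (Hh 0 ltac:(lra)) as [R0 [k Hk]].
  assert (Z : h 0 = 0).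
  { apply C_eq; auto. exact (two_pi_Z_small _ k Hk V0). }
  unfold h in Z. replace (y + 0 * beta)%C with y in Z by ring.
  replace (y + beta + 0 * beta)%C with (y + beta)%C in Z by ring.
  replace (LogQ y) with ((LogQ y - LogQ (y + beta) - L1 y) + (LogQ (y + beta) + L1 y))%C by ring.
  rewrite Z. ring.
Qed.

Variable Li2 : C -> C.
Hypothesis HLi : is_Li2_exp_branch beta Li2.

Lemma Li2_Li_series y : 0 < Re y -> Li2 y = Li_series 2 y.
Proof.
  intros Hy. apply (is_series_C_unique (polylog_term 2 (Cexp (- y)))).
  - apply HLi. auto.
  - apply Li_series_series; [lia|auto].
Qed.

(** Both sides have the same derivative along the ray [y + s beta] and tend to [0] at
    its end. *)
Lemma L1_Li_series y : 0 < Re y -> L1 y = (- Li_series 1 y)%C.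
Proof.
  intros Hy. destruct L1_bound as (M1 & HM1 & B1).
  destruct (Li_series_bound 1 ltac:(lia)) as (M2 & HM2 & B2).
  set (u := fun s => (L1 (y + RtoC s * beta) + Li_series 1 (y + RtoC s * beta))%C).
  assert (Pos : forall s, 0 <= s -> 0 < Re (y + RtoC s * beta)%C).
  { intros s Hs. rewrite Re_ray. nra. }
  assert (D2 : forall s, 0 <= s -> Cderive (fun s => Li_series 1 (y + RtoC s * beta)%C) s (beta * - bose (y + RtoC s * beta))%C).
  { intros s Hs. rewrite <- Li_series_0 by auto. apply holo_line.
    apply (holo_Li_series 1); [lia|auto]. }
  assert (Cst : forall T, 0 <= T -> Cmod (u T - u 0) <= 0).
  { intros T HT. replace 0 with (0 - 0) at 2 by ring.
    apply (mean_value_ineq u (fun _ => RtoC 0) (fun _ => 0) (fun _ => 0)); auto.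
    - intros s Hs. apply Ccont_plus.
      + apply L1_Ccont, cut_domain_pos, Pos; lra.
      + eapply Ccont_of_Cderive, D2; lra.
    - intros s _. apply continuity_pt_const. easy.
    - intros s Hs. eapply Cderive_eq.
      + apply Cderive_plus; [apply L1_derive; [lra|now apply cut_domain_pos]|apply D2; lra].
      + ring.
    - intros s _. apply @is_derive_const.
    - intros s _. rewrite Cmod_0. lra. }
  assert (Z : u 0 = 0).
  { apply Cmod_eq_0. apply Rle_antisym; [|apply Cmod_ge_0].
    apply le_epsilon. intros eps Heps. rewrite Rplus_0_l.
    set (T := (1 + (M1 + M2) / eps) / Re beta).
    assert (Q : 0 <= (M1 + M2) / eps) by (apply Rdiv_le_0_compat; lra).
    assert (HT : 0 <= T) by (apply Rdiv_le_0_compat; lra).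
    assert (ET : T * Re beta = 1 + (M1 + M2) / eps) by (unfold T; field; lra).
    specialize (Cst T HT).
    replace (u 0) with (u T - (u T - u 0))%C by ring.
    unfold Cminus at 1. eapply Rle_trans; [apply Cmod_triangle|]. rewrite Cmod_opp.
    apply Rle_trans with (Cmod (u T)); [lra|].
    unfold u. eapply Rle_trans; [apply Cmod_triangle|].
    set (x := (y + RtoC T * beta)%C).
    assert (Ex : Re x = Re y + T * Re beta) by (unfold x; apply Re_ray).
    eapply Rle_trans; [apply Rplus_le_compat; [apply B1|apply B2]; lra|].
    rewrite <- Rmult_plus_distr_r.
    apply Rle_trans with ((M1 + M2) * / Re x).
    + apply Rmult_le_compat_l; [lra|]. apply exp_opp_le_inv. lra.
    + apply (Rmult_le_reg_r (Re x)); [lra|]. rewrite Rmult_assoc, Rinv_l, Rmult_1_r by lra.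
      rewrite Ex, ET. replace (M1 + M2) with (eps * ((M1 + M2) / eps)) at 1 by (field; lra). nra. }
  unfold u in Z. replace (y + 0 * beta)%C with y in Z by ring.
  replace (L1 y) with ((L1 y + Li_series 1 y) - Li_series 1 y)%C by ring. rewrite Z. ring.
Qed.

(** [d/dy Li_2(e^{-y}) = log(1 - e^{-y})] continues from the half-plane
    [Re y > 0] along the rays of direction [beta]. *)
Lemma Li2_derive y s : 0 <= s -> cut_domain beta y ->
  Cderive (fun s => Li2 (y + RtoC s * beta)%C) s (beta * L1 (y + RtoC s * beta))%C.
Proof.
  intros Hs Hy.
  set (u := fun s => Li2 (y + RtoC s * beta)%C).
  set (v := fun s => (beta * L1 (y + RtoC s * beta))%C).
  assert (An : forall s, 0 <= s -> analytic_at Li2 (y + RtoC s * beta)%C).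
  { intros t Ht. now apply HLi, cut_domain_add. }
  assert (An1 : forall s, 0 <= s -> analytic_at L1 (y + RtoC s * beta)%C).
  { intros t Ht. now apply HL1, cut_domain_add. }
  assert (DP : forall s, 0 < Re (y + RtoC s * beta)%C -> Cderive u s (v s)).
  { intros t Ht. apply (Cderive_ext_loc (fun s => Li_series 2 (y + RtoC s * beta)%C)).
    2: { apply holo_line. rewrite L1_Li_series by auto. apply (holo_Li_series 2); [lia|auto]. }
    destruct (Ccont_of_Cderive _ _ _ (Cderive_line y beta t)) as [HR _].
    apply continuity_pt_filterlim in HR.
    eapply filter_imp; [|apply (HR (fun x => 0 < x)); now apply open_gt].
    intros x Hx. unfold u. symmetry. now apply Li2_Li_series. }
  (* Beyond the real part zero with a margin: the relation is known on the last unit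
     of the parameter interval. *)
  set (b := s + (Rabs (Re y) + 1) / Re beta + 1).
  assert (Hb0 : 0 <= (Rabs (Re y) + 1) / Re beta).
  { apply Rdiv_le_0_compat; auto. pose proof (Rabs_pos (Re y)); lra. }
  assert (Far : forall t, b - 1 < t < b -> 0 < Re (y + RtoC t * beta)%C).
  { intros t Ht. rewrite Re_ray. unfold b in Ht.
    assert ((Rabs (Re y) + 1) / Re beta * Re beta <= t * Re beta) by (apply Rmult_le_compat_r; lra).
    replace ((Rabs (Re y) + 1) / Re beta * Re beta) with (Rabs (Re y) + 1) in H by (field; lra).
    pose proof (Rle_abs (- Re y)) as Q. rewrite Rabs_Ropp in Q. lra. }
  assert (Hsb : 0 <= s < b) by (unfold b; lra).
  assert (AU : forall t, 0 <= t <= b -> Ranalytic (fun s => Re (u s)) t /\ Ranalytic (fun s => Im (u s)) t).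
  { intros t Ht. destruct (analytic_coef _ _ (An t ltac:(lra))) as (l & Hl).
    destruct (Hl y beta t eq_refl) as (A1 & A2 & _). now split. }
  assert (AV : forall t, 0 <= t <= b -> Ranalytic (fun s => Re (v s)) t /\ Ranalytic (fun s => Im (v s)) t).
  { intros t Ht. destruct (analytic_coef _ _ (An1 t ltac:(lra))) as (l & Hl).
    destruct (Hl y beta t eq_refl) as (A1 & A2 & _). split.
    - apply (Ranalytic_minus (fun s => Re beta * Re (L1 (y + RtoC s * beta)%C))
        (fun s => Im beta * Im (L1 (y + RtoC s * beta)%C))); now apply Ranalytic_scal.
    - apply (Ranalytic_plus (fun s => Re beta * Im (L1 (y + RtoC s * beta)%C))
        (fun s => Im beta * Re (L1 (y + RtoC s * beta)%C))); now apply Ranalytic_scal. }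
  split.
  - apply (Ranalytic_derive_continuation (fun s => Re (u s)) (fun s => Re (v s)) 0 b 1); try lra.
    + intros t Ht. now apply AU.
    + intros t Ht. now apply AV.
    + intros t Ht. apply (DP t (Far t Ht)).
  - apply (Ranalytic_derive_continuation (fun s => Im (u s)) (fun s => Im (v s)) 0 b 1); try lra.
    + intros t Ht. now apply AU.
    + intros t Ht. now apply AV.
    + intros t Ht. apply (DP t (Far t Ht)).
Qed.

End Branches.

(** * Polylogarithms of nonpositive order *)

Lemma analytic_ext f g z : (forall x, f x = g x) -> analytic_at f z -> analytic_at g z.
Proof.
  intros E (a & r & Hr & H). exists a, r. split; auto. intros h Hh. rewrite <- E. auto.
Qed.

Lemma analytic_const c z : analytic_at (fun _ => c) z.
Proof.
  exists (fun n => match n with O => c | S _ => RtoC 0 end), 1. split; [lra|]. intros h _.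
  unfold is_pseries, is_series. eapply filterlim_ext; [|apply filterlim_const].
  intros n. simpl. induction n as [|n IH].
  - rewrite sum_O. simpl. unfold scal; simpl; unfold mult, one; simpl. ring.
  - rewrite sum_Sn, <- IH. unfold plus, scal; simpl; unfold mult; simpl. ring.
Qed.

Lemma analytic_plus f g z : analytic_at f z -> analytic_at g z ->
  analytic_at (fun x => f x + g x)%C z.
Proof.
  intros (a & r & Hr & Ha) (b & r' & Hr' & Hb).
  exists (PS_plus a b), (Rmin r r'). split; [now apply Rmin_pos|].
  intros h Hh. pose proof (Rmin_l r r'). pose proof (Rmin_r r r').
  apply @is_pseries_plus; [apply Ha|apply Hb]; lra.
Qed.

Lemma analytic_mul_affine c d f z : analytic_at f z ->
  analytic_at (fun x => (c + d * x) * f x)%C z.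
Proof.
  intros (a & r & Hr & Ha).
  exists (PS_plus (PS_scal (c + d * z)%C a) (PS_scal d (PS_incr_1 a))), r. split; auto.
  intros h Hh. specialize (Ha h Hh).
  replace ((c + d * (z + h)) * f (z + h)%C)%C with
    (plus (scal (c + d * z)%C (f (z + h)%C : C_NormedModule)) (scal d (scal h (f (z + h)%C : C_NormedModule)))).
  - apply @is_pseries_plus; apply @is_pseries_scal; try apply Cmult_comm.
    + exact Ha.
    + exact (@is_pseries_incr_1 C_AbsRing C_NormedModule a h _ Ha).
  - unfold plus, scal; simpl; unfold mult; simpl. ring.
Qed.

Lemma analytic_monomial c j k z : analytic_at (fun x => c * (x ^ j * (1 - x) ^ k))%C z.
Proof.
  induction j as [|j IHj].
  - induction k as [|k IHk].
    + apply (analytic_ext (fun _ => c)); [intros; simpl; ring|apply analytic_const].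
    + apply (analytic_ext (fun x => (1 + - (1) * x) * (c * (x ^ 0 * (1 - x) ^ k)))%C);
        [intros; simpl; ring|now apply analytic_mul_affine].
  - apply (analytic_ext (fun x => (0 + 1 * x) * (c * (x ^ j * (1 - x) ^ k)))%C);
      [intros; simpl; ring|now apply analytic_mul_affine].
Qed.

Lemma analytic_mul_1m_pow f k z : analytic_at f z -> analytic_at (fun x => f x * (1 - x) ^ k)%C z.
Proof.
  intros Hf. induction k as [|k IH].
  - apply (analytic_ext f); [intros; simpl; ring|auto].
  - apply (analytic_ext (fun x => (1 + - (1) * x) * (f x * (1 - x) ^ k))%C);
      [intros; simpl; ring|now apply analytic_mul_affine].
Qed.

(** [(1-x)^{m+1} Li_{-m}(x)] as a polynomial in [x]; clearing the denominator means
    that only polynomial expressions have to be shown analytic. *)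
Definition Li_neg_numerator (m : nat) (x : C) : C :=
  sum_n (fun j => RtoC (Li_neg_coef m j) * (x ^ j * (1 - x) ^ (S m - j)))%C (S m).

Lemma analytic_sum_n (f : nat -> C -> C) n z : (forall k, analytic_at (f k) z) ->
  analytic_at (fun x => sum_n (fun k => f k x) n) z.
Proof.
  intros H. induction n as [|n IH].
  - apply (analytic_ext (f 0%nat)); auto. intros; now rewrite sum_O.
  - apply (analytic_ext (fun x => sum_n (fun k => f k x) n + f (S n) x)%C).
    + intros; now rewrite sum_Sn.
    + now apply analytic_plus.
Qed.

Lemma Li_neg_numerator_eq m y : Cexp y <> 1 ->
  Li_neg_numerator m (Cexp (- y)) = (Li_neg m y * (1 - Cexp (- y)) ^ S m)%C.
Proof.
  intros Hy. assert (N1 : (Cexp y - 1)%C <> 0).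
  { intros Q. apply Hy. replace (Cexp y) with (Cexp y - 1 + 1)%C by ring. rewrite Q. ring. }
  pose proof (Cexp_neq_0 y) as N0.
  assert (E : (bose y * (1 - Cexp (- y)))%C = Cexp (- y)).
  { unfold bose. rewrite Cexp_opp. field. auto. }
  unfold Li_neg_numerator, Li_neg.
  rewrite <- (sum_n_mult_r (K := C_Ring)).
  apply sum_n_ext_loc. intros j Hj.
  change (@mult C_Ring) with Cmult.
  set (q := (1 - Cexp (- y))%C) in *.
  rewrite <- E at 1. rewrite Cpow_mult_l.
  assert (P : (q ^ S m = q ^ j * q ^ (S m - j))%C) by (rewrite <- Cpow_add_r; f_equal; lia).
  rewrite P. match goal with |- ?a = ?b => change (@eq C a b) end. ring.
Qed.

(** Both families are generated from the same initial function by the operator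
    [- d/dy]. *)
Lemma Li_series_Li_neg m y : 0 < Re y -> Li_series (- Z.of_nat m) y = Li_neg m y.
Proof.
  revert y. induction m as [|m IH]; intros y Hy.
  - simpl Z.opp. rewrite Li_series_0 by auto. unfold Li_neg. rewrite sum_Sn, sum_O.
    unfold plus; simpl. ring.
  - assert (D1 : holo (Li_series (- Z.of_nat m)) y (- Li_series (- Z.of_nat m - 1) y)%C) by (apply holo_Li_series; [lia|auto]).
    assert (D2 : holo (Li_neg m) y (- Li_neg (S m) y)%C).
    { apply holo_Li_neg. now apply regular_of_Re_pos. }
    assert (E : y = (y + RtoC 0 * 1)%C) by ring.
    pose proof (D1 y 1 0 E) as C1. pose proof (D2 y 1 0 E) as C2.
    assert (C3 : Cderive (fun s => Li_neg m (y + RtoC s * 1)%C) 0 (1 * - Li_series (- Z.of_nat m - 1) y)%C).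
    { eapply Cderive_ext_loc; [|exact C1].
      exists (mkposreal _ Hy). intros t Ht. change (Rabs (t - 0) < Re y) in Ht.
      apply Rabs_def2 in Ht. apply IH.
      replace (Re _) with (Re y + t) by csimp_ring. lra. }
    pose proof (Cderive_unique _ _ _ _ C2 C3) as Q.
    replace (- Z.of_nat (S m))%Z with (- Z.of_nat m - 1)%Z by lia.
    replace (Li_neg (S m) y) with (- (1 * - Li_neg (S m) y))%C by ring. rewrite Q. ring.
Qed.

Lemma Cexp_surjective Log (x : C) : is_log_slit Log -> x <> 0 -> exists y, x = Cexp (- y).
Proof.
  intros HL Hx. destruct (classic (slit_plane x)) as [H|H].
  - exists (- Log x)%C. replace (- - Log x)%C with (Log x) by ring.
    symmetry. now apply Log_exp.
  - apply NNPP in H. destruct H as (t & Ht & ->).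
    assert (Ht' : 0 < - t).
    { destruct Ht as [|E]; [lra|]. exfalso. now apply Hx; rewrite E. }
    assert (OO : forall z : C, (- - z)%C = z) by (intros; ring).
    exists (- (ln (- t), PI))%C. rewrite OO.
    unfold Cexp. simpl Re. simpl Im. rewrite exp_ln, cos_PI, sin_PI by auto.
    apply C_eq; csimp_ring.
Qed.

Lemma polylog_unit_disc Log m f (x : C) : is_log_slit Log ->
  is_polylog_nonpos (- Z.of_nat m) f -> x <> 0 -> Cmod x < 1 ->
  (f x * (1 - x) ^ S m)%C = Li_neg_numerator m x.
Proof.
  intros HLog Hf Hx0 Hx. destruct (Cexp_surjective Log x HLog Hx0) as (y & ->).
  assert (Hy : 0 < Re y).
  { rewrite Cmod_Cexp_opp in Hx. apply Rnot_le_lt. intros L.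
    assert (exp 0 <= exp (- Re y)) by (apply exp_mono; lra). rewrite exp_0 in H. lra. }
  rewrite Li_neg_numerator_eq by now apply regular_of_Re_pos.
  rewrite <- Li_series_Li_neg by auto. f_equal.
  apply (is_series_C_unique (polylog_term (- Z.of_nat m) (Cexp (- y)))).
  - now apply Hf.
  - apply Li_series_series; [lia|auto].
Qed.

(** Continuation from the unit disc along a segment that avoids [1]. *)
Lemma polylog_numerator Log m f (x : C) : is_log_slit Log ->
  is_polylog_nonpos (- Z.of_nat m) f -> x <> 1 ->
  (f x * (1 - x) ^ S m)%C = Li_neg_numerator m x.
Proof.
  intros HLog Hf Hx.
  set (H := fun x => (f x * (1 - x) ^ S m + - (1) * Li_neg_numerator m x)%C).
  assert (AH : forall z : C, z <> 1 -> analytic_at H z).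
  { intros z Hz. apply analytic_plus.
    - apply analytic_mul_1m_pow. now apply Hf.
    - apply (analytic_ext (fun x => (- (1) + 0 * x) * Li_neg_numerator m x)%C); [intros; ring|].
      apply analytic_mul_affine. apply analytic_sum_n. intros k. apply analytic_monomial. }
  (* A real [x] is reached from [i/2], any other one from [1/2]: neither segment
     meets [1]. *)
  assert (Start : exists x0 : C, Cmod x0 = 1 / 2 /\
    forall s, 0 <= s <= 1 -> (x + RtoC s * (x0 - x))%C <> 1).
  { destruct (Req_dec (Im x) 0) as [E|N].
    - exists (0, 1 / 2). split.
      + replace ((0, 1 / 2) : C) with (RtoC (1 / 2) * Ci)%C by (apply C_eq; csimp_ring).
        rewrite Cmod_mult, Cmod_R, Cmod_Ci, Rabs_right; lra.
      + intros s Hs Q. apply Hx.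
        pose proof (f_equal Im Q) as QI.
        replace (Im (x + s * ((0, 1/2) - x))) with (Im x + s * (1 / 2 - Im x)) in QI by csimp_ring.
        rewrite E in QI. simpl in QI. assert (s = 0) as -> by lra.
        rewrite <- Q. ring.
    - exists (RtoC (1 / 2)). split.
      + rewrite Cmod_R, Rabs_right; lra.
      + intros s Hs Q.
        pose proof (f_equal Im Q) as QI. pose proof (f_equal Re Q) as QR.
        replace (Im (x + s * (RtoC (1/2) - x))) with ((1 - s) * Im x) in QI by csimp_ring.
        replace (Re (x + s * (RtoC (1/2) - x))) with (Re x + s * (1 / 2 - Re x)) in QR by csimp_ring.
        simpl in QI, QR. apply Rmult_integral in QI. destruct QI as [QI|]; [|auto].
        assert (s = 1) as -> by lra. lra. }
  destruct Start as (x0 & Hx0 & Hseg).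
  pose proof (Cmod_ge_0 (x0 - x)) as D0.
  (* Within parameter distance [e] of the start, moduli lie between 1/4 and 3/4. *)
  set (e := / (4 * (Cmod (x0 - x) + 1))).
  assert (He : 0 < e) by (apply Rinv_0_lt_compat; lra).
  assert (Ee : e * (4 * (Cmod (x0 - x) + 1)) = 1) by (unfold e; field; lra).
  assert (Z : H (x + RtoC 0 * (x0 - x))%C = 0).
  { apply (analytic_segment_zero H x (x0 - x)%C 0 1 e); try lra.
    - intros s Hs. apply AH. auto.
    - intros s Hs.
      assert (B : Cmod ((s - 1) * (x0 - x)) <= 1 / 4).
      { rewrite <- RtoC_minus, Cmod_mult, Cmod_R, Rabs_left by lra. nra. }
      set (p := (x + RtoC s * (x0 - x))%C).
      assert (Ep : p = (x0 + (s - 1) * (x0 - x))%C) by (unfold p; ring).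
      pose proof (Cmod_ge_minus x0 ((s - 1) * (x0 - x))) as B1.
      pose proof (Cmod_triangle x0 ((s - 1) * (x0 - x))) as B2.
      rewrite <- Ep in B1, B2.
      unfold H. rewrite (polylog_unit_disc Log); auto; try lra.
      + ring.
      + apply Cmod_gt_0. lra. }
  replace (x + RtoC 0 * (x0 - x))%C with x in Z by ring. unfold H in Z.
  replace (f x * (1 - x) ^ S m)%C with
    ((f x * (1 - x) ^ S m + - (1) * Li_neg_numerator m x) + Li_neg_numerator m x)%C by ring.
  rewrite Z. ring.
Qed.

Lemma polylog_Li_neg Log m f y : is_log_slit Log ->
  is_polylog_nonpos (- Z.of_nat m) f -> Cexp y <> 1 -> f (Cexp (- y)) = Li_neg m y.
Proof.
  intros HLog Hf Hy.
  assert (N1 : (1 - Cexp (- y))%C <> 0).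
  { intros Q. apply Hy. pose proof (Cexp_neq_0 y).
    replace (Cexp y) with (Cexp y * (1 - Cexp (- y)) + 1)%C.
    - rewrite Q. ring.
    - rewrite Cexp_opp. field. auto. }
  assert (Hx : Cexp (- y) <> 1) by (intros Q; apply N1; rewrite Q; ring).
  pose proof (polylog_numerator Log m f _ HLog Hf Hx) as E.
  rewrite Li_neg_numerator_eq in E by auto.
  pose proof (Cpow_nz _ (S m) N1) as P.
  replace (f (Cexp (- y))) with (f (Cexp (- y)) * (1 - Cexp (- y)) ^ S m / (1 - Cexp (- y)) ^ S m)%C
    by (field; auto).
  rewrite E. field. auto.
Qed.

(** * The remainder and its telescoping bound *)

Lemma Ctends_scal_0 k u : Ctends u 0 -> Ctends (fun n => k * u n)%C 0.
Proof.
  intros H. apply (Ctends_squeeze _ _ (fun n => Cmod k * Cmod (u n - 0)) 0).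
  - intros n _. rewrite <- Cmod_mult. right. f_equal. ring.
  - now apply is_lim_seq_scal_0.
Qed.

Lemma Ctends_plus_0 u v : Ctends u 0 -> Ctends v 0 -> Ctends (fun n => u n + v n)%C 0.
Proof. intros Hu Hv. rewrite <- (Cplus_0_r 0). now apply Ctends_plus. Qed.

Lemma Ctends_sum_n_m (u : nat -> nat -> C) m p : (forall k, Ctends (fun n => u k n) 0) ->
  Ctends (fun n => sum_n_m (fun k => u k n) m p) 0.
Proof.
  intros H. induction p as [|p IH].
  - destruct m as [|m].
    + apply (Ctends_ext (fun n => u 0%nat n)); auto. intros n. now rewrite sum_n_n.
    + apply (Ctends_ext (fun _ => RtoC 0)); [|apply Ctends_const].
      intros n. now rewrite sum_n_m_zero by lia.
  - destruct (Nat.le_gt_cases m (S p)) as [L|L].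
    + apply (Ctends_ext (fun n => sum_n_m (fun k => u k n) m p + u (S p) n)%C).
      * intros n. rewrite sum_n_Sm by auto. reflexivity.
      * apply Ctends_plus_0; auto.
    + apply (Ctends_ext (fun _ => RtoC 0)); [|apply Ctends_const].
      intros n. now rewrite sum_n_m_zero by lia.
Qed.

Lemma Cexp_2piI (m : Z) : Cexp (RtoC (2 * PI * IZR m) * Ci) = 1.
Proof.
  assert (S : sin (IZR m * PI) = 0) by (apply sin_eq_0_1; now exists m).
  unfold Cexp. replace (Re _) with 0 by csimp_ring.
  replace (Im _) with (2 * (IZR m * PI)) by csimp_ring.
  rewrite exp_0, cos_2a_sin, sin_2a, S. apply C_eq; csimp_ring.
Qed.

Lemma sum_n_m_Cminus (a b : nat -> C) N :
  sum_n_m (fun k => a k - b k)%C 1 N = (sum_n_m a 1 N - sum_n_m b 1 N)%C.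
Proof.
  induction N as [|N IH].
  - rewrite !sum_n_m_zero by lia. unfold zero; simpl. ring.
  - rewrite !sum_n_Sm, IH by lia. unfold plus; simpl. ring.
Qed.

Section Remainder.

Variables theta Y : R.
Hypothesis Htheta : Rabs theta < PI / 2.
Hypothesis HY : 0 < Y.
Hypothesis HYtheta : theta <> 0 -> Y < PI * Rabs (cos theta / sin theta).

Variables Log LogGamma : C -> C.
Hypothesis HLog : is_log_slit Log.
Hypothesis HLG : is_log_Gamma_slit LogGamma.
Variable c : nat -> R.
Hypothesis Hc : bernoulli_coefs c.

Variable beta : C.
Hypothesis Hbeta : has_arg beta theta.
Variables LogQ Li2 L1 : C -> C.
Hypothesis HQ : is_log_qpoch beta LogQ.
Hypothesis HLi : is_Li2_exp_branch beta Li2.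
Hypothesis HL1 : is_log_1m_exp_branch beta L1.

Lemma cos_theta_pos : 0 < cos theta.
Proof. apply cos_gt_0; apply Rabs_def2 in Htheta; lra. Qed.

Lemma Cmod_beta_Re : Re beta = Cmod beta * cos theta /\ 0 < Cmod beta /\
  beta = (RtoC (Cmod beta) * (cos theta, sin theta))%C.
Proof.
  destruct Hbeta as (r & Hr & E).
  assert (M : Cmod beta = r).
  { rewrite E. unfold Cmod; simpl.
    replace (_ + _) with (r ^ 2 * (Rsqr (sin theta) + Rsqr (cos theta))) by (unfold Rsqr; ring).
    rewrite sin2_cos2, Rmult_1_r. apply sqrt_pow2. lra. }
  rewrite M. repeat split; auto.
  - now rewrite E.
  - rewrite E. apply C_eq; csimp_ring.
Qed.

Lemma Re_beta_pos : 0 < Re beta.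
Proof.
  destruct Cmod_beta_Re as (E & H & _). rewrite E. apply Rmult_lt_0_compat; auto.
  apply cos_theta_pos.
Qed.

Lemma beta_neq_0 : beta <> 0.
Proof. apply Cmod_gt_0, Cmod_beta_Re. Qed.

(** What the telescoping along [y], [y + beta], [y + 2 beta], ... uses at each step;
    unlike the region itself it is preserved by these shifts. *)
Definition admissible (y : C) : Prop :=
  cut_domain beta y /\ slit_plane (y / beta) /\
  forall s, 0 <= s -> swept theta Y (y + RtoC s * beta) /\ (y + RtoC s * beta)%C <> 0.

Lemma admissible_add y s : 0 <= s -> admissible y -> admissible (y + RtoC s * beta).
Proof.
  intros Hs (H1 & H2 & H3). split; [|split].
  - now apply cut_domain_add.
  - replace ((y + RtoC s * beta) / beta)%C with (y / beta + RtoC s)%C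
      by (field; apply beta_neq_0).
    now apply slit_plane_plus.
  - intros t Ht. replace (y + RtoC s * beta + RtoC t * beta)%C with (y + RtoC (s + t) * beta)%C
      by (rewrite RtoC_plus; ring).
    apply H3. lra.
Qed.

Lemma admissible_of_region y : Rabs (Im y) <= PI -> - Y <= Re y -> ~ on_beta_ray beta y ->
  admissible y.
Proof.
  intros HI HR HB. destruct Cmod_beta_Re as (E1 & E2 & E3). pose proof beta_neq_0 as N.
  pose proof cos_theta_pos as Hcos.
  assert (SW : forall s, 0 <= s -> swept theta Y (y + RtoC s * beta)).
  { intros s Hs. exists y, (s * Cmod beta). repeat split; auto; [apply Rmult_le_pos; lra|].
    rewrite E3 at 1. rewrite RtoC_mult. ring. }
  assert (NZ : forall s, 0 <= s -> (y + RtoC s * beta)%C <> 0).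
  { intros s Hs E. apply HB. exists (- s). split; [lra|].
    replace y with (y + RtoC s * beta - RtoC s * beta)%C by ring. rewrite E, RtoC_opp. ring. }
  split; [|split; auto].
  - intros (m & t & Ht & E).
    assert (Es : (y + RtoC (- t) * beta)%C = (RtoC (2 * PI * IZR m) * Ci)%C)
      by (rewrite E, RtoC_opp; ring).
    destruct (swept_regular theta Y _ Htheta HY HYtheta (SW (- t) ltac:(lra)) (NZ (- t) ltac:(lra)))
      as [_ Q].
    apply Q. rewrite Es. apply Cexp_2piI.
  - intros (t & Ht & E). apply HB. exists t. split; auto.
    rewrite <- E. field. auto.
Qed.

(** The difference between the two sides of the expansion, after Stirling's
    main terms are absorbed into [stir_rem]. *)
Definition remainder (N : nat) (y : C) : C :=
  (LogQ y + Li2 y / beta - L1 y / 2 + stir_rem Log LogGamma (y / beta) +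
   sum_n_m (fun k => RtoC (c (2 * k)%nat) * (beta ^ (2 * k - 1) * polefree (2 * k - 2) y)) 1 N)%C.

(** The functional equations of [LogQ], [Li2'] = [L1] and the difference equation of
    [log Gamma] turn this difference into exactly one Euler-Maclaurin step for
    [log(1 - e^{-(y + s beta)}) - log(y/beta + s)], whose derivatives are [beta^j]
    times those of [1/(e^z - 1) - 1/z]. The primitive of [1/(1 + t^2)] makes the
    bounds telescope. *)
Lemma remainder_step N y (M : R) : admissible y -> 0 <= M ->
  (forall z, swept theta Y z -> z <> 0 -> Cmod (polefree (2 * N + 1) z) <= M / (1 + Re z ^ 2)) ->
  Cmod (remainder N y - remainder N (y + beta)) <=
  bpoly_bound c (2 * N + 2) * (M / cos theta * Cmod beta ^ (2 * N + 1)) *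
    (atan (Re y + Re beta) - atan (Re y)).
Proof.
  intros Hy HM HG. pose proof Re_beta_pos as Hrb. pose proof beta_neq_0 as Nb.
  destruct Cmod_beta_Re as (Eb & Pb & _). pose proof cos_theta_pos as Hcos.
  destruct (Hy) as (Hcut & Hslit & Hsw).
  set (w := (y / beta)%C) in *.
  set (K0 := M / cos theta * Cmod beta ^ (2 * N + 1)).
  set (f := fun j s => match j with
    | O => (L1 (y + RtoC s * beta) - Log (w + RtoC s * 1))%C
    | S m => (beta ^ j * polefree m (y + RtoC s * beta))%C end).
  set (F := fun s => (Li2 (y + RtoC s * beta) * / beta -
     ((w + RtoC s * 1) * Log (w + RtoC s * 1) - (w + RtoC s * 1)))%C).
  assert (Sl : forall s, 0 <= s -> slit_plane (w + RtoC s * 1)%C).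
  { intros s Hs. rewrite Cmult_1_r. now apply slit_plane_plus. }
  assert (Reg : forall s, 0 <= s -> regular (y + RtoC s * beta)%C).
  { intros s Hs. destruct (Hsw s Hs). now apply (swept_regular theta Y). }
  assert (Ws : forall s, (w + RtoC s * 1)%C = ((y + RtoC s * beta) / beta)%C).
  { intros s. unfold w. field. auto. }
  assert (DLog : forall s, 0 <= s -> Cderive (fun s => Log (w + RtoC s * 1)%C) s (/ (w + RtoC s * 1))%C).
  { intros s Hs. eapply Cderive_eq; [apply holo_line, Log_derive; auto|]. ring. }
  assert (Df : forall j s, 0 < s -> Cderive (f j) s (f (S j) s)).
  { intros [|j] s Hs.
    - unfold f. eapply Cderive_eq; [apply Cderive_minus; [apply L1_derive; auto|apply DLog; lra]|].
      rewrite Ws. unfold polefree, Li_neg. rewrite sum_Sn, sum_O. unfold plus; simpl.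
      destruct (Reg s ltac:(lra)) as [Nz _].
      field. auto.
    - unfold f. eapply Cderive_eq; [apply Cderive_scal, holo_line, holo_polefree, Reg; lra|].
      simpl Cpow. ring. }
  assert (DF : forall s, 0 <= s -> Cderive F s (f 0%nat s)).
  { intros s Hs. unfold F, f.
    apply (Cderive_ext (fun s => / beta * Li2 (y + RtoC s * beta) -
     ((w + RtoC s * 1) * Log (w + RtoC s * 1) - (w + RtoC s * 1)))%C); [intros; ring|].
    eapply Cderive_eq.
    - apply Cderive_minus; [apply Cderive_scal, (Li2_derive beta Hrb L1 HL1 Li2 HLi); auto|].
      apply Cderive_minus; [|apply Cderive_line].
      apply (Cderive_mult (fun s => (w + RtoC s * 1)%C)); [apply Cderive_line|apply DLog; auto].
    - cbv beta. pose proof (slit_plane_neq_0 _ (Sl s Hs)) as Nw.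
      rewrite Cmult_1_r in *. field. auto. }
  assert (Cf : forall j s, 0 <= s -> Ccont (f j) s).
  { intros [|j] s Hs.
    - apply Ccont_minus.
      + apply (L1_Ccont beta L1 HL1). now apply cut_domain_add.
      + apply (Log_Ccont_line Log HLog). auto.
    - eapply Ccont_of_Cderive. apply Cderive_scal, holo_line, holo_polefree, Reg; auto. }
  assert (DA : forall s, is_derive (fun s => K0 * atan (Re y + s * Re beta)) s
    (K0 * (Re beta * / (1 + (Re y + s * Re beta) ^ 2)))).
  { intros s. apply is_derive_scal. evar_last.
    - apply (is_derive_comp atan (fun s => Re y + s * Re beta)); [apply is_derive_atan|].
      auto_derive; auto.
    - unfold scal; simpl; unfold mult; simpl. unfold Rsqr. f_equal; [ring|]. f_equal. ring. }
  pose proof (euler_maclaurin_step c N f F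
    (fun s => K0 * atan (Re y + s * Re beta))
    (fun s => K0 * (Re beta * / (1 + (Re y + s * Re beta) ^ 2))) Hc) as Q.
  replace (remainder N y - remainder N (y + beta))%C with
    ((f 0%nat 0 + f 0%nat 1) / 2 -
    sum_n_m (fun k => RtoC (c (2 * k)%nat) * (f (2 * k - 1)%nat 1 - f (2 * k - 1)%nat 0)) 1 N
    - (F 1 - F 0))%C.
  - rewrite Rmult_assoc, Rmult_minus_distr_l.
    replace (Re y + Re beta) with (Re y + 1 * Re beta) by ring.
    replace (atan (Re y)) with (atan (Re y + 0 * Re beta)) by (f_equal; ring).
    apply Q.
    + intros s Hs. eapply Ccont_of_Cderive, DF; lra.
    + intros j s _ Hs. apply Cf; lra.
    + intros s _. apply derivable_continuous_pt. eexists. apply is_derive_Reals, DA.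
    + intros s Hs. apply DF; lra.
    + intros j s _ Hs. apply Df; lra.
    + intros s _. apply DA.
    + intros s Hs. replace (2 * N + 2)%nat with (S (2 * N + 1)) by lia.
      unfold f. rewrite Cmod_mult, Cmod_pow.
      destruct (Hsw s ltac:(lra)) as [SW NZ].
      pose proof (HG _ SW NZ) as B. rewrite Re_ray in B.
      apply Rle_trans with (Cmod beta ^ S (2 * N + 1) * (M / (1 + (Re y + s * Re beta) ^ 2))).
      * apply Rmult_le_compat_l; auto. apply pow_le; lra.
      * right. unfold K0. rewrite Eb.
        change (Cmod beta ^ S (2 * N + 1)) with (Cmod beta * Cmod beta ^ (2 * N + 1)).
        pose proof (pow2_ge_0 (Re y + s * (Cmod beta * cos theta))). field. split; lra.
  - unfold remainder.
    assert (LQ := LogQ_step beta Hrb L1 HL1 LogQ HQ y Hcut).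
    assert (SR := stir_rem_step Log HLog c Hc LogGamma HLG w Hslit).
    replace ((y + beta) / beta)%C with (w + 1)%C by (unfold w; field; auto).
    fold w.
    assert (ES : (sum_n_m (fun k => RtoC (c (2 * k)%nat) * (f (2 * k - 1)%nat 1 - f (2 * k - 1)%nat 0)) 1 N)%C
      = (sum_n_m (fun k => RtoC (c (2 * k)%nat) * (beta ^ (2 * k - 1) * polefree (2 * k - 2) (y + beta))) 1 N -
         sum_n_m (fun k => RtoC (c (2 * k)%nat) * (beta ^ (2 * k - 1) * polefree (2 * k - 2) y)) 1 N)%C).
    { rewrite <- sum_n_m_Cminus. apply sum_n_m_ext_loc. intros k Hk.
      replace (2 * k - 1)%nat with (S (2 * k - 2)) by lia.
      unfold f. replace (y + RtoC 0 * beta)%C with y by ring.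
      replace (y + RtoC 1 * beta)%C with (y + beta)%C by ring.
      match goal with |- ?a = ?b => change (@eq C a b) end. ring. }
    rewrite ES.
    set (S1 := sum_n_m _ 1 N). set (S0 := sum_n_m _ 1 N).
    rewrite LQ.
    replace (stir_rem Log LogGamma w) with (stir_rem Log LogGamma (w + 1) + stir_defect Log w)%C
      by (rewrite <- SR; ring).
    unfold stir_defect, stir, F, f.
    replace (y + RtoC 0 * beta)%C with y by ring.
    replace (y + RtoC 1 * beta)%C with (y + beta)%C by ring.
    replace (w + RtoC 0 * 1)%C with w by ring.
    replace (w + RtoC 1 * 1)%C with (w + 1)%C by ring.
    field. auto.
Qed.

Lemma admissible_add_nat y n : admissible y -> admissible (y + RtoC (INR n) * beta).
Proof. intros H. apply admissible_add; auto. apply pos_INR. Qed.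

Lemma remainder_telescope N y (M : R) n : admissible y -> 0 <= M ->
  (forall z, swept theta Y z -> z <> 0 -> Cmod (polefree (2 * N + 1) z) <= M / (1 + Re z ^ 2)) ->
  Cmod (remainder N y - remainder N (y + RtoC (INR n) * beta)) <=
  bpoly_bound c (2 * N + 2) * (M / cos theta * Cmod beta ^ (2 * N + 1)) *
    (atan (Re y + INR n * Re beta) - atan (Re y)).
Proof.
  intros Hy HM HG. induction n as [|n IH].
  - simpl INR. replace (y + RtoC 0 * beta)%C with y by ring.
    replace (remainder N y - remainder N y)%C with (RtoC 0) by ring.
    rewrite Cmod_0, Rmult_0_l, Rplus_0_r, Rminus_diag, Rmult_0_r. lra.
  - pose proof (remainder_step N _ M (admissible_add_nat y n Hy) HM HG) as Q.
    rewrite Re_ray in Q.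
    replace (y + RtoC (INR n) * beta + beta)%C with (y + RtoC (INR (S n)) * beta)%C in Q
      by (rewrite S_INR, RtoC_plus; ring).
    replace (Re y + INR n * Re beta + Re beta) with (Re y + INR (S n) * Re beta) in Q
      by (rewrite S_INR; ring).
    replace (remainder N y - remainder N (y + RtoC (INR (S n)) * beta))%C with
      ((remainder N y - remainder N (y + RtoC (INR n) * beta)) +
       (remainder N (y + RtoC (INR n) * beta) - remainder N (y + RtoC (INR (S n)) * beta)))%C by ring.
    eapply Rle_trans; [apply Cmod_triangle|]. lra.
Qed.

Lemma Re_ray_eventually y a : exists n0, forall n, (n0 <= n)%nat ->
  a <= Re (y + RtoC (INR n) * beta).
Proof.
  pose proof Re_beta_pos as Hrb.
  destruct (nfloor_ex ((Rabs a + Rabs (Re y)) / Re beta)) as [n0 Hn0].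
  { apply Rdiv_le_0_compat; auto. pose proof (Rabs_pos a); pose proof (Rabs_pos (Re y)); lra. }
  exists (S n0). intros n Hn. apply le_INR in Hn. rewrite S_INR in Hn. rewrite Re_ray.
  assert (H : (Rabs a + Rabs (Re y)) / Re beta * Re beta <= INR n * Re beta)
    by (apply Rmult_le_compat_r; lra).
  replace ((Rabs a + Rabs (Re y)) / Re beta * Re beta) with (Rabs a + Rabs (Re y)) in H by (field; lra).
  pose proof (Rle_abs a). pose proof (Rle_abs (- Re y)) as Q. rewrite Rabs_Ropp in Q. lra.
Qed.

Lemma Ctends_ray_0 (g : C -> C) M y : 0 <= M ->
  (forall z, 1 <= Re z -> Cmod (g z) <= M / Re z) ->
  Ctends (fun n => g (y + RtoC (INR n) * beta)%C) 0.
Proof.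
  intros HM Hg. pose proof Re_beta_pos as Hrb.
  destruct (Re_ray_eventually y 1) as [n0 Hn0].
  destruct (nfloor_ex (2 * Rabs (Re y) / Re beta)) as [n1 Hn1].
  { apply Rdiv_le_0_compat; auto. pose proof (Rabs_pos (Re y)); lra. }
  apply (Ctends_squeeze _ _ (fun n => 2 * M / Re beta * / (0 + INR n)) (n0 + S n1)).
  - intros n Hn. specialize (Hn0 n ltac:(lia)).
    assert (Hn' : INR n1 + 1 <= INR n) by (rewrite <- S_INR; apply le_INR; lia).
    replace (g (y + RtoC (INR n) * beta) - 0)%C with (g (y + RtoC (INR n) * beta)%C) by ring.
    eapply Rle_trans; [apply Hg, Hn0|]. rewrite Rplus_0_l.
    pose proof (pos_INR n1).
    replace (2 * M / Re beta * / INR n) with (M / (INR n * Re beta / 2)) by (field; lra).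
    unfold Rdiv. apply Rmult_le_compat_l; auto. apply Rinv_le_contravar.
    + assert (0 < INR n * Re beta) by (apply Rmult_lt_0_compat; lra). lra.
    + rewrite Re_ray.
      assert (A : 2 * Rabs (Re y) / Re beta * Re beta <= INR n * Re beta)
        by (apply Rmult_le_compat_r; lra).
      replace (2 * Rabs (Re y) / Re beta * Re beta) with (2 * Rabs (Re y)) in A by (field; lra).
      pose proof (Rle_abs (- Re y)) as Q. rewrite Rabs_Ropp in Q. lra.
  - apply is_lim_seq_scal_0, is_lim_seq_inv_INR.
Qed.

Lemma remainder_limit N y : admissible y ->
  Ctends (fun n => remainder N (y + RtoC (INR n) * beta)%C) 0.
Proof.
  intros Hy. pose proof Re_beta_pos as Hrb. pose proof beta_neq_0 as Nb.
  assert (EI : forall g M, 0 <= M -> (forall z, 1 <= Re z -> Cmod (g z) <= M * exp (- Re z)) ->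
    forall z, 1 <= Re z -> Cmod (g z) <= M / Re z).
  { intros g M HM Hg z Hz. eapply Rle_trans; [apply Hg, Hz|].
    unfold Rdiv. apply Rmult_le_compat_l; auto. apply exp_opp_le_inv. lra. }
  assert (TQ : Ctends (fun n => LogQ (y + RtoC (INR n) * beta)%C) 0).
  { apply is_lim_seq_spec. intros eps.
    destruct (proj2 HQ eps (cond_pos eps)) as [m Hm].
    destruct (Re_ray_eventually y (m + 1)) as [n0 Hn0]. exists n0. intros n Hn.
    rewrite Rminus_0_r, Rabs_right by (apply Rle_ge, Cmod_ge_0).
    replace (LogQ (y + RtoC (INR n) * beta) - 0)%C with (LogQ (y + RtoC (INR n) * beta)%C) by ring.
    apply Hm; [apply (admissible_add_nat y n Hy)|]. specialize (Hn0 n Hn). lra. }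
  assert (TLi : Ctends (fun n => Li2 (y + RtoC (INR n) * beta)%C) 0).
  { destruct (Li_series_bound 2 ltac:(lia)) as (M & HM & B).
    apply (Ctends_ray_0 _ M); auto. apply EI; auto. intros z Hz.
    rewrite (Li2_Li_series beta Li2 HLi) by lra. auto. }
  assert (TL1 : Ctends (fun n => L1 (y + RtoC (INR n) * beta)%C) 0).
  { destruct (L1_bound beta Hrb L1 HL1) as (M & HM & B).
    apply (Ctends_ray_0 _ M); auto. }
  assert (TG : forall m, Ctends (fun n => polefree m (y + RtoC (INR n) * beta)%C) 0).
  { intros m. destruct (polefree_bounded_right m) as (M & HM & B).
    apply (Ctends_ray_0 _ M); auto. intros z Hz. now apply B. }
  assert (TS : Ctends (fun n => stir_rem Log LogGamma ((y + RtoC (INR n) * beta) / beta)%C) 0).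
  { destruct (nfloor_ex (Rabs (Re (y / beta)))) as [n0 Hn0]; [apply Rabs_pos|].
    pose proof (Rle_abs (- Re (y / beta))) as Q. rewrite Rabs_Ropp in Q.
    apply (Ctends_squeeze _ _ (fun n => bpoly_bound c 2 * / (Re (y / beta) + INR n)) (S n0)).
    - intros n Hn. apply le_INR in Hn. rewrite S_INR in Hn.
      replace ((y + RtoC (INR n) * beta) / beta)%C with (y / beta + RtoC (INR n))%C by (field; auto).
      set (w := (y / beta)%C) in *.
      replace (stir_rem Log LogGamma (w + RtoC (INR n)) - 0)%C with
        (stir_rem Log LogGamma (w + RtoC (INR n))) by ring.
      assert (E : Re (w + RtoC (INR n)) = Re w + INR n) by csimp_ring.
      rewrite <- E. apply (stir_rem_bound Log HLog c Hc LogGamma HLG). rewrite E. lra.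
    - apply is_lim_seq_scal_0, is_lim_seq_inv_INR. }
  unfold remainder.
  apply (Ctends_ext (fun n => LogQ (y + RtoC (INR n) * beta) + (/ beta * Li2 (y + RtoC (INR n) * beta)
     + (- (1) / 2 * L1 (y + RtoC (INR n) * beta) + (stir_rem Log LogGamma ((y + RtoC (INR n) * beta) / beta) +
     sum_n_m (fun k => (RtoC (c (2 * k)%nat) * beta ^ (2 * k - 1)) * polefree (2 * k - 2) (y + RtoC (INR n) * beta)) 1 N))))%C).
  - intros n. rewrite (sum_n_m_ext _ (fun k => RtoC (c (2 * k)%nat) *
      (beta ^ (2 * k - 1) * polefree (2 * k - 2) (y + RtoC (INR n) * beta)))%C).
    + field. auto.
    + intros k. symmetry. apply Cmult_assoc.
  - apply Ctends_plus_0; [exact TQ|].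
    apply Ctends_plus_0; [now apply Ctends_scal_0|].
    apply Ctends_plus_0; [now apply Ctends_scal_0|].
    apply Ctends_plus_0; [exact TS|].
    apply (Ctends_sum_n_m (fun k n => RtoC (c (2 * k)%nat) * beta ^ (2 * k - 1) * polefree (2 * k - 2) (y + RtoC (INR n) * beta))%C).
    intros k. now apply Ctends_scal_0.
Qed.

Lemma remainder_bound N y (M : R) : admissible y -> 0 <= M ->
  (forall z, swept theta Y z -> z <> 0 -> Cmod (polefree (2 * N + 1) z) <= M / (1 + Re z ^ 2)) ->
  Cmod (remainder N y) <= bpoly_bound c (2 * N + 2) * (M / cos theta) * PI * Cmod beta ^ (2 * N + 1).
Proof.
  intros Hy HM HG. pose proof cos_theta_pos as Hcos.
  replace (remainder N y) with (remainder N y - 0)%C by ring.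
  apply (Cmod_limit_le _ _ _ _ 0 (remainder_limit N y Hy)). intros n _.
  eapply Rle_trans; [apply (remainder_telescope N y M n); auto|].
  replace (bpoly_bound c (2 * N + 2) * (M / cos theta) * PI * Cmod beta ^ (2 * N + 1)) with
    (bpoly_bound c (2 * N + 2) * (M / cos theta * Cmod beta ^ (2 * N + 1)) * PI) by ring.
  apply Rmult_le_compat_l.
  - apply Rmult_le_pos.
    + eapply Rle_trans; [apply Rabs_pos|]. apply (bpoly_bounded c (2 * N + 2) 0). lra.
    + apply Rmult_le_pos; [apply Rdiv_le_0_compat; auto|]. apply pow_le, Cmod_ge_0.
  - pose proof (atan_bound (Re y + INR n * Re beta)). pose proof (atan_bound (Re y)). lra.
Qed.

End Remainder.

Theorem corollary2 :
  forall (theta Y : R),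
    Rabs theta < PI / 2 ->
    0 < Y ->
    (theta <> 0 -> Y < PI * Rabs (cos theta / sin theta)) ->
  forall N : nat, (1 <= N)%nat ->
  exists D : R,
  forall (B : nat -> R) (Li : Z -> C -> C) (Log LogGamma : C -> C),
    is_bernoulli B ->
    (forall n : Z, (n <= 0)%Z -> is_polylog_nonpos n (Li n)) ->
    is_log_slit Log ->
    is_log_Gamma_slit LogGamma ->
  forall (beta : C) (LogQ Li2exp Log1mexp : C -> C),
    has_arg beta theta ->
    is_log_qpoch beta LogQ ->
    is_Li2_exp_branch beta Li2exp ->
    is_log_1m_exp_branch beta Log1mexp ->
  forall y : C,
    Rabs (Im y) <= PI ->
    - Y <= Re y ->
    ~ on_beta_ray beta y ->
    Cmod (LogQ y -
      (- Li2exp y / beta + Log1mexp y / 2 + RtoC (ln (2 * PI)) / 2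
       - y / beta + (y / beta - 1 / 2) * Log (y / beta) - LogGamma (y / beta)
       - sum_n_m (fun k : nat =>
           RtoC (B (2 * k)%nat) * Cpow beta (2 * k - 1) / RtoC (INR (fact (2 * k)))
           * (Li (2 - 2 * Z.of_nat k)%Z (Cexp (- y))
              - RtoC (INR (fact (2 * k - 2))) / Cpow y (2 * k - 1))) 1 N))%C
    <= D * Cmod beta ^ (2 * N + 1).
Proof.
  intros theta Y Ht HY HYt N HN.
  (* The constant must not depend on [B]: the generating function determines the
     Bernoulli numbers, so any one sequence [B0] serves. *)
  destruct (classic (exists B0, is_bernoulli B0)) as [[B0 HB0]|NB].
  2: { exists 0. intros B Li Log LogGamma HB. exfalso. apply NB. now exists B. }
  destruct (polefree_bounded_swept theta Y (2 * N + 1) Ht HY HYt ltac:(lia)) as (M & HM & HG).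
  set (c := fun k => B0 k / INR (fact k)).
  exists (bpoly_bound c (2 * N + 2) * (M / cos theta) * PI).
  intros B Li Log LogGamma HB HLi HLog HLG beta LogQ Li2 L1 Hbeta HQ HLi2 HL1 y HI HR Hray.
  assert (Hc : bernoulli_coefs c) by now apply bernoulli_coefs_of.
  pose proof (admissible_of_region theta Y Ht HY HYt beta Hbeta y HI HR Hray) as Hy.
  pose proof (beta_neq_0 theta beta Hbeta) as Nb.
  pose proof (remainder_bound theta Y Ht HY HYt Log LogGamma HLog HLG c Hc beta Hbeta
    LogQ Li2 L1 HQ HLi2 HL1 N y M Hy HM HG) as Q.
  match goal with |- Cmod ?e <= _ => replace e with
    (remainder Log LogGamma c beta LogQ Li2 L1 N y); [exact Q|] end.
  destruct Hy as (_ & _ & Hsw). destruct (Hsw 0 ltac:(lra)) as [SW NZ].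
  replace (y + RtoC 0 * beta)%C with y in SW, NZ by ring.
  destruct (swept_regular theta Y y Ht HY HYt SW NZ) as [_ Hexp].
  unfold remainder, stir_rem, stir.
  rewrite (sum_n_m_ext_loc _ (fun k : nat =>
           RtoC (B (2 * k)%nat) * Cpow beta (2 * k - 1) / RtoC (INR (fact (2 * k)))
           * (Li (2 - 2 * Z.of_nat k)%Z (Cexp (- y))
              - RtoC (INR (fact (2 * k - 2))) / Cpow y (2 * k - 1)))%C).
  - set (S1 := sum_n_m _ 1 N). rewrite RtoC_div by lra. field. auto.
  - intros k Hk. unfold c. rewrite (bernoulli_unique B0 B HB0 HB).
    assert (F : INR (fact (2 * k)) <> 0) by apply INR_fact_neq_0.
    rewrite RtoC_div by auto.
    assert (EL : Li (2 - 2 * Z.of_nat k)%Z (Cexp (- y)) = Li_neg (2 * k - 2) y).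
    { replace (2 - 2 * Z.of_nat k)%Z with (- Z.of_nat (2 * k - 2))%Z by lia.
      apply (polylog_Li_neg Log); auto. apply HLi. lia. }
    rewrite EL. unfold polefree.
    replace ((-1) ^ (2 * k - 2))%C with (RtoC 1).
    + replace (S (2 * k - 2)) with (2 * k - 1)%nat by lia.
      match goal with |- ?a = ?b => change (@eq C a b) end.
      field. split; [now apply Cpow_nz|now apply RtoC_neq].
    + replace (2 * k - 2)%nat with (2 * (k - 1))%nat by lia.
      rewrite <- RtoC_pow, pow_1_even. reflexivity.
Qed.
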